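(* There exists an absolute constant $C>0$ such that the following holds. Suppose that $m\ge C\beta\,\mathbf r(\Sigma_0)$ and that $$R:=\sup_{\|\mathbf v\|_2\le 1}\frac{\sqrt{\mathbb E\langle Z,\mathbf v\rangle^4}}{\mathbb E\langle Z,\mathbf v\rangle^2}<\infty,\qquad Z:=X-\mu_0 .$$ Then $$\left\|\widehat\Sigma_\ast-\Sigma_0\right\|\le 18R\,\|\Sigma_0\|\sqrt{\frac{\mathbf r(\Sigma_0)\beta}{m}}$$ with probability at least $1-5d\log_2\left(\frac{2\sigma_{\max}}{\sigma_{\min}}\right)e^{-\beta}$.
   Context: Let $X\in\mathbb R^d$ be a random vector with mean $\mu_0=\mathbb E X$, covariance matrix $\Sigma_0=\mathbb E[(X-\mu_0)(X-\mu_0)^T]\neq 0$, and $\mathbb E\|X-\mu_0\|_2^4<\infty$; let $X_1,\dots,X_m$ be i.i.d. copies of $X$. $\|\cdot\|$ is the operator norm of a matrix and $\|\cdot\|_2$ the Euclidean norm. Let $\sigma_0\ge 0$ be given by $\sigma_0^2:=\left\|\mathbb E\left[\|X-\mu_0\|_2^2(X-\mu_0)(X-\mu_0)^T\right]\right\|$. The effective rank of $\Sigma_0$ is $\mathbf r(\Sigma_0)=\mathrm{tr}(\Sigma_0)/\|\Sigma_0\|$. In the supremum defining $R$, only $\mathbf v$ with $\mathbb E\langle Z,\mathbf v\rangle^2>0$ are considered. Let $\psi(x)=(|x|\wedge 1)\,\mathrm{sign}(x)$, $x\in\mathbb R$. For a real function $f$ and a symmetric matrix $A=U\Lambda U^T$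 with $\Lambda=\mathrm{diag}(\lambda_1,\dots,\lambda_d)$, $f(A):=U\,\mathrm{diag}(f(\lambda_1),\dots,f(\lambda_d))\,U^T$. Mean estimator: let $1<\beta<\infty$ and $k_0=\lfloor 3.5\beta\rfloor+1$, and assume $k_0\le m/2$. Divide the sample $X_1,\dots,X_m$ into $k_0$ disjoint groups $G_1,\dots,G_{k_0}$ (of indices) of size $\lfloor m/k_0\rfloor$ each, put $\hat\mu_j=\frac1{|G_j|}\sum_{i\in G_j}X_i$, and let $\hat\mu$ be the geometric median of $\hat\mu_1,\dots,\hat\mu_{k_0}$, i.e. a minimizer of $z\mapsto\sum_{j=1}^{k_0}\|z-\hat\mu_j\|_2$ over $z\in\mathbb R^d$. Adaptive covariance estimator: let $0<\sigma_{\min}\le\sigma_0\le\sigma_{\max}$ be known bounds. Set $\sigma_j:=\sigma_{\min}2^j$ and $\mathcal J=\{j\in\mathbb Z:\ \sigma_{\min}\le\sigma_j<2\sigma_{\max}\}$. For $j\in\mathcal J$ let $\theta_j=\frac1{\sigma_j}\sqrt{\frac\beta m}$ and $$\widehat\Sigma_{m,j}=\frac1{m\theta_j}\sum_{i=1}^m\psi\left(\theta_j(X_i-\hat\mu)(X_i-\hat\mu)^T\right).$$ Let $$j_\ast:=\min\left\{j\in\mathcal J:\ \forall k\in\mathcal J\text{ with }k>j,\ \left\|\widehat\Sigma_{m,k}-\widehat\Sigma_{m,j}\right\|\le 6\sigma_k\sqrt{\frac\beta m}\right\},\qquad \widehat\Sigma_\ast:=\widehat\Sigma_{m,j_\ast}.$$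 *)

(* Defs.v *)
From HB Require Import structures.
From mathcomp Require Import all_boot all_order all_algebra.
From mathcomp Require Import all_classical all_reals all_analysis.
Set Implicit Arguments.
Unset Strict Implicit.
Unset Printing Implicit Defensive.
Import Order.TTheory GRing.Theory Num.Theory.
Import numFieldNormedType.Exports.
Local Open Scope classical_set_scope.
Local Open Scope ring_scope.

(* The norm [`|x|] that the library puts on matrices is the sup norm, hence
   the following two definitions. *)
Definition norm2 (R : realType) (d : nat) (x : 'cV[R]_d) : R :=
  Num.sqrt (\sum_i x i 0 ^+ 2).

Definition opnorm (R : realType) (d : nat) (A : 'M[R]_d) : R :=
  sup [set norm2 (A *m v) | v in [set v : 'cV[R]_d | norm2 v <= 1]].

Definition inner (R : realType) (d : nat) (x y : 'cV[R]_d) : R :=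
  \sum_i x i 0 * y i 0.

Definition psi (R : realType) (x : R) : R := Num.min `|x| 1 * Num.sg x.

(* [f(A) = U diag(f(lambda)) U^T] whenever [A = U diag(lambda) U^T] with [U]
   orthogonal.  Such a decomposition exists for every symmetric [A], and the
   value does not depend on it; [0] is a default for non-symmetric [A]. *)
Definition is_mxfun (R : realType) (d : nat) (f : R -> R) (A B : 'M[R]_d) :=
  exists (U : 'M[R]_d) (lam : 'rV[R]_d),
    [/\ U *m U^T = 1%:M,
        A = U *m diag_mx lam *m U^T
      & B = U *m diag_mx (map_mx f lam) *m U^T].

Definition mxfun (R : realType) (d : nat) (f : R -> R) (A : 'M[R]_d) : 'M[R]_d :=
  xget 0 [set B | is_mxfun f A B].

(* Column vectors with their Borel sigma-algebra. *)
Notation bvec R d := (g_sigma_algebraType (@open 'cV[R]_d)).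

Definition random_vector (R : realType) (disp : measure_display)
    (T : measurableType disp) (d : nat) (X : T -> 'cV[R]_d) : Prop :=
  measurable_fun [set: T] (X : T -> bvec R d).

Definition identically_distributed (R : realType) (disp : measure_display)
    (T : measurableType disp) (P : probability T R) (d : nat)
    (X Y : T -> 'cV[R]_d) : Prop :=
  forall A : set (bvec R d), measurable A -> P (X @^-1` A) = P (Y @^-1` A).

Definition independent_vectors (R : realType) (disp : measure_display)
    (T : measurableType disp) (P : probability T R) (d m : nat)
    (X : 'I_m -> T -> 'cV[R]_d) : Prop :=
  forall (S : {set 'I_m}) (A : 'I_m -> set (bvec R d)),
    (forall i, measurable (A i)) ->
    P (\bigcap_(i in [set` S]) (X i @^-1` A i)) =
    (\prod_(i in S) P (X i @^-1` A i))%E.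

(* The [Xs i] are i.i.d. copies of the random vector [X]. *)
Definition iid_copies (R : realType) (disp : measure_display)
    (T : measurableType disp) (P : probability T R) (d m : nat)
    (X : T -> 'cV[R]_d) (Xs : 'I_m -> T -> 'cV[R]_d) : Prop :=
  [/\ forall i, random_vector (Xs i),
      forall i, identically_distributed P (Xs i) X
    & independent_vectors P Xs].

(* Entrywise expectation.  [fine] sends an infinite expectation to [0]; this
   does not occur below, where fourth moments are assumed finite.  (Were some
   coordinate of [X] not integrable, [X - c] would have an infinite fourth
   moment for every constant vector [c], so the moment assumption also
   guarantees that the mean exists.) *)
Definition expectation_mx (R : realType) (disp : measure_display)
    (T : measurableType disp) (P : probability T R) (p q : nat)
    (M : T -> 'M[R]_(p, q)) : 'M[R]_(p, q) :=
  \matrix_(i, j) fine 'E_P[fun w => M w i j]%E.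

Section Population.
Context (R : realType) (disp : measure_display) (T : measurableType disp).
Context (P : probability T R) (d : nat) (X : T -> 'cV[R]_d).

Definition mean : 'cV[R]_d := expectation_mx P X.

Definition centered (w : T) : 'cV[R]_d := X w - mean.

Definition covariance_mx : 'M[R]_d :=
  expectation_mx P (fun w => centered w *m (centered w)^T).

Definition fourth_moment : \bar R :=
  'E_P[fun w => (norm2 (centered w) ^+ 4)%R]%E.

Definition sigma0 : R :=
  Num.sqrt (opnorm (expectation_mx P
    (fun w => norm2 (centered w) ^+ 2 *: (centered w *m (centered w)^T)))).

Definition marginal_moment (v : 'cV[R]_d) (k : nat) : R :=
  fine 'E_P[fun w => (inner (centered w) v ^+ k)%R]%E.

Definition kurtosis_sup : \bar R :=
  ereal_sup [set (Num.sqrt (marginal_moment v 4) / marginal_moment v 2)%:E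
            | v in [set v : 'cV[R]_d |
                     norm2 v <= 1 /\ 0 < marginal_moment v 2]].

End Population.

Definition effective_rank (R : realType) (d : nat) (A : 'M[R]_d) : R :=
  \tr A / opnorm A.

(* [Num.truncn] is the floor on nonnegative reals. *)
Definition nb_groups (R : realType) (beta : R) : nat :=
  (Num.truncn (7%:R / 2%:R * beta)).+1.

(* Disjoint groups of indices, each of size [floor (m / k)]; when [k] does not
   divide [m] some indices belong to no group. *)
Definition is_grouping (m k : nat) (G : 'I_k -> {set 'I_m}) : Prop :=
  (forall j, #|G j| = (m %/ k)%N) /\
  (forall j l, j != l -> [disjoint G j & G l]%bool).

Definition group_mean (R : realType) (d m : nat) (x : 'I_m -> 'cV[R]_d)
    (S : {set 'I_m}) : 'cV[R]_d :=
  (#|S|%:R)^-1 *: \sum_(i in S) x i.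

Definition is_geometric_median (R : realType) (d k : nat)
    (x : 'I_k -> 'cV[R]_d) (z : 'cV[R]_d) : Prop :=
  forall y : 'cV[R]_d, \sum_j norm2 (z - x j) <= \sum_j norm2 (y - x j).

Section Estimator.
Context (R : realType) (d m : nat) (beta smin smax : R).

Definition sigma_grid (j : int) : R := smin * 2%:R ^ j.

Definition grid : set int :=
  [set j | smin <= sigma_grid j < 2%:R * smax].

Definition theta (j : int) : R :=
  (sigma_grid j)^-1 * Num.sqrt (beta / m%:R).

(* [x] is the sample and [mu] the value of the mean estimator. *)
Definition cov_est (x : 'I_m -> 'cV[R]_d) (mu : 'cV[R]_d) (j : int) : 'M[R]_d :=
  (m%:R * theta j)^-1 *:
    \sum_i mxfun (@psi R) (theta j *: ((x i - mu) *m (x i - mu)^T)).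

Definition admissible (x : 'I_m -> 'cV[R]_d) (mu : 'cV[R]_d) : set int :=
  [set j | grid j /\
     forall k, grid k -> j < k ->
       opnorm (cov_est x mu k - cov_est x mu j)
         <= 6%:R * sigma_grid k * Num.sqrt (beta / m%:R)].

(* The minimum of [admissible x mu].  It exists as soon as
   [0 < smin <= smax]: [grid] is then finite and nonempty, and its largest
   element is admissible. *)
Definition jstar (x : 'I_m -> 'cV[R]_d) (mu : 'cV[R]_d) : int :=
  xget 0 [set j | admissible x mu j /\ forall k, admissible x mu k -> j <= k].

Definition cov_adaptive (x : 'I_m -> 'cV[R]_d) (mu : 'cV[R]_d) : 'M[R]_d :=
  cov_est x mu (jstar x mu).

End Estimator.

(* Main.v *)
Require Import Defs.
From HB Require Import structures.
From mathcomp Require Import all_boot all_order all_algebra.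
From mathcomp Require Import all_classical all_reals all_analysis.
From mathcomp Require Import complex spectral measurable_realfun ring lra zify.
Import Order.TTheory GRing.Theory Num.Theory.
Import numFieldNormedType.Exports.
Local Open Scope classical_set_scope.
Local Open Scope ring_scope.

(** Why the bound holds.

Applied to the rank-one matrix [theta y y^T], the truncation [psi] replaces
[y] by its projection [clip B y] onto the ball of radius [B = theta^(-1/2)]
([mxfun_psi_outer]).  Each estimator is thus the empirical second moment of
clipped vectors, and only its quadratic forms at unit vectors matter.

Concentration.  Fix a level [sigma >= sigma0], put [eps = sqrt (beta / m)]
and [s = sigma eps].  The sum of the rank-one matrices of the clipped centered
sample, minus its compensator, is a matrix random walk, whose potential is
the trace of the exponential.  Two facts control one step: Klein's inequality
([klein_expR]), and a comparison of the exponentials of two matrices that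
differ by a rank-one matrix ([mxexp_rank1_secant]), which in the two
eigenbases is a scalar convexity inequality summed termwise.  They give
[matrix_upper_step] and [matrix_lower_step]; since the trace dominates the
exponential of every quadratic form, Markov's inequality then bounds all
directions at once, with only the dimension as a loss
([clipped_covariance_upper], [clipped_covariance_lower]).  Each side
exceeds [5 / 2 s] with probability at most [d e^(-beta)].

Centering.  The mean estimator replaces the mean.  Most blocks have a
block mean close to the mean, by Chebyshev's inequality in each block and
independence between blocks, and the geometric median follows the majority
([geometric_median_deviation]).  Shifting the data by a small vector before
clipping changes a quadratic form by a term proportional to the clipped sample
mean, and by a term for the points near or outside the sphere
([clip_shift_quad]).  The former is small by another block argument
([clipped_mean_le]); the latter is controlled by the difference of the
quadratic forms at radii [B] and [B / 2], both of which concentrate around the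
same value.  Altogether ([level_deviation]) every level has error at most
[2.76 s + 0.25 e |Sigma|], where [e^2 = r(Sigma) beta / m] is as small as the
absolute constant demands.

Selection.  Let [st = K |Sigma| e] with [K] the kurtosis bound.  The
Cauchy-Schwarz inequality gives [sigma0 eps <= st] and [e |Sigma| <= st]
([sigma0_le_kurtosis], [kurtosis_ge1]).  Hence some level [i0 >= sigma0] has
noise at most [2 st] and passes all tests: the first one whose noise reaches
[st], or the last one of the grid.  The selected level is not above [i0], so
its error is at most [6 * 2 st] plus the error at [i0], less than [18 st]
([lepski_error]).  The failure probabilities of the levels add up to the
announced one ([failure_budget]). *)

Set Implicit Arguments.
Unset Strict Implicit.
Unset Printing Implicit Defensive.


(** * Spectral theorem for real symmetric matrices *)

(** Over the complex numbers the matrix is hermitian, so that its spectrum is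
    real; a real root of the characteristic polynomial is an eigenvalue over
    the reals. *)
Lemma symmetric_eigenvalue (R : rcfType) (n : nat) (A : 'M[R]_n.+1) :
  A^T = A -> exists a, eigenvalue A a.
Proof.
move=> sA; pose C : numClosedFieldType := R[i].
pose f : {rmorphism R -> R[i]} := real_complex R.
pose B : 'M[R[i]]_n.+1 := map_mx f A.
have hB : B \is hermsymmx.
  apply: realsym_hermsym.
    apply/is_hermitianmxP; rewrite expr0 scale1r map_mx_id //.
    by rewrite /B map_trmx sA.
  apply/mxOverP => i j; rewrite mxE; apply/complex_realP; by exists (A i j).
have rd := hermitian_spectral_diag_real hB.
have /orthomx_spectralP BE := hermitian_normalmx hB.
set P := spectralmx B in BE; set D := spectral_diag B in rd BE.
have Pu : P \in unitmx by exact: spectral_unit.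
have /mxOverP/(_ 0 0)/complex_realP [a Da] := rd.
exists a; rewrite eigenvalue_root_char.
rewrite -(fmorph_root f) /= map_char_poly -/B -eigenvalue_root_char.
apply/eigenvalueP; exists (row 0 P).
  rewrite [X in _ *m X]BE -row_mul !mulmxA mulmxV // mul1mx.
  by rewrite row_mul row_diag_mx -scalemxAl -rowE Da.
apply/eqP => /(congr1 (mulmx^~ (invmx P))); rewrite -row_mul mulmxV // mul0mx.
by move/rowP/(_ 0); rewrite !mxE eqxx => /eqP; rewrite oner_eq0.
Qed.

Lemma sqnorm_row_eq0 (R : rcfType) (n : nat) (u : 'rV[R]_n) :
  ((u *m u^T) 0 0 == 0) = (u == 0).
Proof.
apply/eqP/eqP => [|->]; last by rewrite mul0mx mxE.
rewrite mxE => /psumr_eq0P h; apply/rowP => i; rewrite !mxE; apply/eqP.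
have := h _ i isT; rewrite mxE => /(_ _)/eqP; rewrite mulf_eq0 orbb; apply.
by move=> j _; rewrite mxE -expr2 sqr_ge0.
Qed.

(** Householder: the reflection in the hyperplane orthogonal to
    [u - |u| e] exchanges [u] and [|u| e], where [e] is the first basis vector. *)
Lemma orthogonal_completion (R : rcfType) (n : nat) (u : 'rV[R]_n.+1) :
  u != 0 -> exists (H : 'M[R]_n.+1) (c : R),
    [/\ H *m H^T = 1%:M, c != 0 & u *m H = c *: delta_mx 0 0].
Proof.
move=> u0; pose c := Num.sqrt ((u *m u^T) 0 0).
have ge0 (x : 'rV[R]_n.+1) : 0 <= (x *m x^T) 0 0.
  by rewrite mxE sumr_ge0 // => i _; rewrite mxE -expr2 sqr_ge0.
have c0 : 0 < c by rewrite sqrtr_gt0 lt_def ge0 sqnorm_row_eq0 u0.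
have cc : c ^+ 2 = (u *m u^T) 0 0 by rewrite sqr_sqrtr.
pose e : 'rV[R]_n.+1 := delta_mx 0 0.
pose w : 'rV[R]_n.+1 := u - c *: e.
have uE : u = w + c *: e by rewrite /w subrK.
have [w0|w0] := eqVneq w 0.
  exists 1%:M, c; split; rewrite ?trmx1 ?mulmx1 ?gt_eqF //.
  by rewrite uE w0 add0r.
have one (x : 'M[R]_1) : x = (x 0 0)%:M.
  by apply/matrixP => i j; rewrite !ord1 [RHS]mxE eqxx mulr1n.
pose s : R := (w *m w^T) 0 0.
have s0 : s != 0 by rewrite sqnorm_row_eq0.
have ee : (e *m e^T) 0 0 = 1 by rewrite trmx_delta mul_delta_mx mxE !eqxx.
have eu : (e *m u^T) 0 0 = (u *m e^T) 0 0.
  by rewrite !mxE; apply: eq_bigr => i _; rewrite !mxE mulrC.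
(* [2 <u, w> = |w|^2] because [u] and [c *: e] have the same norm *)
have uw : (u *m w^T) 0 0 = s / 2.
  have wT : w^T = u^T - c *: e^T by rewrite /w linearB /= linearZ.
  have uwE : (u *m w^T) 0 0 = c ^+ 2 - c * (u *m e^T) 0 0.
    rewrite wT mulmxBr -scalemxAr cc.
    by rewrite [LHS]mxE [in X in _ + X]mxE [in X in _ + X]mxE.
  have ewE : (e *m w^T) 0 0 = (u *m e^T) 0 0 - c.
    rewrite wT mulmxBr -scalemxAr.
    by rewrite [LHS]mxE [in X in _ + X]mxE [in X in _ + X]mxE ee mulr1 eu.
  have sE : s = (u *m w^T) 0 0 - c * (e *m w^T) 0 0.
    rewrite /s {1}/w mulmxBl -scalemxAl.
    by rewrite [LHS]mxE [in X in _ + X]mxE [in X in _ + X]mxE.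
  by rewrite sE uwE ewE; field.
pose H : 'M[R]_n.+1 := 1%:M - (2 / s) *: (w^T *m w).
have HT : H^T = H.
  by rewrite /H linearB /= trmx1 linearZ /= trmx_mul trmxK.
exists H, c; split; first last.
- rewrite /H mulmxBr mulmx1 -scalemxAr mulmxA [u *m w^T]one uw.
  rewrite mul_scalar_mx scalerA {1}uE (_ : 2 / s * (s / 2) = 1); last by field.
  by rewrite scale1r addrAC subrr add0r.
- by rewrite gt_eqF.
have WW : (w^T *m w) *m (w^T *m w) = s *: (w^T *m w).
  by rewrite mulmxA -(mulmxA w^T) [w *m w^T]one -/s mul_mx_scalar -scalemxAl.
rewrite HT /H mulmxBr !mulmxBl mulmx1 mul1mx -!scalemxAr -!scalemxAl mulmx1.
rewrite WW !scalerA -addrA -opprD -scalerBl.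
rewrite -scalerDl (_ : 2 / s + _ = 0) ?scale0r ?subr0 //.
by field.
Qed.

(** Deflation: conjugating by a reflection that moves an eigenvector to the
    first axis leaves a symmetric block of smaller size. *)
Theorem real_spectral (R : rcfType) (n : nat) (A : 'M[R]_n) : A^T = A ->
  exists (U : 'M[R]_n) (lam : 'rV[R]_n),
    U *m U^T = 1%:M /\ A = U *m diag_mx lam *m U^T.
Proof.
elim: n A => [|n IH] A sA.
  by exists 1%:M, 0; split; apply/matrixP => -[].
have [a /eigenvalueP [u uA u0]] := symmetric_eigenvalue sA.
have [H [c [HH c0 uH]]] := orthogonal_completion u0.
have HH' : H^T *m H = 1%:M by exact: mulmx1C.
have sB : (H^T *m A *m H)^T = H^T *m A *m H.
  by rewrite !trmx_mul trmxK sA mulmxA.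
have B0 : delta_mx 0 0 *m (H^T *m A *m H) = a *: (delta_mx 0 0 : 'rV[R]_n.+1).
  have -> : (delta_mx 0 0 : 'rV[R]_n.+1) = c^-1 *: (u *m H).
    by rewrite uH scalerA mulVf // scale1r.
  rewrite -!scalemxAl !mulmxA -(mulmxA u) HH mulmx1 uA -scalemxAl.
  by rewrite scalerA mulrC -scalerA.
set B := H^T *m A *m H in sB B0.
have AE : A = H *m B *m H^T.
  by rewrite /B !mulmxA HH mul1mx -!mulmxA HH mulmx1.
clearbody B.
have BE : B = block_mx (a%:M : 'M[R]_1) 0 0 (drsubmx (B : 'M[R]_(1 + n))).
  have B0j j : B 0 j = a * (j == 0)%:R.
    by have /rowP/(_ j) := B0; rewrite -rowE !mxE.
  have Bi0 i : B i 0 = a * (i == 0)%:R.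
    by rewrite -sB mxE B0j.
  have l0 : lshift n 0 = 0 :> 'I_(1 + n) by exact/val_inj.
  have r0 j : (rshift 1 j == 0 :> 'I_(1 + n)) = false by rewrite -val_eqE.
  have ul : ulsubmx (B : 'M[R]_(1 + n)) = a%:M.
    by apply/matrixP => i j; rewrite !mxE !ord1 l0 B0j eqxx mulr1 mulr1n.
  have ur : ursubmx (B : 'M[R]_(1 + n)) = 0.
    by apply/matrixP => i j; rewrite !mxE !ord1 l0 B0j r0 mulr0.
  have dl : dlsubmx (B : 'M[R]_(1 + n)) = 0.
    by apply/matrixP => i j; rewrite !mxE !ord1 l0 Bi0 r0 mulr0.
  by rewrite -ul -ur -dl (submxK (B : 'M[R]_(1 + n))).
have sB' : (drsubmx (B : 'M[R]_(1 + n)))^T = drsubmx (B : 'M[R]_(1 + n)).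
  by rewrite trmx_drsub sB.
have [V [mu [VV drE]]] := IH _ sB'.
pose W : 'M[R]_(1 + n) := block_mx 1%:M 0 0 V.
have WW : W *m W^T = 1%:M.
  rewrite /W tr_block_mx mulmx_block !trmx0 trmx1 !mulmx0 !mul0mx mulmx1 VV.
  by rewrite !addr0 !add0r -scalar_mx_block.
pose D : 'rV[R]_(1 + n) := row_mx (a%:M : 'M[R]_1) mu.
have DE : block_mx (a%:M : 'M[R]_1) 0 0 (V *m diag_mx mu *m V^T) =
          W *m diag_mx D *m W^T.
  rewrite /D diag_mx_row /W tr_block_mx !trmx0 trmx1.
  have -> : diag_mx (a%:M : 'M[R]_1) = a%:M.
    by apply/matrixP => i j; rewrite !ord1 !mxE.
  rewrite !mulmx_block !mulmx0 !mul0mx !addr0 !add0r.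
  by rewrite mul1mx mulmx1 (mul0mx 1 V^T) (mul0mx n 1%:M).
exists (H *m (W : 'M[R]_n.+1)), D; split.
  rewrite trmx_mul mulmxA -(mulmxA H) (_ : _ *m (W : 'M[R]_n.+1)^T = 1%:M) ?mulmx1 //.
rewrite AE BE drE DE trmx_mul; set DD := diag_mx _.
by rewrite !mulmxA.
Qed.

(** * Euclidean geometry and spectral calculus *)

Lemma innerE (R : realType) (d : nat) (x y : 'cV[R]_d) :
  inner x y = (x^T *m y) 0 0.
Proof. by rewrite mxE; apply: eq_bigr => i _; rewrite mxE. Qed.

Lemma innerC (R : realType) (d : nat) (x y : 'cV[R]_d) : inner x y = inner y x.
Proof. by apply: eq_bigr => i _; rewrite mulrC. Qed.

Lemma innerDl (R : realType) (d : nat) (x y z : 'cV[R]_d) :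
  inner (x + y) z = inner x z + inner y z.
Proof. by rewrite -big_split; apply: eq_bigr => i _; rewrite mxE mulrDl. Qed.

Lemma innerDr (R : realType) (d : nat) (x y z : 'cV[R]_d) :
  inner z (x + y) = inner z x + inner z y.
Proof. by rewrite innerC innerDl !(innerC z). Qed.

Lemma innerZl (R : realType) (d : nat) (c : R) (x y : 'cV[R]_d) :
  inner (c *: x) y = c * inner x y.
Proof. by rewrite /inner mulr_sumr; apply: eq_bigr => i _; rewrite mxE mulrA. Qed.

Lemma innerZr (R : realType) (d : nat) (c : R) (x y : 'cV[R]_d) :
  inner x (c *: y) = c * inner x y.
Proof. by rewrite innerC innerZl innerC. Qed.

Lemma innerNl (R : realType) (d : nat) (x y : 'cV[R]_d) :
  inner (- x) y = - inner x y.
Proof. by rewrite -scaleN1r innerZl mulN1r. Qed.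

Lemma innerNr (R : realType) (d : nat) (x y : 'cV[R]_d) :
  inner x (- y) = - inner x y.
Proof. by rewrite innerC innerNl innerC. Qed.

Lemma inner0l (R : realType) (d : nat) (x : 'cV[R]_d) : inner 0 x = 0.
Proof. by rewrite -(scale0r 0) innerZl mul0r. Qed.

Lemma inner_sumr (R : realType) (d : nat) (I : Type) (r : seq I) (p : pred I)
    (x : 'cV[R]_d) (F : I -> 'cV[R]_d) :
  inner x (\sum_(i <- r | p i) F i) = \sum_(i <- r | p i) inner x (F i).
Proof.
apply: (big_morph (inner x)); first by move=> y z; rewrite innerDr.
by rewrite innerC inner0l.
Qed.

Lemma inner_suml (R : realType) (d : nat) (I : Type) (r : seq I) (p : pred I)
    (x : 'cV[R]_d) (F : I -> 'cV[R]_d) :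
  inner (\sum_(i <- r | p i) F i) x = \sum_(i <- r | p i) inner (F i) x.
Proof. by rewrite innerC inner_sumr; apply: eq_bigr => i _; rewrite innerC. Qed.

Lemma inner_ge0 (R : realType) (d : nat) (x : 'cV[R]_d) : 0 <= inner x x.
Proof. by rewrite sumr_ge0 // => i _; rewrite -expr2 sqr_ge0. Qed.

Lemma norm2_sqr (R : realType) (d : nat) (x : 'cV[R]_d) :
  norm2 x ^+ 2 = inner x x.
Proof.
rewrite /norm2 sqr_sqrtr; last by apply: sumr_ge0 => i _; exact: sqr_ge0.
by apply: eq_bigr => i _; rewrite expr2.
Qed.

Lemma norm2_ge0 (R : realType) (d : nat) (x : 'cV[R]_d) : 0 <= norm2 x.
Proof. exact: sqrtr_ge0. Qed.

Lemma norm2E (R : realType) (d : nat) (x : 'cV[R]_d) :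
  norm2 x = Num.sqrt (inner x x).
Proof. by rewrite -norm2_sqr sqrtr_sqr ger0_norm ?norm2_ge0. Qed.

Lemma inner_mxr (R : realType) (d : nat) (A : 'M[R]_d) (x y : 'cV[R]_d) :
  inner x (A *m y) = inner (A^T *m x) y.
Proof. by rewrite !innerE trmx_mul trmxK mulmxA. Qed.

Lemma mulmx_outer (R : realType) (d : nat) (a x : 'cV[R]_d) :
  a *m a^T *m x = inner a x *: a.
Proof.
rewrite -mulmxA (_ : a^T *m x = (inner a x)%:M) ?mul_mx_scalar //.
by apply/matrixP => i j; rewrite !ord1 innerE [RHS]mxE eqxx mulr1n.
Qed.

Lemma inner_spectral (R : realType) (d : nat) (U : 'M[R]_d) (l : 'rV[R]_d)
    (x y : 'cV[R]_d) :
  inner x (U *m diag_mx l *m U^T *m y) =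
  \sum_k l 0 k * ((U^T *m x) k 0 * (U^T *m y) k 0).
Proof.
rewrite -!mulmxA inner_mxr; apply: eq_bigr => k _.
move: (U^T *m x) (U^T *m y) => p q.
by rewrite mul_diag_mx mxE mulrCA.
Qed.

Lemma inner_orthogonal (R : realType) (d : nat) (U : 'M[R]_d) (x y : 'cV[R]_d) :
  U *m U^T = 1%:M -> inner (U^T *m x) (U^T *m y) = inner x y.
Proof. by move=> UU; rewrite -inner_mxr mulmxA UU mul1mx. Qed.

Lemma mxtrace_spectral (R : realType) (d : nat) (U : 'M[R]_d) (l : 'rV[R]_d) :
  U *m U^T = 1%:M -> \tr (U *m diag_mx l *m U^T) = \sum_k l 0 k.
Proof. by move=> UU; rewrite mxtrace_mulC mulmxA (mulmx1C UU) mul1mx mxtrace_diag. Qed.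

(** With different eigenbases, the trace of a product pairs all eigenvalues;
    the weights are doubly stochastic by the next two lemmas, which turns
    trace inequalities into averages of scalar inequalities. *)
Lemma mxtrace_spectral2 (R : realType) (d : nat) (U V : 'M[R]_d) (l m : 'rV[R]_d) :
  \tr ((U *m diag_mx l *m U^T) *m (V *m diag_mx m *m V^T)) =
  \sum_k \sum_j (U^T *m V) k j ^+ 2 * (l 0 k * m 0 j).
Proof.
rewrite -2!mulmxA mxtrace_mulC -!mulmxA [V^T *m U](_ : _ = (U^T *m V)^T); last first.
  by rewrite trmx_mul trmxK.
rewrite !mulmxA -(mulmxA _ U^T) -mulmxA; move: (U^T *m V) => W.
rewrite -!mulmxA; apply: eq_bigr => k _.
rewrite mul_diag_mx mxE mxE mulr_sumr; apply: eq_bigr => j _.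
by rewrite mul_diag_mx !mxE; ring.
Qed.

Lemma orthogonal_row_sum (R : realType) (d : nat) (U V : 'M[R]_d) k :
  U *m U^T = 1%:M -> V *m V^T = 1%:M -> \sum_j (U^T *m V) k j ^+ 2 = 1.
Proof.
move=> UU VV; have : ((U^T *m V) *m (U^T *m V)^T) k k = 1.
  by rewrite trmx_mul trmxK !mulmxA -(mulmxA _ V) VV mulmx1 (mulmx1C UU) mxE eqxx.
move: (U^T *m V) => W.
by rewrite mxE => <-; apply: eq_bigr => j _; rewrite mxE expr2.
Qed.

Lemma orthogonal_col_sum (R : realType) (d : nat) (U V : 'M[R]_d) j :
  U *m U^T = 1%:M -> V *m V^T = 1%:M -> \sum_k (U^T *m V) k j ^+ 2 = 1.
Proof.
move=> UU VV; rewrite -[RHS](orthogonal_row_sum j VV UU).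
by apply: eq_bigr => k _; rewrite -[V^T *m U]trmxK trmx_mul trmxK [in RHS]mxE.
Qed.

Lemma mxfunP (R : realType) (d : nat) (f : R -> R) (A : 'M[R]_d) :
  A^T = A -> is_mxfun f A (mxfun f A).
Proof.
move=> sA; have [U [l [UU AE]]] := real_spectral sA.
apply: (@xgetPex _ 0 [set B | is_mxfun f A B]).
by exists (U *m diag_mx (map_mx f l) *m U^T), U, l.
Qed.

(** * The trace of the exponential *)

Definition mxexp (R : realType) (d : nat) (A : 'M[R]_d) : 'M[R]_d :=
  mxfun (@expR R) A.

(** Klein's inequality: the tangent inequality of the scalar exponential,
    averaged with doubly stochastic weights.  It makes the convexity of the
    potential usable although the two matrices do not commute. *)
Lemma klein_expR (R : realType) (d : nat) (A B : 'M[R]_d) :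
  A^T = A -> B^T = B ->
  \tr (mxexp A) + \tr (mxexp A *m (B - A)) <= \tr (mxexp B).
Proof.
move=> /(mxfunP (@expR R)) [U [l [UU AE eAE]]].
move=> /(mxfunP (@expR R)) [V [m [VV BE eBE]]].
rewrite mulmxBr [\tr (_ - _)]raddfB /= /mxexp eAE eBE {1}AE {1}BE.
rewrite !mxtrace_spectral2 !mxtrace_spectral //.
have -> : \sum_k map_mx (@expR R) l 0 k =
  \sum_k \sum_j (U^T *m V) k j ^+ 2 * expR (l 0 k).
  by apply: eq_bigr => k _; rewrite -mulr_suml orthogonal_row_sum // mul1r mxE.
have -> : \sum_k map_mx (@expR R) m 0 k =
  \sum_k \sum_j (U^T *m V) k j ^+ 2 * expR (m 0 j).
  rewrite exchange_big /=.
  by apply: eq_bigr => k _; rewrite -mulr_suml orthogonal_col_sum // mul1r mxE.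
have -> : \sum_k \sum_j (U^T *m U) k j ^+ 2 * (map_mx (@expR R) l 0 k * l 0 j) =
  \sum_k \sum_j (U^T *m V) k j ^+ 2 * (expR (l 0 k) * l 0 k).
  apply: eq_bigr => k _; rewrite -mulr_suml orthogonal_row_sum // mul1r.
  rewrite (mulmx1C UU) (bigD1 k) //= big1 => [|j jk].
    by rewrite !mxE eqxx expr1n mul1r addr0.
  by rewrite !mxE eq_sym (negbTE jk) expr0n mul0r.
rewrite -sumrB -big_split ler_sum // => k _.
rewrite -sumrB -big_split ler_sum // => j _ /=.
rewrite -mulrBr -mulrDr ler_wpM2l ?sqr_ge0 // mxE.
have : expR (m 0 j) = expR (l 0 k) * expR (m 0 j - l 0 k) by rewrite -expRD addrC subrK.
move=> ->; rewrite -mulrBr -[X in X + _]mulr1 -mulrDr ler_wpM2l ?expR_ge0 //.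
exact: expR_ge1Dx.
Qed.

(** The mean of the exponential over an interval is at most the average of its
    two end values, by convexity. *)
Lemma expR_secant (R : realType) (x y : R) :
  (x - y) * (expR x - expR y) <= (x - y) ^+ 2 * ((expR x + expR y) / 2).
Proof.
wlog xy : x y / y <= x => [H|].
  have [|/ltW] := leP y x; first exact: H.
  move=> /H; rewrite -(opprB x y) sqrrN -(opprB (expR x)) mulrNN.
  by rewrite (addrC (expR y)).
rewrite expr2 -mulrA ler_wpM2l ?subr_ge0 //.
have -> : expR x = expR y * expR (x - y) by rewrite -expRD addrC subrK.
move: (x - y) (subr_ge0 y x) => t; rewrite xy => t0.
suff : expR t - 1 <= t * ((expR t + 1) / 2).
  move=> /(ler_wpM2l (expR_ge0 y)); nra.
pose g (u : R) := u * ((expR u + 1) / 2) - (expR u - 1).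
suff : g 0 <= g t by rewrite /g expR0; lra.
have dg (u : R) : is_derive u (1 : R) g ((u * expR u + 1 - expR u) / 2).
  by apply: trigger_derive; rewrite /GRing.scale /=; field.
have dg' (u : R) : derivable g u 1 by have [] := dg u.
apply: (ger0_derive1_ndecry (a := 0)) => //.
- move=> u; rewrite in_itv /= andbT => u0.
  rewrite derive1E; have [_ ->] := dg u.
  have := expR_ge1Dx (- u); have := expR_gt0 u; have := expRxMexpNx_1 u.
  move: (expR u) (expR (- u)) => a b ab a0 bu; nra.
- apply: continuous_subspaceT => u.
  exact/differentiable_continuous/derivable1_diffP.
Qed.

Lemma quad_mxexp_ge0 (R : realType) (d : nat) (A : 'M[R]_d) (a : 'cV[R]_d) :
  A^T = A -> 0 <= inner a (mxexp A *m a).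
Proof.
move=> /(mxfunP (@expR R)) [U [l [UU AE eAE]]].
rewrite /mxexp eAE inner_spectral sumr_ge0 // => k _.
by rewrite mxE mulr_ge0 ?expR_ge0 // -expr2 sqr_ge0.
Qed.

(** In eigenbases of [A] and [B], the relation [A - B = a a^T] reads
    [(l k - m j) W k j = p k q j], where [W] is the change of basis and [p], [q]
    are the coordinates of [a].  Both sides become double sums over pairs of
    eigenvalues, and [expR_secant] compares them termwise. *)
Lemma mxexp_rank1_secant (R : realType) (d : nat) (A B : 'M[R]_d) (a : 'cV[R]_d) :
  A^T = A -> B^T = B -> A = B + a *m a^T ->
  inner a (mxexp A *m a) - inner a (mxexp B *m a) <=
  inner a a * ((inner a (mxexp A *m a) + inner a (mxexp B *m a)) / 2).
Proof.
move=> sA sB AB; have := mxfunP (@expR R) sA => -[U [l [UU AE eAE]]].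
have := mxfunP (@expR R) sB => -[V [m [VV BE eBE]]].
set W := U^T *m V; set p := U^T *m a; set q := V^T *m a.
have pE : p = W *m q by rewrite /W /q !mulmxA -(mulmxA _ V) VV mulmx1.
have qE : q = W^T *m p.
  by rewrite /W /p trmx_mul trmxK !mulmxA -(mulmxA _ U) UU mulmx1.
have entry (N : 'M[R]_d) (x y : 'cV[R]_d) k j :
    diag_mx l *m N = N *m diag_mx m + x *m y^T ->
    (l 0 k - m 0 j) * N k j = x k 0 * y j 0.
  move=> /matrixP/(_ k j); rewrite mul_diag_mx mul_mx_diag !mxE big_ord1 mxE.
  by rewrite -[in X in _ -> X]/(0 : 'I_1); lra.
have Wpq k j : (l 0 k - m 0 j) * W k j = p k 0 * q j 0.
  have : U^T *m A *m V = U^T *m (B + a *m a^T) *m V by rewrite AB.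
  rewrite {1}AE {1}BE mulmxDr mulmxDl !mulmxA (mulmx1C UU) mul1mx.
  rewrite -(mulmxA _ V^T V) (mulmx1C VV) mulmx1 -/p -(mulmxA _ U^T) -/W.
  rewrite -(mulmxA p) (_ : a^T *m V = q^T); last by rewrite trmx_mul trmxK.
  exact: entry.
have expE (n : 'rV[R]_d) k : map_mx (@expR R) n 0 k = expR (n 0 k).
  by rewrite mxE.
have pk k : p k 0 = \sum_j W k j * q j 0 by rewrite {1}pE mxE.
have qj j : q j 0 = \sum_k p k 0 * W k j.
  by rewrite {1}qE mxE; apply: eq_bigr => k _; rewrite [W^T _ _]mxE mulrC.
have hA : inner a (mxexp A *m a) = \sum_k \sum_j p k 0 * W k j * q j 0 * expR (l 0 k).
  rewrite /mxexp eAE inner_spectral -/p; apply: eq_bigr => k _.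
  rewrite [X in _ * (_ * X)]pk !mulr_sumr; apply: eq_bigr => j _.
  by rewrite expE; ring.
have hB : inner a (mxexp B *m a) = \sum_k \sum_j p k 0 * W k j * q j 0 * expR (m 0 j).
  rewrite /mxexp eBE inner_spectral -/q exchange_big; apply: eq_bigr => j _ /=.
  rewrite [X in _ * (X * _)]qj mulr_suml mulr_sumr; apply: eq_bigr => k _.
  by rewrite expE; ring.
have hA2 : inner a a * inner a (mxexp A *m a) = \sum_k \sum_j (p k 0 * q j 0) ^+ 2 * expR (l 0 k).
  rewrite /mxexp eAE inner_spectral -/p -(inner_orthogonal a a VV) -/q mulr_sumr.
  apply: eq_bigr => k _; rewrite mulr_suml; apply: eq_bigr => j _.
  by rewrite expE; ring.
have hB2 : inner a a * inner a (mxexp B *m a) = \sum_k \sum_j (p k 0 * q j 0) ^+ 2 * expR (m 0 j).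
  rewrite /mxexp eBE inner_spectral -/q -(inner_orthogonal a a UU) -/p mulr_sumr.
  rewrite exchange_big; apply: eq_bigr => j _; rewrite mulr_suml; apply: eq_bigr => k _.
  by rewrite expE; ring.
rewrite mulrA mulrDr hA2 hB2 hA hB -sumrB -big_split mulr_suml ler_sum // => k _.
rewrite -sumrB -big_split mulr_suml ler_sum // => j _ /=.
have := Wpq k j; have := expR_secant (l 0 k) (m 0 j).
move: (l 0 k) (m 0 j) (W k j) (p k 0) (q j 0).
move=> u v w s t h E.
set x := expR u in h *; set y := expR v in h *.
have -> : s * w * t * x - s * w * t * y = w ^+ 2 * ((u - v) * (x - y)).
  have -> : s * w * t * x - s * w * t * y = s * t * (w * (x - y)) by ring.
  by rewrite -E; ring.
by rewrite -E; have := ler_wpM2l (sqr_ge0 w) h; lra.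
Qed.

Lemma trmx_outer (R : realType) (d : nat) (a : 'cV[R]_d) :
  (a *m a^T)^T = a *m a^T.
Proof. by rewrite trmx_mul trmxK. Qed.

Lemma mxtrace_outer (R : realType) (d : nat) (E : 'M[R]_d) (a : 'cV[R]_d) :
  \tr (E *m (a *m a^T)) = inner a (E *m a).
Proof. by rewrite mulmxA mxtrace_mulC innerE /mxtrace big_ord1. Qed.

Lemma trmxD_sym (R : realType) (d : nat) (A B : 'M[R]_d) :
  A^T = A -> B^T = B -> (A + B)^T = A + B.
Proof. by move=> sA sB; rewrite linearD /= sA sB. Qed.

Lemma trmxB_sym (R : realType) (d : nat) (A B : 'M[R]_d) :
  A^T = A -> B^T = B -> (A - B)^T = A - B.
Proof. by move=> sA sB; rewrite linearB /= sA sB. Qed.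

(** Klein's inequality bounds the increment by the quadratic form of the
    exponential at the end point; [mxexp_rank1_secant] moves it back to the
    starting point, at the price of the factor [1 + 3 / 2 |a|^2]. *)
Lemma mxexp_rank1_up (R : realType) (d : nat) (H : 'M[R]_d) (a : 'cV[R]_d) :
  H^T = H -> inner a a <= 2 / 3 ->
  \tr (mxexp (H + a *m a^T)) <=
  \tr (mxexp H) + (1 + 3 / 2 * inner a a) * inner a (mxexp H *m a).
Proof.
move=> sH q1; have sX := trmxD_sym sH (trmx_outer a).
have := klein_expR sX sH; rewrite opprD addrA subrr add0r mulmxN raddfN /=.
rewrite mxtrace_outer => kl.
have := mxexp_rank1_secant sX sH erefl.
have := quad_mxexp_ge0 a sH; have := quad_mxexp_ge0 a sX; have := inner_ge0 a.
move: q1 kl; set q := inner a a; set x := inner a _; set y := inner a _.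
set t := \tr _; set s := \tr _ => q1 kl q0 x0 y0 sec.
suff : x <= (1 + 3 / 2 * q) * y by lra.
have xy : x * (1 - q / 2) <= y * (1 + q / 2) by lra.
have h : (1 + q / 2) <= (1 + 3 / 2 * q) * (1 - q / 2) by nra.
have := ler_wpM2l y0 h; nra.
Qed.

Lemma mxexp_rank1_down (R : realType) (d : nat) (H : 'M[R]_d) (a : 'cV[R]_d) :
  H^T = H ->
  \tr (mxexp (H - a *m a^T)) <=
  \tr (mxexp H) - (1 - inner a a) * inner a (mxexp H *m a).
Proof.
move=> sH; have sX := trmxB_sym sH (trmx_outer a).
have := klein_expR sX sH; rewrite subKr mxtrace_outer => kl.
have HE : H = H - a *m a^T + a *m a^T by rewrite subrK.
have := mxexp_rank1_secant sH sX HE.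
have := quad_mxexp_ge0 a sH; have := quad_mxexp_ge0 a sX; have := inner_ge0 a.
move: kl; set q := inner a a; set x := inner a (mxexp (H - _) *m a); set y := inner a _.
set t := \tr _; set s := \tr _ => kl q0 x0 y0 sec.
suff : (1 - q) * y <= x by lra.
have xy : y * (1 - q / 2) <= x * (1 + q / 2) by lra.
have q2 : 0 < 1 + q / 2 by lra.
rewrite -(ler_pM2r q2); nra.
Qed.

(** The exponential as a family of positive weights on unit vectors: a bound on
    quadratic forms at unit vectors integrates to a bound on traces. *)
Lemma mxexp_eigen (R : realType) (d : nat) (H : 'M[R]_d) : H^T = H ->
  exists (w : 'I_d -> R) (v : 'I_d -> 'cV[R]_d),
  [/\ forall k, 0 <= w k, forall k, inner (v k) (v k) = 1,
      \tr (mxexp H) = \sum_k w k,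
      forall a, inner a (mxexp H *m a) = \sum_k w k * inner a (v k) ^+ 2 &
      forall C, \tr (mxexp H *m C) = \sum_k w k * inner (v k) (C *m v k)].
Proof.
move=> /(mxfunP (@expR R)) [U [l [UU HE eHE]]].
exists (fun k => expR (l 0 k)), (fun k => col k U).
have colE k x : (U^T *m x) k 0 = inner x (col k U).
  by rewrite mxE; apply: eq_bigr => i _; rewrite !mxE mulrC.
split.
- by move=> k; rewrite expR_ge0.
- move=> k; transitivity ((U^T *m U) k k); last by rewrite (mulmx1C UU) mxE eqxx.
  by rewrite mxE; apply: eq_bigr => i _; rewrite !mxE.
- by rewrite /mxexp eHE mxtrace_spectral //; apply: eq_bigr => k _; rewrite mxE.
- move=> a; rewrite /mxexp eHE inner_spectral; apply: eq_bigr => k _.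
  by rewrite !colE mxE expr2.
- move=> C; have quadE k : (U^T *m (C *m U)) k k = inner (col k U) (C *m col k U).
    rewrite mxE; apply: eq_bigr => i _; rewrite mxE [col k U i 0]mxE.
    by congr (_ * _); rewrite !mxE; apply: eq_bigr => j _; rewrite mxE.
  rewrite /mxexp eHE -!mulmxA mxtrace_mulC -mulmxA; apply: eq_bigr => k _.
  by rewrite mul_diag_mx mxE -mulmxA quadE mxE.
Qed.

(** Jensen's inequality for the spectral measure of a unit vector *)
Lemma expR_quad_le_trace (R : realType) (d : nat) (M : 'M[R]_d) (v : 'cV[R]_d) :
  M^T = M -> inner v v = 1 -> expR (inner v (M *m v)) <= \tr (mxexp M).
Proof.
move=> sM v1; have := mxfunP (@expR R) sM => -[U [l [UU ME eME]]].
set c := inner v _.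
have w1 : \sum_k (U^T *m v) k 0 ^+ 2 = 1.
  by rewrite -v1 -(inner_orthogonal v v UU); apply: eq_bigr => k _; rewrite expr2.
have cE : c = \sum_k l 0 k * (U^T *m v) k 0 ^+ 2.
  by rewrite /c ME inner_spectral; apply: eq_bigr => k _; rewrite expr2.
rewrite /mxexp eME mxtrace_spectral //.
have -> : expR c = \sum_k (expR c * (1 + (l 0 k - c))) * (U^T *m v) k 0 ^+ 2.
  under eq_bigr do rewrite -mulrA mulrDl mul1r mulrBl.
  by rewrite -mulr_sumr big_split /= sumrB -cE -mulr_sumr w1 mulr1 subrr addr0 mulr1.
apply: ler_sum => k _; rewrite [X in _ <= X]mxE.
have s1 : (U^T *m v) k 0 ^+ 2 <= 1.
  by rewrite -w1 (bigD1 k) //= lerDl sumr_ge0 // => j _; rewrite sqr_ge0.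
have -> : expR (l 0 k) = expR c * expR (l 0 k - c) by rewrite -expRD addrC subrK.
apply: (@le_trans _ _ (expR c * expR (l 0 k - c) * (U^T *m v) k 0 ^+ 2)).
  by rewrite ler_wpM2r ?sqr_ge0 // ler_wpM2l ?expR_ge0 // expR_ge1Dx.
by rewrite ler_piMr // mulr_ge0 ?expR_ge0.
Qed.

Lemma mxtrace_exp0 (R : realType) (d : nat) : \tr (mxexp (0 : 'M[R]_d)) = d%:R.
Proof.
have := mxfunP (@expR R) (trmx0 R d d) => -[U [l [UU E0 eE]]].
have dl : diag_mx l = 0.
  have -> : diag_mx l = U^T *m (U *m diag_mx l *m U^T) *m U.
    by rewrite !mulmxA (mulmx1C UU) mul1mx -mulmxA (mulmx1C UU) mulmx1.
  by rewrite -E0 mulmx0 mul0mx.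
rewrite /mxexp eE mxtrace_spectral //.
rewrite (eq_bigr (fun=> 1)) ?sumr_const ?card_ord // => k _.
by rewrite mxE; move/matrixP/(_ k k): dl; rewrite !mxE eqxx mulr1n => ->; rewrite expR0.
Qed.

Lemma mxtrace_exp_ge0 (R : realType) (d : nat) (M : 'M[R]_d) :
  M^T = M -> 0 <= \tr (mxexp M).
Proof.
by move=> /mxexp_eigen [w [v [w0 _ -> _ _]]]; exact: sumr_ge0.
Qed.

(** Klein's inequality at [M + B] bounds the trace at [M + B] by the trace at
    [M] plus [b] times itself. *)
Lemma mxexp_trace_add (R : realType) (d : nat) (M B : 'M[R]_d) (b : R) :
  M^T = M -> B^T = B -> b < 1 ->
  (forall v, inner v (B *m v) <= b * inner v v) ->
  \tr (mxexp (M + B)) <= \tr (mxexp M) / (1 - b).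
Proof.
move=> sM sB b1 Bb; have sX := trmxD_sym sM sB.
have := klein_expR sX sM; rewrite opprD addrA subrr add0r mulmxN raddfN /=.
have [w [v [w0 v1 -> _ ->]]] := mxexp_eigen sX => kl.
rewrite ler_pdivlMr ?subr_gt0 //; apply: le_trans kl.
rewrite mulrBr mulr1 lerD2l lerN2 mulr_suml ler_sum // => k _.
by rewrite ler_wpM2l //; have := Bb (v k); rewrite v1 mulr1.
Qed.

(** A limit of polynomials in the entries: this is what makes the potential of
    a random matrix measurable. *)
Lemma mxtrace_exp_cvg (R : realType) (d : nat) (M : 'M[R]_d) : M^T = M ->
  (fun n => \sum_(0 <= i < n) \tr (iter i (mulmx M) 1%:M) / i`!%:R) @ \oo
    --> \tr (mxexp M).
Proof.
move=> sM; have := mxfunP (@expR R) sM => -[U [l [UU ME eME]]].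
have powE i : iter i (mulmx M) 1%:M = U *m diag_mx (map_mx (fun x => x ^+ i) l) *m U^T.
  elim: i => [|i IH] /=.
    rewrite (_ : diag_mx _ = 1%:M) ?mulmx1 //.
    by apply/matrixP => i j; rewrite !mxE expr0.
  rewrite IH {1}ME !mulmxA -(mulmxA _ U^T) (mulmx1C UU) mulmx1; congr (_ *m _).
  rewrite -mulmxA; congr (_ *m _); apply/matrixP => a b.
  by rewrite mul_diag_mx !mxE exprS mulrnAr.
rewrite (_ : (fun _ => _) = (fun n => \sum_k series (exp_coeff (l 0 k)) n)).
  rewrite /mxexp eME mxtrace_spectral //.
  under eq_bigr do rewrite mxE.
  apply: cvg_big => [x|k _]; first exact: add_continuous.
  exact: is_cvg_series_exp_coeff.
apply/funext => n; rewrite /series /= exchange_big; apply: eq_bigr => i _.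
rewrite powE mxtrace_spectral // mulr_suml; apply: eq_bigr => k _.
by rewrite mxE /exp_coeff.
Qed.

(** * The operator norm of symmetric matrices *)

(** Quadratic forms bound the eigenvalues, hence the operator. *)
Lemma norm2_spectral_le (R : realType) (d : nat) (A : 'M[R]_d) (c : R) v :
  A^T = A -> 0 <= c -> (forall u, `|inner u (A *m u)| <= c * inner u u) ->
  norm2 (A *m v) <= c * norm2 v.
Proof.
move=> sA c0 Ac; have [U [l [UU AE]]] := real_spectral sA.
have lc k : `|l 0 k| <= c.
  have := Ac (U *m delta_mx k 0); rewrite {1}AE inner_spectral.
  rewrite -[X in _ * X](inner_orthogonal _ _ UU) !mulmxA (mulmx1C UU) mul1mx.
  rewrite (bigD1 k) //= big1 ?addr0 => [|j jk]; last first.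
    by rewrite !mxE (negbTE jk) !mulr0.
  rewrite /inner [X in _ <= _ * X](bigD1 k) //= [X in _ <= _ * (_ + X)]big1 ?addr0.
    by rewrite !mxE !eqxx !mulr1.
  by move=> j jk; rewrite !mxE (negbTE jk) !mulr0.
rewrite -(@ler_pXn2r _ 2) ?nnegrE ?mulr_ge0 ?norm2_ge0 // exprMn !norm2_sqr.
have -> : inner (A *m v) (A *m v) = \sum_k l 0 k ^+ 2 * (U^T *m v) k 0 ^+ 2.
  have UA : U^T *m (A *m v) = diag_mx l *m (U^T *m v).
    by rewrite {1}AE !mulmxA (mulmx1C UU) mul1mx.
  rewrite -(inner_orthogonal _ _ UU) UA; apply: eq_bigr => k _.
  by rewrite mul_diag_mx mxE -expr2 exprMn.
rewrite -(inner_orthogonal v v UU) mulr_sumr ler_sum // => k _.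
rewrite -expr2 ler_wpM2r ?sqr_ge0 // -real_normK ?num_real //.
by rewrite ler_pXn2r ?nnegrE.
Qed.

Lemma opnorm_ubound (R : realType) (d : nat) (A : 'M[R]_d) : A^T = A ->
  has_sup [set norm2 (A *m v) | v in [set v : 'cV[R]_d | norm2 v <= 1]].
Proof.
move=> sA; have [U [l [UU AE]]] := real_spectral sA.
split.
  exists (norm2 (A *m 0)), 0 => //=.
  by rewrite norm2E inner0l sqrtr0.
exists (\sum_k `|l 0 k|) => _ [v v1 <-].
have L0 : 0 <= \sum_k `|l 0 k| by exact: sumr_ge0.
apply: le_trans (norm2_spectral_le v sA L0 _) _ => [u|]; last first.
  by rewrite ler_piMr.
rewrite {1}AE inner_spectral (le_trans (ler_norm_sum _ _ _)) //.
rewrite -(inner_orthogonal u u UU) mulr_sumr ler_sum // => k _.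
rewrite -!expr2 normrM [X in _ * X]ger0_norm ?sqr_ge0 // ler_wpM2r ?sqr_ge0 //.
by rewrite (bigD1 k) //= lerDl sumr_ge0.
Qed.

Lemma opnorm_ge0 (R : realType) (d : nat) (A : 'M[R]_d) : A^T = A -> 0 <= opnorm A.
Proof.
move=> sA; apply: (@le_trans _ _ (norm2 (A *m 0))); first exact: norm2_ge0.
apply: sup_upper_bound; first exact: opnorm_ubound.
by exists 0 => //=; rewrite norm2E inner0l sqrtr0.
Qed.

Lemma opnorm_le (R : realType) (d : nat) (A : 'M[R]_d) (c : R) :
  A^T = A -> 0 <= c -> (forall u, `|inner u (A *m u)| <= c * inner u u) ->
  opnorm A <= c.
Proof.
move=> sA c0 Ac; apply: sup_le_ub; first by have [] := opnorm_ubound sA.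
move=> _ [v v1 <-]; apply: le_trans (norm2_spectral_le v sA c0 Ac) _.
by rewrite ler_piMr.
Qed.

Lemma inner_eq0 (R : realType) (d : nat) (x : 'cV[R]_d) : inner x x = 0 -> x = 0.
Proof.
move=> /psumr_eq0P h; apply/colP => i; rewrite mxE; apply/eqP.
by rewrite -sqrf_eq0 expr2 h // => j _; rewrite -expr2 sqr_ge0.
Qed.

Lemma inner_CS (R : realType) (d : nat) (x y : 'cV[R]_d) :
  `|inner x y| <= norm2 x * norm2 y.
Proof.
rewrite -(@ler_pXn2r _ 2) ?nnegrE ?mulr_ge0 ?norm2_ge0 // exprMn !norm2_sqr.
rewrite real_normK ?num_real //.
have [y0|y0] := eqVneq (inner y y) 0.
  by rewrite (inner_eq0 y0) innerC !inner0l expr0n mulr0.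
have := inner_ge0 (inner y y *: x - inner x y *: y).
rewrite !(innerDl, innerDr, innerNl, innerNr, innerZl, innerZr) (innerC y x).
move: y0 (inner_ge0 y); set a := inner x y; set b := inner y y; set c := inner x x.
move=> y0 b0 h; have bp : 0 < b by rewrite lt_def y0 b0.
rewrite -(ler_pM2l bp); nra.
Qed.

Lemma quad_le_opnorm (R : realType) (d : nat) (A : 'M[R]_d) u :
  A^T = A -> `|inner u (A *m u)| <= opnorm A * inner u u.
Proof.
move=> sA; have [u0|u0] := eqVneq (norm2 u) 0.
  apply: le_trans (inner_CS _ _) _; rewrite u0 mul0r.
  by rewrite mulr_ge0 ?opnorm_ge0 ?inner_ge0.
have n0 : 0 < norm2 u by rewrite lt_def u0 norm2_ge0.
apply: le_trans (inner_CS _ _) _; rewrite -norm2_sqr expr2 mulrCA ler_pM2l //.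
rewrite -ler_pdivrMr //.
have -> : norm2 (A *m u) / norm2 u = norm2 (A *m ((norm2 u)^-1 *: u)).
  rewrite -scalemxAr [in RHS]norm2E innerZl innerZr mulrA -norm2_sqr.
  by rewrite -expr2 -exprMn sqrtr_sqr ger0_norm ?mulr_ge0 ?invr_ge0 ?norm2_ge0 // mulrC.
apply: sup_upper_bound; first exact: opnorm_ubound.
exists ((norm2 u)^-1 *: u) => //=.
rewrite norm2E innerZl innerZr mulrA -norm2_sqr -expr2 -exprMn mulVf //.
by rewrite expr1n sqrtr1.
Qed.

Lemma opnormD (R : realType) (d : nat) (A B : 'M[R]_d) :
  A^T = A -> B^T = B -> opnorm (A + B) <= opnorm A + opnorm B.
Proof.
move=> sA sB; apply: opnorm_le; first exact: trmxD_sym.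
  by rewrite addr_ge0 ?opnorm_ge0.
move=> u; rewrite mulmxDl innerDr mulrDl (le_trans (ler_normD _ _)) //.
by rewrite lerD ?quad_le_opnorm.
Qed.

Lemma opnormN (R : realType) (d : nat) (A : 'M[R]_d) : opnorm (- A) = opnorm A.
Proof.
rewrite /opnorm; congr sup; apply: eq_imagel => v _.
by rewrite mulNmx norm2E innerNl innerNr opprK -norm2E.
Qed.

Lemma expR_unbounded (R : realType) (x D : R) :
  (forall n : nat, expR (n%:R * x) <= D) -> x <= 0.
Proof.
move=> h; rewrite leNgt; apply/negP => x0.
have [n Dn] : exists n : nat, D / x < n%:R.
  exists (Num.bound (D / x)); apply: archi_boundP; rewrite divr_ge0 ?ltW //.
  exact: lt_le_trans (expR_gt0 _) (h 0%N).
have := h n; rewrite leNgt => /negP; apply.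
rewrite -(ltr_pM2r x0) divfK ?gt_eqF // in Dn.
by apply: lt_le_trans (expR_ge1Dx _); rewrite (lt_trans Dn) // ltrDr.
Qed.

(** Describes a ball of the operator norm by countably many conditions on
    traces of exponentials, which are measurable in the entries.  As [n] grows,
    [d e^(n c)] leaves no room for an eigenvalue above [c]. *)
Lemma opnorm_le_mxexp (R : realType) (d : nat) (A : 'M[R]_d) (c : R) :
  A^T = A -> 0 <= c ->
  opnorm A <= c <->
  forall n : nat, \tr (mxexp (n%:R *: A)) <= d%:R * expR (n%:R * c) /\
                  \tr (mxexp (- (n%:R *: A))) <= d%:R * expR (n%:R * c).
Proof.
move=> sA c0; have sZ (n : nat) : (n%:R *: A)^T = n%:R *: A by rewrite linearZ /= sA.
have sN (n : nat) : (- (n%:R *: A))^T = - (n%:R *: A) by rewrite linearN /= sZ.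
split=> [Ac n|h].
  have bnd (B : 'M[R]_d) : B^T = B -> (forall u, inner u (B *m u) <= n%:R * c * inner u u) ->
      \tr (mxexp B) <= d%:R * expR (n%:R * c).
    move=> sB Bc; have := mxfunP (@expR R) sB => -[U [l [UU BE eBE]]].
    rewrite /mxexp eBE mxtrace_spectral //.
    rewrite mulr_natl -[d in _ *+ d]card_ord -sumr_const ler_sum // => k _.
    rewrite mxE ler_expR; have := Bc (U *m delta_mx k 0); rewrite BE inner_spectral.
    rewrite -[X in _ * X](inner_orthogonal _ _ UU) !mulmxA (mulmx1C UU) mul1mx.
    rewrite (bigD1 k) //= big1 ?addr0 => [|j jk]; last first.
      by rewrite !mxE (negbTE jk) !mulr0.
    rewrite /inner [X in _ <= _ * X](bigD1 k) //= [X in _ <= _ * (_ + X)]big1 ?addr0.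
      by rewrite !mxE !eqxx !mulr1.
    by move=> j jk; rewrite !mxE (negbTE jk) !mulr0.
  have qA u := le_trans (quad_le_opnorm u sA) (ler_wpM2r (inner_ge0 u) Ac).
  split; apply: bnd => // u.
    rewrite -scalemxAl innerZr -mulrA ler_wpM2l // (le_trans (ler_norm _)) //.
  rewrite mulNmx -scalemxAl innerNr innerZr -mulrN -mulrA ler_wpM2l //.
  by rewrite (le_trans (ler_norm _)) // normrN.
have qle (B : 'M[R]_d) : B^T = B -> (forall n : nat, \tr (mxexp (n%:R *: B)) <= d%:R * expR (n%:R * c)) ->
    forall u, inner u (B *m u) <= c * inner u u.
  move=> sB Bh.
  have unit v : inner v v = 1 -> inner v (B *m v) <= c.
    move=> v1; rewrite -subr_le0; apply: (@expR_unbounded _ _ d%:R) => n.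
    have sZB : (n%:R *: B)^T = n%:R *: B by rewrite linearZ /= sB.
    have := le_trans (expR_quad_le_trace sZB v1) (Bh n).
    rewrite -scalemxAl innerZr mulrBr expRD expRN.
    by rewrite ler_pdivrMr ?expR_gt0.
  move=> u; have [u0|u0] := eqVneq (norm2 u) 0.
    apply: le_trans (ler_norm _) _; apply: le_trans (inner_CS _ _) _.
    by rewrite u0 mul0r mulr_ge0 ?inner_ge0.
  have n0 : 0 < norm2 u by rewrite lt_def u0 norm2_ge0.
  have := unit ((norm2 u)^-1 *: u); rewrite -scalemxAr !innerZl !innerZr -norm2_sqr.
  move: (norm2 u) n0 => t t0; rewrite expr2 mulKf ?gt_eqF // mulVf ?gt_eqF //.
  by move=> /(_ erefl); rewrite !ler_pdivrMl // mulrA (mulrC c).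
apply: opnorm_le => // u; rewrite ler_norml; apply/andP; split.
  have := qle (- A) _ _ u; rewrite mulNmx innerNr linearN /= sA => /(_ erefl).
  by rewrite lerNl; apply => n; rewrite scalerN; have [] := h n.
by apply: qle => // n; have [] := h n.
Qed.

(** * Clipping to a ball *)

Definition clip_factor (R : realType) (d : nat) (B : R) (y : 'cV[R]_d) : R :=
  Num.min 1 (B / norm2 y).

(** The metric projection onto the centered ball of radius [B].  At [y = 0] the
    quotient in [clip_factor] is [0], which is harmless since it multiplies
    [y]. *)
Definition clip (R : realType) (d : nat) (B : R) (y : 'cV[R]_d) : 'cV[R]_d :=
  clip_factor B y *: y.

Lemma clip_factor_itv (R : realType) (d : nat) (B : R) (y : 'cV[R]_d) :
  0 <= B -> 0 <= clip_factor B y <= 1.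
Proof.
by move=> B0; rewrite /clip_factor le_min ler01 divr_ge0 ?norm2_ge0 //= ge_min lexx.
Qed.

Lemma norm2_eq0 (R : realType) (d : nat) (y : 'cV[R]_d) : (norm2 y == 0) = (y == 0).
Proof.
apply/eqP/eqP => [y0|->]; last by rewrite norm2E inner0l sqrtr0.
by apply: inner_eq0; rewrite -norm2_sqr y0 expr0n.
Qed.

Lemma norm2Z (R : realType) (d : nat) (c : R) (y : 'cV[R]_d) :
  norm2 (c *: y) = `|c| * norm2 y.
Proof.
rewrite norm2E innerZl innerZr mulrA -norm2_sqr -expr2 -exprMn sqrtr_sqr normrM.
by rewrite [X in _ * X]ger0_norm ?norm2_ge0.
Qed.

Lemma clip_small (R : realType) (d : nat) (B : R) (y : 'cV[R]_d) :
  norm2 y <= B -> clip B y = y.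
Proof.
have [->|y0] := eqVneq y 0; first by rewrite /clip scaler0.
have n0 : 0 < norm2 y by rewrite lt_def norm2_eq0 y0 norm2_ge0.
by move=> yB; rewrite /clip /clip_factor min_l ?scale1r // ler_pdivlMr // mul1r.
Qed.

Lemma clip_large (R : realType) (d : nat) (B : R) (y : 'cV[R]_d) :
  0 <= B -> B < norm2 y -> clip_factor B y = B / norm2 y.
Proof.
move=> B0 yB; have n0 := le_lt_trans B0 yB.
by rewrite /clip_factor min_r // ler_pdivrMr // mul1r ltW.
Qed.

Lemma norm2_clip (R : realType) (d : nat) (B : R) (y : 'cV[R]_d) :
  0 <= B -> norm2 (clip B y) <= B.
Proof.
move=> B0; have [yB|yB] := leP (norm2 y) B; first by rewrite clip_small.
have n0 := le_lt_trans B0 yB.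
rewrite /clip clip_large // norm2Z ger0_norm ?divr_ge0 ?norm2_ge0 //.
by rewrite divfK ?gt_eqF.
Qed.

Lemma inner_clip_sqr (R : realType) (d : nat) (B : R) (y v : 'cV[R]_d) :
  inner (clip B y) v ^+ 2 = clip_factor B y ^+ 2 * inner y v ^+ 2.
Proof. by rewrite /clip innerZl exprMn. Qed.

Lemma inner_clip_le (R : realType) (d : nat) (B : R) (y v : 'cV[R]_d) :
  0 <= B -> inner (clip B y) v ^+ 2 <= inner y v ^+ 2.
Proof.
move=> B0; have /andP[g0 g1] := clip_factor_itv y B0.
by rewrite inner_clip_sqr ler_piMl ?sqr_ge0 // expr_le1.
Qed.

(** The variational inequality that characterizes a projection onto a convex
    set *)
Lemma clip_obtuse (R : realType) (d : nat) (B : R) (x z : 'cV[R]_d) :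
  0 <= B -> norm2 z <= B -> inner (x - clip B x) (z - clip B x) <= 0.
Proof.
move=> B0 zB; have [xB|xB] := leP (norm2 x) B.
  by rewrite clip_small // subrr inner0l.
have n0 := le_lt_trans B0 xB.
rewrite /clip clip_large //; set c := B / norm2 x.
have c1 : c <= 1 by rewrite ler_pdivrMr // mul1r ltW.
rewrite -{1}(scale1r x) -scalerBl innerZl mulr_ge0_le0 ?subr_ge0 //.
rewrite innerDr innerNr innerZr -norm2_sqr /c expr2 mulrA divfK ?gt_eqF // subr_le0.
rewrite (le_trans (ler_norm _)) // (le_trans (inner_CS _ _)) //.
by rewrite mulrC ler_wpM2r ?norm2_ge0.
Qed.

(** Projections onto convex sets do not expand distances: add the variational
    inequalities of the two projections. *)
Lemma clip_lipschitz (R : realType) (d : nat) (B : R) (x y : 'cV[R]_d) :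
  0 <= B -> norm2 (clip B x - clip B y) <= norm2 (x - y).
Proof.
move=> B0; rewrite -(@ler_pXn2r _ 2) ?nnegrE ?norm2_ge0 // !norm2_sqr.
have hx := clip_obtuse x B0 (norm2_clip y B0).
have hy := clip_obtuse y B0 (norm2_clip x B0).
set a := clip B x in hx hy *; set b := clip B y in hx hy *.
have -> : x - y = (a - b) + ((x - a) - (y - b)).
  by apply/colP => i; rewrite !mxE; ring.
rewrite [X in _ <= X]innerDl !(innerDr _ ((x - a) - _)) -addrA lerDl.
have -> : inner (a - b) (x - a - (y - b)) = - inner (x - a) (b - a) - inner (y - b) (a - b).
  by rewrite innerC (innerDl (x - a)) (innerNl (y - b)) -(opprB b a) innerNr.
rewrite (innerC (x - a - _) (a - b)).
have -> : inner (a - b) (x - a - (y - b)) = - inner (x - a) (b - a) - inner (y - b) (a - b).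
  by rewrite innerC (innerDl (x - a)) (innerNl (y - b)) -(opprB b a) innerNr.
have := inner_ge0 (x - a - (y - b)); lra.
Qed.

(** Points inside the ball do not move, and [|y| / B] exceeds [1] outside. *)
Lemma clip_bias (R : realType) (d : nat) (B : R) (y v : 'cV[R]_d) : 0 < B ->
  (inner y v - inner (clip B y) v) ^+ 2 <= inner y y * inner y v ^+ 2 / B ^+ 2.
Proof.
move=> B0; have [yB|yB] := leP (norm2 y) B.
  by rewrite clip_small // subrr expr0n /= divr_ge0 ?sqr_ge0 // mulr_ge0 ?sqr_ge0 ?inner_ge0.
have n0 := lt_trans B0 yB.
rewrite /clip innerZl -{1}(mul1r (inner y v)) -mulrBl exprMn [X in _ <= X]mulrAC ler_wpM2r ?sqr_ge0 //.
have /andP[g0 g1] := clip_factor_itv y (ltW B0).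
apply: (@le_trans _ _ 1); first by rewrite expr_le1 // ?subr_ge0 // lerBlDl lerDr.
by rewrite ler_pdivlMr ?exprn_gt0 // mul1r -norm2_sqr ler_pXn2r ?nnegrE ?norm2_ge0 ?ltW.
Qed.

Lemma clip_half_le (R : realType) (d : nat) (B : R) (y v : 'cV[R]_d) : 0 <= B ->
  inner (clip (B / 2) y) v ^+ 2 <= inner (clip B y) v ^+ 2.
Proof.
move=> B0; have B20 : 0 <= B / 2 by rewrite divr_ge0 ?ler0n.
rewrite !inner_clip_sqr ler_wpM2r ?sqr_ge0 // ler_pXn2r ?nnegrE //.
- rewrite /clip_factor le_min !ge_min lexx /= ler_wpM2r ?orbT ?invr_ge0 ?norm2_ge0 //.
  by rewrite ler_pdivrMr ?ltr0n // ler_peMr // ler1n.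
- by have /andP[] := clip_factor_itv y B20.
- by have /andP[] := clip_factor_itv y B0.
Qed.

(** Past [9 / 10 B] the ball of half radius keeps at most half of the square,
    so the square itself is paid for by the gap between the two radii. *)
Lemma clip_half_gap (R : realType) (d : nat) (B : R) (y v : 'cV[R]_d) : 0 < B ->
  9 / 10 * B <= norm2 y ->
  inner (clip B y) v ^+ 2 <=
  2 * (inner (clip B y) v ^+ 2 - inner (clip (B / 2) y) v ^+ 2).
Proof.
move=> B0 yB; have n0 : 0 < norm2 y by apply: lt_le_trans yB; rewrite mulr_gt0 // divr_gt0 ?ltr0n.
suff : clip_factor (B / 2) y ^+ 2 <= clip_factor B y ^+ 2 / 2.
  move=> /(ler_wpM2r (sqr_ge0 (inner y v))); rewrite !inner_clip_sqr; lra.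
rewrite (@clip_large _ _ (B / 2)); last 2 first.
- by rewrite divr_ge0 ?ler0n ?ltW.
- by apply: lt_le_trans yB; lra.
rewrite /clip_factor; move: (norm2 y) n0 yB => n n0 yB.
have B1 : B / n <= 10 / 9 by rewrite ler_pdivrMr //; lra.
have -> : B / 2 / n = B / n / 2 by rewrite mulrAC.
have : 0 < B / n by rewrite divr_gt0.
move: (B / n) B1 => x x1 x0; rewrite /Num.min; case: ltP => x2; nra.
Qed.

Lemma psi_ge0E (R : realType) (x : R) : 0 <= x -> psi x = Num.min x 1.
Proof.
rewrite le_eqVlt => /predU1P[<-|x0]; first by rewrite /psi sgr0 mulr0 min_l.
by rewrite /psi gtr0_sg // gtr0_norm // mulr1.
Qed.

(** The only nonzero eigenvalue of [y y^T / B^2] is [|y|^2 / B^2], along [y];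
    truncating it at [1] amounts to clipping [y]. *)
Lemma mxfun_psi_outer (R : realType) (d : nat) (B : R) (y : 'cV[R]_d) : 0 < B ->
  mxfun (@psi R) ((B ^+ 2)^-1 *: (y *m y^T)) =
  (B ^+ 2)^-1 *: (clip B y *m (clip B y)^T).
Proof.
move=> B0; set A := _ *: _.
have sA : A^T = A by rewrite /A linearZ /= trmx_outer.
have := mxfunP (@psi R) sA => -[U [l [UU AE ->]]].
set g := clip_factor B y.
have -> : (B ^+ 2)^-1 *: (clip B y *m (clip B y)^T) = g ^+ 2 *: A.
  by rewrite /clip linearZ /= -scalemxAl -scalemxAr scalerA /A !scalerA; congr (_ *: _); rewrite -/g; ring.
pose q := (B ^+ 2)^-1 * inner y y.
have AA : A *m A = q *: A.
  rewrite /A -!scalemxAl -!scalemxAr mulmxA mulmx_outer -scalemxAl !scalerA /q.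
  by congr (_ *: _); ring.
have DD : diag_mx l *m diag_mx l = q *: diag_mx l.
  have -> : diag_mx l = U^T *m A *m U.
    by rewrite AE !mulmxA (mulmx1C UU) mul1mx -mulmxA (mulmx1C UU) mulmx1.
  rewrite !mulmxA -(mulmxA _ U) UU mulmx1 -(mulmxA _ A A) AA.
  by rewrite -scalemxAr -scalemxAl.
have lq k : l 0 k = 0 \/ l 0 k = q.
  move/matrixP/(_ k k): DD; rewrite mul_diag_mx !mxE eqxx mulr1n.
  move=> /eqP; rewrite -subr_eq0 -mulrBl mulf_eq0 => /orP[|/eqP]; last by left.
  by rewrite subr_eq0 => /eqP; right.
rewrite AE scalemxAl scalemxAr; congr (_ *m _ *m _).
apply/matrixP => i j; rewrite !mxE mulrnAr; congr (_ *+ _).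
have q0 : 0 <= q by rewrite mulr_ge0 ?inner_ge0 // invr_ge0 sqr_ge0.
case: (lq i) => ->; first by rewrite psi_ge0E // min_l // mulr0.
rewrite psi_ge0E //.
have qE : q = (norm2 y / B) ^+ 2 by rewrite /q -norm2_sqr expr_div_n mulrC.
have nB0 : 0 <= norm2 y / B by rewrite divr_ge0 ?norm2_ge0 // ltW.
have [yB|yB] := leP (norm2 y) B.
  rewrite min_l; last first.
    by rewrite qE expr_le1 // ler_pdivrMr // mul1r.
  have [y0|y0] := eqVneq y 0; first by rewrite /q y0 inner0l !mulr0.
  have n0 : 0 < norm2 y by rewrite lt_def norm2_eq0 y0 norm2_ge0.
  by rewrite /g /clip_factor min_l ?expr1n ?mul1r // ler_pdivlMr // mul1r.
have n0 := lt_trans B0 yB.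
rewrite min_r /g ?(clip_large (ltW B0)) // qE.
  by rewrite -exprMn mulrA divfK ?gt_eqF // divff ?gt_eqF // expr1n.
by rewrite expr_ge1 // ler_pdivlMr // mul1r ltW.
Qed.

(** * Measurability of random matrices *)

Lemma measurable_le_cst (R : realType) (disp : measure_display)
    (T : measurableType disp) (f : T -> R) (c : R) :
  measurable_fun [set: T] f -> measurable [set t | f t <= c].
Proof.
move=> mf; rewrite (_ : [set _ | _] = [set: T] `&` f @^-1` `]-oo, c]).
  exact: mf.
by rewrite setTI; apply/seteqP; split => t /=; rewrite in_itv.
Qed.

Definition measurable_mx (R : realType) (disp : measure_display)
    (T : measurableType disp) (p q : nat) (M : T -> 'M[R]_(p, q)) : Prop :=
  forall i j, measurable_fun [set: T] (fun t => M t i j).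

Lemma measurable_coord (R : realType) (d : nat) i :
  measurable_fun [set: bvec R d] (fun x : bvec R d => (x : 'cV[R]_d) i 0).
Proof.
apply: (measurability _ (RGenOpens.measurableE R)) => _ [_ [a [b ->]] <-].
rewrite setTI; apply: sub_sigma_algebra; rewrite /=.
apply: open_comp; last exact: interval_open.
by move=> x _; exact: coord_continuous.
Qed.

Lemma random_vector_mx (R : realType) (disp : measure_display)
    (T : measurableType disp) (d : nat) (X : T -> 'cV[R]_d) :
  random_vector X -> measurable_mx X.
Proof.
move=> mX i j; rewrite (ord1 j).
exact: (measurableT_comp (@measurable_coord R d i) mX).
Qed.

Lemma measurable_mxD (R : realType) (disp : measure_display)
    (T : measurableType disp) (p q : nat) (M N : T -> 'M[R]_(p, q)) :
  measurable_mx M -> measurable_mx N -> measurable_mx (fun t => M t + N t).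
Proof.
move=> mM mN i j; rewrite (_ : (fun _ => _) = (fun t => M t i j + N t i j)).
  exact: measurable_funD.
by apply/funext => t; rewrite mxE.
Qed.

Lemma measurable_mxZ (R : realType) (disp : measure_display)
    (T : measurableType disp) (p q : nat) (f : T -> R) (M : T -> 'M[R]_(p, q)) :
  measurable_fun [set: T] f -> measurable_mx M ->
  measurable_mx (fun t => f t *: M t).
Proof.
move=> mf mM i j; rewrite (_ : (fun _ => _) = (fun t => f t * M t i j)).
  exact: measurable_funM.
by apply/funext => t; rewrite mxE.
Qed.

Lemma measurable_mx_cst (R : realType) (disp : measure_display)
    (T : measurableType disp) (p q : nat) (A : 'M[R]_(p, q)) :
  measurable_mx (fun _ : T => A).
Proof. by move=> i j; exact: measurable_cst. Qed.

Lemma measurable_mxN (R : realType) (disp : measure_display)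
    (T : measurableType disp) (p q : nat) (M : T -> 'M[R]_(p, q)) :
  measurable_mx M -> measurable_mx (fun t => - M t).
Proof.
move=> mM; rewrite (_ : (fun _ => _) = (fun t => (-1) *: M t)).
  by apply: measurable_mxZ => //; exact: measurable_cst.
by apply/funext => t; rewrite scaleN1r.
Qed.

Lemma measurable_mxB (R : realType) (disp : measure_display)
    (T : measurableType disp) (p q : nat) (M N : T -> 'M[R]_(p, q)) :
  measurable_mx M -> measurable_mx N -> measurable_mx (fun t => M t - N t).
Proof. by move=> mM mN; apply: measurable_mxD => //; exact: measurable_mxN. Qed.

Lemma measurable_mx_sum (R : realType) (disp : measure_display)
    (T : measurableType disp) (p q : nat) (I : Type) (s : seq I)
    (M : I -> T -> 'M[R]_(p, q)) :
  (forall i, measurable_mx (M i)) ->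
  measurable_mx (fun t => \sum_(i <- s) M i t).
Proof.
move=> mM i j.
rewrite (_ : (fun _ => _) = (fun t => \sum_(k <- s) M k t i j)).
  by apply: measurable_sum => k; exact: mM.
by apply/funext => t; rewrite summxE.
Qed.

Lemma measurable_mxM (R : realType) (disp : measure_display)
    (T : measurableType disp) (p q r : nat) (M : T -> 'M[R]_(p, q))
    (N : T -> 'M[R]_(q, r)) :
  measurable_mx M -> measurable_mx N -> measurable_mx (fun t => M t *m N t).
Proof.
move=> mM mN i j.
rewrite (_ : (fun _ => _) = (fun t => \sum_k M t i k * N t k j)).
  by apply: measurable_sum => k; apply: measurable_funM; [exact: mM|exact: mN].
by apply/funext => t; rewrite mxE.
Qed.

Lemma measurable_mx_tr (R : realType) (disp : measure_display)
    (T : measurableType disp) (p q : nat) (M : T -> 'M[R]_(p, q)) :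
  measurable_mx M -> measurable_mx (fun t => (M t)^T).
Proof.
move=> mM i j; rewrite (_ : (fun _ => _) = (fun t => M t j i)); first exact: mM.
by apply/funext => t; rewrite mxE.
Qed.

Lemma measurable_inner (R : realType) (disp : measure_display)
    (T : measurableType disp) (d : nat) (x y : T -> 'cV[R]_d) :
  measurable_mx x -> measurable_mx y ->
  measurable_fun [set: T] (fun t => inner (x t) (y t)).
Proof.
move=> mx my; apply: measurable_sum => i.
by apply: measurable_funM; [exact: mx|exact: my].
Qed.

Lemma measurable_norm2 (R : realType) (disp : measure_display)
    (T : measurableType disp) (d : nat) (x : T -> 'cV[R]_d) :
  measurable_mx x -> measurable_fun [set: T] (fun t => norm2 (x t)).
Proof.
move=> mx; rewrite (_ : (fun _ => _) = (fun t => (inner (x t) (x t)) `^ (2^-1))).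
  apply: (measurableT_comp (measurable_powR (2^-1))).
  exact: measurable_inner.
by apply/funext => t; rewrite powR12_sqrt ?inner_ge0 // norm2E.
Qed.

Lemma measurable_clip (R : realType) (disp : measure_display)
    (T : measurableType disp) (d : nat) (B : R) (x : T -> 'cV[R]_d) :
  measurable_mx x -> measurable_mx (fun t => clip B (x t)).
Proof.
move=> mx; apply: measurable_mxZ => //.
rewrite (_ : (fun _ => _) = ((fun=> 1) \min (fun t => B * (norm2 (x t)) `^ (-1)))).
  apply: measurable_minr; first exact: measurable_cst.
  apply: measurable_funM; first exact: measurable_cst.
  apply: (measurableT_comp (measurable_powR (-1))).
  exact: measurable_norm2.
by apply/funext => t /=; rewrite powR_inv1 ?norm2_ge0.
Qed.

Lemma measurable_mxtrace (R : realType) (disp : measure_display)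
    (T : measurableType disp) (d : nat) (M : T -> 'M[R]_d) :
  measurable_mx M -> measurable_fun [set: T] (fun t => \tr (M t)).
Proof. by move=> mM; apply: measurable_sum => i; exact: mM. Qed.

(** Pointwise limit of the truncated exponential series, whose terms are
    polynomials in the entries *)
Lemma measurable_mxtrace_exp (R : realType) (disp : measure_display)
    (T : measurableType disp) (d : nat) (M : T -> 'M[R]_d) :
  measurable_mx M -> (forall t, (M t)^T = M t) ->
  measurable_fun [set: T] (fun t => \tr (mxexp (M t))).
Proof.
move=> mM sM; pose F n t := \sum_(0 <= i < n) \tr (iter i (mulmx (M t)) 1%:M) / i`!%:R.
apply: (measurable_fun_cvg (h := F)) => [n|t _]; last exact: mxtrace_exp_cvg.
apply: measurable_sum => i; apply: measurable_funM; last exact: measurable_cst.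
apply: measurable_mxtrace; elim: i => [|i IH] /=; first exact: measurable_mx_cst.
exact: measurable_mxM.
Qed.

Lemma measurable_opnorm_le (R : realType) (disp : measure_display)
    (T : measurableType disp) (d : nat) (M : T -> 'M[R]_d) (c : R) :
  measurable_mx M -> (forall t, (M t)^T = M t) ->
  measurable [set t | opnorm (M t) <= c].
Proof.
move=> mM sM; have [c0|c0] := ltP c 0.
  rewrite (_ : [set _ | _] = set0) //; apply/seteqP; split => // t /=.
  by rewrite leNgt (lt_le_trans c0 (opnorm_ge0 (sM t))).
have sZ (n : nat) t : (n%:R *: M t)^T = n%:R *: M t by rewrite linearZ /= sM.
rewrite (_ : [set _ | _] = \bigcap_(n in [set: nat])
   ([set t | \tr (mxexp (n%:R *: M t)) <= d%:R * expR (n%:R * c)] `&`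
    [set t | \tr (mxexp (- (n%:R *: M t))) <= d%:R * expR (n%:R * c)])).
  have mZ (n : nat) : measurable_mx (fun t => n%:R *: M t).
    by apply: measurable_mxZ => //; exact: measurable_cst.
  apply: bigcapT_measurable => n; apply: measurableI; apply: measurable_le_cst.
    exact: measurable_mxtrace_exp.
  apply: measurable_mxtrace_exp; first exact: measurable_mxN.
  by move=> t; rewrite linearN /= sZ.
apply/seteqP; split => t /=.
  by move=> /(opnorm_le_mxexp (sM t) c0) h n _; exact: h.
by move=> h; apply/(opnorm_le_mxexp (sM t) c0) => n; exact: h.
Qed.

(** * Independent blocks of a sample *)

(** Generators of the sigma-algebra of the sub-sample indexed by [S] *)
Definition block_gen (R : realType) (disp : measure_display)
    (T : measurableType disp) (d m : nat) (X : 'I_m -> T -> 'cV[R]_d)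
    (S : {set 'I_m}) : set (set T) :=
  [set B | exists2 A : 'I_m -> set (bvec R d),
     (forall i, measurable (A i)) & B = \bigcap_(i in [set` S]) (X i @^-1` A i)].

Notation blockT X S := (g_sigma_algebraType (block_gen X S)).

Lemma block_gen_setI (R : realType) (disp : measure_display)
    (T : measurableType disp) (d m : nat) (X : 'I_m -> T -> 'cV[R]_d) S :
  setI_closed (block_gen X S).
Proof.
move=> _ _ [A mA ->] [B mB ->]; exists (fun i => A i `&` B i).
  by move=> i; apply: measurableI.
apply/seteqP; split => t.
  by move=> [tA tB] i Si; split; [exact: tA|exact: tB].
by move=> tAB; split => i Si; have [] := tAB i Si.
Qed.

Lemma block_gen_measurable (R : realType) (disp : measure_display)
    (T : measurableType disp) (d m : nat) (X : 'I_m -> T -> 'cV[R]_d) S :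
  (forall i, random_vector (X i)) -> block_gen X S `<=` measurable.
Proof.
move=> mX _ [A mA ->]; apply: fin_bigcap_measurable; first exact: finite_finset.
by move=> i _; rewrite -[X in measurable X]setTI; exact: mX.
Qed.

Lemma block_gen_setT (R : realType) (disp : measure_display)
    (T : measurableType disp) (d m : nat) (X : 'I_m -> T -> 'cV[R]_d) S :
  block_gen X S [set: T].
Proof.
exists (fun=> setT) => // ; apply/esym; rewrite -subTset => t _ i _ //.
Qed.

Lemma block_measurable (R : realType) (disp : measure_display)
    (T : measurableType disp) (d m : nat) (X : 'I_m -> T -> 'cV[R]_d) S :
  (forall i, random_vector (X i)) -> <<s block_gen X S >> `<=` @measurable _ T.
Proof.
move=> mX; apply: smallest_sub; first exact: sigma_algebra_measurable.
exact: block_gen_measurable.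
Qed.

Lemma block_coordinate (R : realType) (disp : measure_display)
    (T : measurableType disp) (d m : nat) (X : 'I_m -> T -> 'cV[R]_d)
    (S : {set 'I_m}) i :
  i \in S -> @random_vector R _ (blockT X S) d (X i).
Proof.
move=> iS _ A mA; rewrite setTI; apply: sub_sigma_algebra.
exists (fun j => if j == i then A else setT); first by move=> j; case: ifP.
apply/seteqP; split => t /=.
  by move=> tA j _ /=; case: eqVneq => [->|].
by move=> /(_ i iS) /=; rewrite eqxx.
Qed.

Lemma block_subset (R : realType) (disp : measure_display)
    (T : measurableType disp) (d m : nat) (X : 'I_m -> T -> 'cV[R]_d)
    (S S' : {set 'I_m}) :
  S \subset S' -> <<s block_gen X S >> `<=` <<s block_gen X S' >>.
Proof.
move=> SS'; apply: smallest_sub; first exact: smallest_sigma_algebra.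
move=> _ [A mA ->]; apply: sub_sigma_algebra.
exists (fun i => if i \in S then A i else setT); first by move=> i; case: ifP.
apply/seteqP; split => t tA i /= iS.
  by case: ifP => // iS0; exact: tA.
by have := tA i (fintype.subsetP SS' _ iS); rewrite /= iS.
Qed.

Lemma block_gen_independent (R : realType) (disp : measure_display)
    (T : measurableType disp) (P : probability T R) (d m : nat)
    (X : 'I_m -> T -> 'cV[R]_d) (S S' : {set 'I_m}) A B :
  independent_vectors P X -> [disjoint S & S']%bool ->
  block_gen X S A -> block_gen X S' B -> P (A `&` B) = (P A * P B)%E.
Proof.
move=> iX SS' [a ma ->] [b mb ->].
pose c i := if i \in S then a i else b i.
have mc i : measurable (c i) by rewrite /c; case: ifP.
have -> : \bigcap_(i in [set` S]) (X i @^-1` a i) `&` \bigcap_(i in [set` S']) (X i @^-1` b i) =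
   \bigcap_(i in [set` S :|: S']) (X i @^-1` c i).
  apply/seteqP; split => t /=.
    move=> [ta tb] i /=; rewrite finset.in_setU /c; case: ifP => [iS _|iS /= iS']; first exact: ta.
    exact: tb.
  move=> tc; split => i iS /=.
    by have := tc i; rewrite /c /= finset.in_setU iS; apply.
  have := tc i; rewrite /c /= finset.in_setU iS orbT.
  by rewrite (disjointFl SS' iS); apply.
rewrite !iX // (eq_bigl [predU S & S']); last by move=> i; rewrite finset.in_setU.
rewrite bigU //=.
rewrite (eq_bigr (fun i => P (X i @^-1` a i))); last by move=> i iS; rewrite /c iS.
congr (_ * _)%E; apply: eq_bigr => i iS; rewrite /c.
by rewrite (disjointFl SS' iS).
Qed.

(** Extends the product rule from rectangles to the generated sigma-algebras,
    one factor at a time: two finite measures that agree on a generating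
    pi-system coincide. *)
Lemma block_independent (R : realType) (disp : measure_display)
    (T : measurableType disp) (P : probability T R) (d m : nat)
    (X : 'I_m -> T -> 'cV[R]_d) (S S' : {set 'I_m}) A B :
  (forall i, random_vector (X i)) ->
  independent_vectors P X -> [disjoint S & S']%bool ->
  <<s block_gen X S >> A -> <<s block_gen X S' >> B ->
  P (A `&` B) = (P A * P B)%E.
Proof.
move=> mX iX SS'.
have ext (S0 : {set 'I_m}) (B0 : set T) : measurable B0 ->
    (forall A, block_gen X S0 A -> P (A `&` B0) = (P A * P B0)%E) ->
    forall A, <<s block_gen X S0 >> A -> P (A `&` B0) = (P A * P B0)%E.
  move=> mB0 gA A0 sA.
  have pB0 : (0 <= fine (P B0))%R by rewrite fine_ge0.
  have mscE A1 : mscale (NngNum pB0) P A1 = (P A1 * P B0)%E.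
    by rewrite /mscale /= fineK ?fin_num_measure // muleC.
  rewrite -mscE.
  apply: (g_sigma_algebra_measure_unique (block_gen X S0) _ (fun=> setT) _ _
    (mrestr P mB0) (mscale (NngNum pB0) P)) => //.
  - exact: block_gen_measurable.
  - by move=> _; exact: block_gen_setT.
  - by rewrite bigcup_const.
  - exact: block_gen_setI.
  - move=> A1 gA1; transitivity (P (A1 `&` B0)) => //.
    by rewrite gA //; exact/esym/mscE.
  - by move=> _; apply: le_lt_trans (probability_le1 P _) (ltry _); apply: measurableI.
move=> sA sB; rewrite setIC muleC.
have mA := block_measurable mX sA.
apply: (ext S') => // B1 gB1; rewrite setIC muleC.
have mB1 : measurable B1 by exact: block_gen_measurable gB1.
apply: (ext S) => // A1 gA1; exact: block_gen_independent gA1 gB1.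
Qed.

Lemma measurable_to_block (R : realType) (disp : measure_display)
    (T : measurableType disp) (d m : nat) (X : 'I_m -> T -> 'cV[R]_d) S :
  (forall i, random_vector (X i)) ->
  measurable_fun [set: T] (fun w : T => (w : blockT X S)).
Proof. by move=> mX _ A mA; rewrite setTI; exact: block_measurable mA. Qed.

(** Conditioning on the past: the joint law of a sub-sample and a further
    observation is a product, so the new observation may be integrated out with
    the earlier ones frozen. *)
Lemma fubini_block (R : realType) (disp : measure_display)
    (T : measurableType disp) (P : probability T R) (d m : nat)
    (X : 'I_m -> T -> 'cV[R]_d) (S : {set 'I_m}) i
    (F : blockT X S * bvec R d -> \bar R) :
  (forall i, random_vector (X i)) -> independent_vectors P X -> i \notin S ->
  measurable_fun [set: blockT X S * bvec R d] F -> (forall z, (0 <= F z)%E) ->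
  (\int[P]_w F (w, X i w) = \int[P]_w \int[P]_w' F (w, X i w'))%E.
Proof.
move=> mX iX iS mF F0.
have mI := @measurable_to_block _ _ _ _ _ _ S mX.
have mJ : measurable_fun [set: T] (fun w : T => ((w : blockT X S), (X i w : bvec R d))).
  by apply: measurable_fun_pair; [exact: mI|exact: mX].
pose I0 : {mfun T >-> blockT X S} := mfun_Sub (mem_set mI).
pose X0 : {mfun T >-> bvec R d} := mfun_Sub (mem_set (mX i)).
pose J0 : {mfun T >-> (blockT X S * bvec R d)%type} := mfun_Sub (mem_set mJ).
pose m1 : probability (blockT X S) R := distribution P I0.
pose m2 : probability (bvec R d) R := distribution P X0.
pose m' : probability (blockT X S * bvec R d)%type R := distribution P J0.
have E A : measurable A -> (m1 \x m2)%E A = m' A.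
  apply: product_measure_unique => A0 B0 mA mB.
  have sB : <<s block_gen X [set i]%SET >> (X i @^-1` B0).
    have ii : i \in [set i]%SET by rewrite finset.in_set1.
    by have := @block_coordinate _ _ _ _ _ X _ _ ii measurableT _ mB; rewrite setTI.
  have ds : [disjoint S & [set i]%SET]%bool by rewrite disjoint_sym disjoints1.
  exact: (block_independent mX iX ds mA sB).
transitivity (\int[m']_z F z)%E.
  by rewrite ge0_integral_distribution.
transitivity (\int[(m1 \x m2)%E]_z F z)%E.
  by apply: eq_measure_integral => A mA _; exact/esym/E.
rewrite fubini_tonelli1 // /fubini_F.
have mG := measurable_fun_fubini_tonelli_F (m2 := m2) F mF F0.
rewrite ge0_integral_distribution //; last by move=> y; exact: integral_ge0.
apply: eq_integral => w _ /=.
rewrite ge0_integral_distribution //.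
exact: measurable_fun_pair2.
Qed.

Lemma ge0_integral_identically_distributed (R : realType) (disp : measure_display)
    (T : measurableType disp) (P : probability T R) (d : nat)
    (X Y : T -> 'cV[R]_d) (f : bvec R d -> \bar R) :
  random_vector X -> random_vector Y -> identically_distributed P X Y ->
  measurable_fun [set: bvec R d] f -> (forall x, (0 <= f x)%E) ->
  (\int[P]_w f (X w) = \int[P]_w f (Y w))%E.
Proof.
move=> mX mY XY mf f0.
pose X0 : {mfun T >-> bvec R d} := mfun_Sub (mem_set mX).
pose Y0 : {mfun T >-> bvec R d} := mfun_Sub (mem_set mY).
transitivity (\int[distribution P X0]_x f x)%E.
  by rewrite ge0_integral_distribution.
transitivity (\int[distribution P Y0]_x f x)%E; last by rewrite ge0_integral_distribution.
by apply: eq_measure_integral => A mA _; exact: XY.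
Qed.

Lemma integral_probability_cst (R : realType) (disp : measure_display)
    (T : measurableType disp) (P : probability T R) (c : R) :
  (\int[P]_w c%:E = c%:E)%E.
Proof.
rewrite integral_cst; last exact: measurableT.
by rewrite -[RHS]mule1; congr (_ * _)%E; exact: probability_setT.
Qed.

(** Exponential-supermartingale principle: a one-step bound on a nonnegative
    potential of a random walk iterates along independent increments. *)
Lemma potential_random_walk (R : realType) (disp : measure_display)
    (T : measurableType disp) (P : probability T R) (d m p q : nat)
    (X : T -> 'cV[R]_d) (Xs : 'I_m -> T -> 'cV[R]_d)
    (D : 'M[R]_(p, q) -> Prop) (Phi : 'M[R]_(p, q) -> R)
    (g : 'cV[R]_d -> 'M[R]_(p, q)) (c b : R) (M0 : 'M[R]_(p, q)) (s : seq 'I_m) :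
  random_vector X -> iid_copies P X Xs ->
  (forall (disp' : measure_display) (T' : measurableType disp') (M : T' -> 'M[R]_(p, q)),
     measurable_mx M -> (forall t, D (M t)) -> measurable_fun [set: T'] (Phi \o M)) ->
  @measurable_mx _ _ (bvec R d) _ _ g ->
  (forall M, D M -> 0 <= Phi M) ->
  D M0 -> (forall M x, D M -> D (M + g x)) ->
  0 <= c -> 0 <= b ->
  (forall M, D M -> \int[P]_w (Phi (M + g (X w)))%:E <= (c * Phi M + b)%:E)%E ->
  uniq s ->
  (\int[P]_w (Phi (M0 + \sum_(i <- s) g (Xs i w)))%:E <=
   (iter (size s) (fun u => c * u + b)%R (Phi M0))%:E)%E.
Proof.
move=> mX [mXs idX iX] mPhi mg Phi0 D0 Dg c0 b0 step.
have DS (s' : seq 'I_m) w : D (M0 + \sum_(i <- s') g (Xs i w)).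
  elim: s' => [|i s' IH]; first by rewrite big_nil addr0.
  by rewrite big_cons (addrC (g _)) addrA; exact: Dg.
elim: s => [_|i s IH /= /andP[nis us]].
  under eq_integral do rewrite big_nil addr0.
  by rewrite integral_probability_cst.
pose S := [set j in s]%SET.
have iS : i \notin S by rewrite finset.inE.
pose A (w : T) := M0 + \sum_(j <- s) g (Xs j w).
have mA : @measurable_mx _ _ (blockT Xs S) _ _ A.
  apply: measurable_mxD; first exact: measurable_mx_cst.
  rewrite (_ : (fun t => _) = (fun t => \sum_(j <- s) if j \in s then g (Xs j t) else 0)).
    apply: measurable_mx_sum => j a e; have [js|_] := boolP (j \in s); last exact: measurable_cst.
    have jS : j \in S by rewrite finset.inE.
    exact: (measurableT_comp (mg a e) (block_coordinate (X := Xs) jS)).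
  by apply/funext => t; rewrite !big_seq; apply: eq_bigr => j ->.
pose F (z : blockT Xs S * bvec R d) : \bar R := (Phi (A z.1 + g z.2))%:E.
have mF : measurable_fun [set: blockT Xs S * bvec R d] F.
  apply/measurable_EFinP; apply: mPhi => [|[w x]]; last exact/Dg/DS.
  apply: measurable_mxD => a e.
    exact: (measurableT_comp (mA a e) measurable_fst).
  exact: (measurableT_comp (mg a e) measurable_snd).
have F0 z : (0 <= F z)%E by rewrite lee_fin; apply/Phi0/Dg/DS.
have mAT : measurable_mx A.
  move=> a e; exact: (measurableT_comp (mA a e) (measurable_to_block (S := S) mXs)).
have mPA : measurable_fun [set: T] (fun w => (Phi (A w))%:E).
  by apply/measurable_EFinP; apply: mPhi => // w; exact: DS.
have -> : (\int[P]_w (Phi (M0 + \sum_(j <- i :: s) g (Xs j w)))%:E = \int[P]_w F (w, Xs i w))%E.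
  by apply: eq_integral => w _; rewrite /F /A big_cons /= (addrC (g _)) addrA.
rewrite (fubini_block mXs iX iS mF F0).
apply: (@le_trans _ _ (\int[P]_w (c * Phi (A w) + b)%:E)%E).
  apply: ge0_le_integral => //.
  - by move=> w _; exact: integral_ge0.
  - have := measurable_fun_fubini_tonelli_F (m2 := distribution P (mfun_Sub (mem_set (mXs i)))) F mF F0.
    move=> mG; have := measurableT_comp mG (measurable_to_block (S := S) mXs).
    rewrite /fubini_F; congr (measurable_fun _ _); apply/funext => w /=.
    rewrite ge0_integral_distribution //.
    exact: measurable_fun_pair2.
  - apply/measurable_EFinP; apply: measurable_funD; last exact: measurable_cst.
    by apply: measurable_funM; [exact: measurable_cst|exact/measurable_EFinP].
  - move=> w _; apply: le_trans (step (A w) (DS s w)).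
    rewrite le_eqVlt; apply/orP; left; apply/eqP.
    apply: (@ge0_integral_identically_distributed _ _ _ P _ (Xs i) X (fun x => (Phi (A w + g x))%:E)) => //.
    + exact: measurable_fun_pair2 mF.
    + by move=> x; rewrite lee_fin; apply/Phi0/Dg/DS.
under eq_integral do rewrite EFinD EFinM.
rewrite ge0_integralD //; last 2 first.
- by move=> w _; rewrite mule_ge0 // lee_fin //; apply/Phi0/DS.
- exact: emeasurable_funM.
rewrite integral_probability_cst ge0_integralZl //; last first.
  by move=> w _; rewrite lee_fin; apply/Phi0/DS.
by rewrite EFinD EFinM leeD2r // lee_wpmul2l ?lee_fin // IH.
Qed.

(** * Expectations of real random variables *)

Definition rint (R : realType) (disp : measure_display) (T : measurableType disp)
    (P : probability T R) (f : T -> R) : Prop :=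
  P.-integrable [set: T] (EFin \o f).

Definition Ex (R : realType) (disp : measure_display) (T : measurableType disp)
    (P : probability T R) (f : T -> R) : R := \int[P]_w f w.

Lemma rint_measurable (R : realType) (disp : measure_display)
    (T : measurableType disp) (P : probability T R) (f : T -> R) :
  rint P f -> measurable_fun [set: T] f.
Proof. by move=> /integrableP[mf _]; apply/measurable_EFinP. Qed.

Lemma EFin_Ex (R : realType) (disp : measure_display) (T : measurableType disp)
    (P : probability T R) (f : T -> R) :
  rint P f -> (\int[P]_w (f w)%:E = (Ex P f)%:E)%E.
Proof. by move=> fi; rewrite /Ex /Rintegral fineK // integrable_fin_num. Qed.

Lemma rint_dominated (R : realType) (disp : measure_display)
    (T : measurableType disp) (P : probability T R) (f g : T -> R) :
  measurable_fun [set: T] f -> rint P g -> (forall w, `|f w| <= g w) -> rint P f.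
Proof.
move=> mf gi fg; apply: (le_integrable _ _ _ gi) => //; first exact/measurable_EFinP.
by move=> w _; rewrite lee_fin (le_trans (fg w)) // ler_norm.
Qed.

Lemma rint_cst (R : realType) (disp : measure_display) (T : measurableType disp)
    (P : probability T R) (c : R) : rint P (fun=> c).
Proof. exact: finite_measure_integrable_cst. Qed.

Lemma rintD (R : realType) (disp : measure_display) (T : measurableType disp)
    (P : probability T R) (f g : T -> R) :
  rint P f -> rint P g -> rint P (fun w => f w + g w).
Proof. by move=> fi gi; apply: eq_integrable (integrableD _ fi gi). Qed.

Lemma rintZ (R : realType) (disp : measure_display) (T : measurableType disp)
    (P : probability T R) (c : R) (f : T -> R) :
  rint P f -> rint P (fun w => c * f w).
Proof. by move=> fi; apply: eq_integrable (integrableZl _ c fi). Qed.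

Lemma rintB (R : realType) (disp : measure_display) (T : measurableType disp)
    (P : probability T R) (f g : T -> R) :
  rint P f -> rint P g -> rint P (fun w => f w - g w).
Proof.
move=> fi gi; have -> : (fun w => f w - g w) = (fun w => f w + (-1) * g w).
  by apply/funext => w; rewrite mulN1r.
by apply: rintD => //; exact: rintZ.
Qed.

Lemma rint_sum (R : realType) (disp : measure_display) (T : measurableType disp)
    (P : probability T R) (I : Type) (s : seq I) (f : I -> T -> R) :
  (forall i, rint P (f i)) -> rint P (fun w => \sum_(i <- s) f i w).
Proof.
move=> fi; elim: s => [|i s IH].
  by under eq_fun do rewrite big_nil; exact: rint_cst.
by under eq_fun do rewrite big_cons; exact: rintD.
Qed.

Lemma ExD (R : realType) (disp : measure_display) (T : measurableType disp)
    (P : probability T R) (f g : T -> R) :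
  rint P f -> rint P g -> Ex P (fun w => f w + g w) = Ex P f + Ex P g.
Proof. by move=> fi gi; rewrite /Ex RintegralD. Qed.

Lemma ExB (R : realType) (disp : measure_display) (T : measurableType disp)
    (P : probability T R) (f g : T -> R) :
  rint P f -> rint P g -> Ex P (fun w => f w - g w) = Ex P f - Ex P g.
Proof. by move=> fi gi; rewrite /Ex RintegralB. Qed.

Lemma ExZ (R : realType) (disp : measure_display) (T : measurableType disp)
    (P : probability T R) (c : R) (f : T -> R) :
  rint P f -> Ex P (fun w => c * f w) = c * Ex P f.
Proof. by move=> fi; rewrite /Ex RintegralZl. Qed.

Lemma Ex_cst (R : realType) (disp : measure_display) (T : measurableType disp)
    (P : probability T R) (c : R) : Ex P (fun=> c) = c.
Proof. by rewrite /Ex /Rintegral integral_probability_cst. Qed.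

Lemma Ex_sum (R : realType) (disp : measure_display) (T : measurableType disp)
    (P : probability T R) (I : Type) (s : seq I) (f : I -> T -> R) :
  (forall i, rint P (f i)) ->
  Ex P (fun w => \sum_(i <- s) f i w) = \sum_(i <- s) Ex P (f i).
Proof.
move=> fi; elim: s => [|i s IH].
  by rewrite big_nil -[RHS](Ex_cst P); congr Ex; apply/funext => w; rewrite big_nil.
rewrite big_cons -IH -ExD //; last exact: rint_sum.
by congr Ex; apply/funext => w; rewrite big_cons.
Qed.

Lemma Ex_le (R : realType) (disp : measure_display) (T : measurableType disp)
    (P : probability T R) (f g : T -> R) :
  rint P f -> rint P g -> (forall w, f w <= g w) -> Ex P f <= Ex P g.
Proof. by move=> fi gi fg; apply: le_Rintegral. Qed.

Lemma Ex_ge0 (R : realType) (disp : measure_display) (T : measurableType disp)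
    (P : probability T R) (f : T -> R) : (forall w, 0 <= f w) -> 0 <= Ex P f.
Proof. by move=> f0; apply: Rintegral_ge0. Qed.

(** Cauchy-Schwarz, in the form in which it is chained: the product of bounds
    on the two second moments bounds the mixed moment. *)
Lemma Ex_mul_le (R : realType) (disp : measure_display) (T : measurableType disp)
    (P : probability T R) (f g : T -> R) (a b : R) :
  rint P (fun w => f w ^+ 2) -> rint P (fun w => g w ^+ 2) ->
  rint P (fun w => f w * g w) ->
  0 <= a -> 0 <= b -> Ex P (fun w => f w ^+ 2) <= a ^+ 2 ->
  Ex P (fun w => g w ^+ 2) <= b ^+ 2 -> Ex P (fun w => f w * g w) <= a * b.
Proof.
move=> ff gg fg a0 b0 fa gb.
have key x y : 0 <= x -> 0 <= y ->
    2 * (x * y) * Ex P (fun w => f w * g w) <= x ^+ 2 * a ^+ 2 + y ^+ 2 * b ^+ 2.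
  move=> x0 y0; apply: (@le_trans _ _ (x ^+ 2 * Ex P (fun w => f w ^+ 2) + y ^+ 2 * Ex P (fun w => g w ^+ 2))).
    rewrite -!ExZ // -ExD; try exact: rintZ.
    apply: Ex_le; [exact: rintZ|apply: rintD; exact: rintZ|move=> w].
    have := sqr_ge0 (x * f w - y * g w); lra.
  by rewrite lerD // ler_wpM2l ?sqr_ge0.
(* the optimal weights are [b] and [a]; if one of them vanishes, a large
   enough weight on the vanishing side gives the claim *)
have [a1|a1] := eqVneq a 0; last first.
  have [b1|b1] := eqVneq b 0; last first.
    have ap : 0 < a by rewrite lt_def a1.
    have bp : 0 < b by rewrite lt_def b1.
    have := key b a (ltW bp) (ltW ap).
    have : 0 < 2 * (b * a) by rewrite !mulr_gt0.
    by move=> h0 h; rewrite -(ler_pM2l h0) (le_trans h) //; lra.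
  rewrite b1 mulr0 leNgt; apply/negP => e0.
  have := key 1 (a ^+ 2 / Ex P (fun w => f w * g w)) ler01.
  have ap : 0 < a by rewrite lt_def a1.
  rewrite b1 expr0n /= mulr0 addr0 divr_ge0 ?sqr_ge0 ?(ltW e0) // => /(_ isT).
  rewrite !mul1r -mulrA divfK ?gt_eqF // expr1n mul1r.
  by have := exprn_gt0 2 ap; lra.
rewrite a1 mul0r leNgt; apply/negP => e0.
have := key ((b ^+ 2 + 1) / Ex P (fun w => f w * g w)) 1.
rewrite a1 expr0n /= mulr0 add0r divr_ge0 ?(ltW e0) ?ler01 ?addr_ge0 ?sqr_ge0 // => /(_ isT isT).
rewrite mulr1 -mulrA divfK ?gt_eqF // expr1n mul1r.
by have := sqr_ge0 b; lra.
Qed.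

Lemma measurable_rint_bounded (R : realType) (disp : measure_display)
    (T : measurableType disp) (P : probability T R) (f : T -> R) (c : R) :
  measurable_fun [set: T] f -> (forall w, `|f w| <= c) -> rint P f.
Proof. by move=> mf fc; apply: rint_dominated (rint_cst P c) fc. Qed.

Lemma measurable_mx_outer (R : realType) (disp : measure_display)
    (T : measurableType disp) (d : nat) (a : T -> 'cV[R]_d) :
  measurable_mx a -> measurable_mx (fun t => a t *m (a t)^T).
Proof. by move=> ma; apply: measurable_mxM => //; exact: measurable_mx_tr. Qed.

(** * Exponential moments of matrix random walks *)

(** Averages a bound at the eigenvectors of the exponential into a trace
    bound. *)
Lemma mxtrace_exp_quad_le (R : realType) (d : nat) (H : 'M[R]_d) (b : R)
    (w : 'I_d -> R) (v : 'I_d -> 'cV[R]_d) (z : 'I_d -> R) (C : 'M[R]_d) :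
  (forall k, 0 <= w k) -> (forall k, inner (v k) (v k) = 1) ->
  \tr (mxexp H) = \sum_k w k ->
  \tr (mxexp H *m C) = \sum_k w k * inner (v k) (C *m v k) ->
  (forall k, z k <= inner (v k) (C *m v k) + b) ->
  \sum_k w k * z k <= \tr (mxexp H *m C) + b * \tr (mxexp H).
Proof.
move=> w0 v1 -> -> zk; rewrite mulr_sumr -big_split ler_sum // => k _ /=.
by rewrite (mulrC b) -mulrDr ler_wpM2l.
Qed.

(** Subtract the compensator first.  From [M - B], the rank-one increment adds
    on average at most the trace of [B + b] against the exponential, and Klein's
    inequality gives the [B] part back when returning to [M]. *)
Lemma matrix_upper_step (R : realType) (disp : measure_display)
    (T : measurableType disp) (P : probability T R) (d : nat)
    (a : T -> 'cV[R]_d) (B : 'M[R]_d) (b : R) (M : 'M[R]_d) :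
  measurable_mx a -> (forall w, inner (a w) (a w) <= 2 / 3) ->
  B^T = B -> 0 <= b -> (forall v, 0 <= inner v (B *m v)) ->
  (forall v, inner v v = 1 ->
     Ex P (fun w => (1 + 3 / 2 * inner (a w) (a w)) * inner (a w) v ^+ 2)
     <= inner v (B *m v) + b) ->
  M^T = M ->
  (\int[P]_w (\tr (mxexp (M + (a w *m (a w)^T - B))))%:E
   <= ((1 + b) * \tr (mxexp M))%:E)%E.
Proof.
move=> ma a1 sB b0 B0 Ha sM; pose H := M - B.
have sH : H^T = H by exact: trmxB_sym.
have sHa w : (H + a w *m (a w)^T)^T = H + a w *m (a w)^T.
  by apply: trmxD_sym => //; exact: trmx_outer.
have shiftE w : M + (a w *m (a w)^T - B) = H + a w *m (a w)^T.
  by rewrite /H addrA addrAC.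
have [w [v [w0 v1 trE qE tE]]] := mxexp_eigen sH.
pose z k t := (1 + 3 / 2 * inner (a t) (a t)) * inner (a t) (v k) ^+ 2.
have zi k : rint P (z k).
  apply: (@measurable_rint_bounded _ _ _ _ _ (2 * (2 / 3))).
    apply: measurable_funM; last first.
      apply: measurable_funX; apply: measurable_inner => //; exact: measurable_mx_cst.
    apply: measurable_funD; first exact: measurable_cst.
    by apply: measurable_funM; [exact: measurable_cst|exact: measurable_inner].
  move=> t; rewrite ger0_norm; last first.
    by rewrite mulr_ge0 ?sqr_ge0 // addr_ge0 // mulr_ge0 ?inner_ge0 // divr_ge0 ?ler0n.
  have q0 := inner_ge0 (a t); have q1 := a1 t.
  have cs : inner (a t) (v k) ^+ 2 <= inner (a t) (a t).
    rewrite -real_normK ?num_real // -[X in _ <= X]norm2_sqr ler_pXn2r ?nnegrE ?norm2_ge0 //.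
    by apply: le_trans (inner_CS _ _) _; rewrite [norm2 (v k)]norm2E v1 sqrtr1 mulr1.
  rewrite ler_pM ?sqr_ge0 //; first by lra.
    by lra.
  exact: le_trans cs q1.
pose U t := \tr (mxexp H) + \sum_k w k * z k t.
have Ui : rint P U.
  by apply: rintD; [exact: rint_cst|apply: rint_sum => k; exact: rintZ].
apply: (@le_trans _ _ (\int[P]_t (U t)%:E)%E).
  apply: ge0_le_integral => //.
  - by move=> t _; rewrite lee_fin mxtrace_exp_ge0 // shiftE.
  - apply/measurable_EFinP; apply: measurable_mxtrace_exp.
      apply: measurable_mxD; first exact: measurable_mx_cst.
      by apply: measurable_mxB; [exact: measurable_mx_outer|exact: measurable_mx_cst].
    by move=> t; rewrite shiftE.
  - by apply/measurable_EFinP; exact: rint_measurable Ui.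
  - move=> t _; rewrite lee_fin shiftE.
    apply: le_trans (mxexp_rank1_up sH (a1 t)) _; rewrite lerD2l qE mulr_sumr.
    by apply: ler_sum => k _; rewrite mulrCA.
rewrite EFin_Ex // lee_fin /U ExD; last 2 first.
- exact: rint_cst.
- by apply: rint_sum => k; exact: rintZ.
rewrite Ex_cst Ex_sum; last by move=> k; exact: rintZ.
under eq_bigr do rewrite ExZ //.
have zB k : Ex P (z k) <= inner (v k) (B *m v k) + b by exact: Ha.
have := mxtrace_exp_quad_le w0 v1 trE (tE B) zB.
have := klein_expR sH sM; rewrite (_ : M - H = B); last by rewrite /H opprB addrC subrK.
have tB : 0 <= \tr (mxexp H *m B).
  by rewrite tE sumr_ge0 // => k _; rewrite mulr_ge0.
move=> kl; have hb : b * \tr (mxexp H) <= b * \tr (mxexp M).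
  by rewrite ler_wpM2l //; lra.
lra.
Qed.

(** As [matrix_upper_step] with opposite signs.  The error [b] is now weighted by
    the potential at [M + B], larger than at [M] by a factor at most
    [1 / (1 - k0)]. *)
Lemma matrix_lower_step (R : realType) (disp : measure_display)
    (T : measurableType disp) (P : probability T R) (d : nat)
    (a : T -> 'cV[R]_d) (B : 'M[R]_d) (b k0 : R) (M : 'M[R]_d) :
  measurable_mx a -> (forall w, inner (a w) (a w) <= 1) ->
  B^T = B -> 0 <= b -> k0 < 1 -> (forall v, inner v (B *m v) <= k0 * inner v v) ->
  (forall v, inner v v = 1 ->
     inner v (B *m v) - b <=
     Ex P (fun w => (1 - inner (a w) (a w)) * inner (a w) v ^+ 2)) ->
  M^T = M ->
  (\int[P]_w (\tr (mxexp (M + (B - a w *m (a w)^T))))%:E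
   <= ((1 + b / (1 - k0)) * \tr (mxexp M))%:E)%E.
Proof.
move=> ma a1 sB b0 k1 Bk Ha sM; pose H := M + B.
have sH : H^T = H by exact: trmxD_sym.
have sHa w : (H - a w *m (a w)^T)^T = H - a w *m (a w)^T.
  by apply: trmxB_sym => //; exact: trmx_outer.
have [w [v [w0 v1 trE qE tE]]] := mxexp_eigen sH.
pose z k t := (1 - inner (a t) (a t)) * inner (a t) (v k) ^+ 2.
have zi k : rint P (z k).
  apply: (@measurable_rint_bounded _ _ _ _ _ 1).
    apply: measurable_funM; last first.
      apply: measurable_funX; apply: measurable_inner => //; exact: measurable_mx_cst.
    by apply: measurable_funB; [exact: measurable_cst|exact: measurable_inner].
  move=> t; have q0 := inner_ge0 (a t); have q1 := a1 t.
  rewrite ger0_norm; last by rewrite mulr_ge0 ?sqr_ge0 // subr_ge0.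
  have cs : inner (a t) (v k) ^+ 2 <= inner (a t) (a t).
    rewrite -real_normK ?num_real // -[X in _ <= X]norm2_sqr ler_pXn2r ?nnegrE ?norm2_ge0 //.
    by apply: le_trans (inner_CS _ _) _; rewrite [norm2 (v k)]norm2E v1 sqrtr1 mulr1.
  by rewrite mulr_ile1 ?sqr_ge0 ?subr_ge0 // ?(le_trans cs q1) // lerBlDr lerDl.
pose U t := \tr (mxexp H) - \sum_k w k * z k t.
have Si : rint P (fun t => \sum_k w k * z k t).
  by apply: rint_sum => k; exact: rintZ.
have Ui : rint P U by apply: rintB => //; exact: rint_cst.
apply: (@le_trans _ _ (\int[P]_t (U t)%:E)%E).
  apply: ge0_le_integral => //.
  - by move=> t _; rewrite lee_fin addrA mxtrace_exp_ge0 //; exact: sHa.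
  - apply/measurable_EFinP; apply: measurable_mxtrace_exp.
      apply: measurable_mxD; first exact: measurable_mx_cst.
      by apply: measurable_mxB; [exact: measurable_mx_cst|exact: measurable_mx_outer].
    by move=> t; rewrite addrA; exact: sHa.
  - by apply/measurable_EFinP; exact: rint_measurable Ui.
  - move=> t _; rewrite lee_fin addrA -/H.
    apply: le_trans (mxexp_rank1_down (a t) sH) _; rewrite lerD2l lerN2 qE mulr_sumr.
    by apply: ler_sum => k _; rewrite mulrCA.
rewrite EFin_Ex // lee_fin /U ExB //; last exact: rint_cst.
rewrite Ex_cst Ex_sum; last by move=> k; exact: rintZ.
under eq_bigr do rewrite ExZ //.
have zB k : - Ex P (z k) <= inner (v k) (- B *m v k) + b.
  by rewrite mulNmx innerNr; have := Ha _ (v1 k); rewrite -/(z k); lra.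
have Sle := mxtrace_exp_quad_le w0 v1 trE (tE (- B)) zB.
rewrite (eq_bigr (fun k => - (w k * Ex P (z k)))) in Sle; last by move=> k _; rewrite mulrN.
rewrite sumrN in Sle.
have := klein_expR sH sM; rewrite (_ : M - H = - B); last by rewrite /H opprD addrA subrr add0r.
move=> kl; have := mxexp_trace_add sM sB k1 Bk; rewrite -/H => /(ler_wpM2l b0) add.
have -> : (1 + b / (1 - k0)) * \tr (mxexp M) = \tr (mxexp M) + b * (\tr (mxexp M) / (1 - k0)).
  by rewrite mulrDl mul1r -mulrA (mulrC (1 - k0)^-1).
lra.
Qed.

Lemma markov_ge0 (R : realType) (disp : measure_display) (T : measurableType disp)
    (P : probability T R) (f : T -> R) (c K : R) :
  measurable_fun [set: T] f -> (forall w, 0 <= f w) -> 0 < c ->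
  (\int[P]_w (f w)%:E <= K%:E)%E -> (P [set w | (c <= f w)%R] <= (K / c)%:E)%E.
Proof.
move=> mf f0 c0 fK.
have := @le_integral_comp_abse _ T R P setT measurableT (EFin \o f) c id
  (@measurable_id _ _ _) (fun r r0 => r0) (fun x y _ _ xy => xy).
move=> /(_ _ c0); rewrite setTI => H.
have {}H : (c%:E * P [set w | (c <= f w)%R] <= \int[P]_w (f w)%:E)%E.
  have -> : [set w | (c <= f w)%R] = [set x | (c%:E <= `|(EFin \o f) x|)%E].
    by apply/seteqP; split => w /=; rewrite lee_fin ger0_norm.
  apply: le_trans (H _) _; first exact/measurable_EFinP.
  rewrite le_eqVlt; apply/orP; left; apply/eqP; apply: eq_integral => w _ /=.
  by rewrite ger0_norm.
rewrite -(@lee_pmul2l _ c%:E) ?lte_fin //.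
by rewrite (le_trans H) // (le_trans fK) // -EFinM lee_fin mulrCA divff ?gt_eqF // mulr1.
Qed.

Lemma iter_scale (R : realType) (c x : R) n : iter n (fun u => c * u + 0) x = c ^+ n * x.
Proof. by elim: n => [|n /= ->]; rewrite ?expr0 ?mul1r // addr0 exprS mulrA. Qed.

(** Markov's inequality for the potential, which starts at [d] and grows by a
    factor [1 + b <= e^b] at each step *)
Lemma matrix_walk_tail (R : realType) (disp : measure_display)
    (T : measurableType disp) (P : probability T R) (d m : nat)
    (X : T -> 'cV[R]_d) (Xs : 'I_m -> T -> 'cV[R]_d)
    (g : 'cV[R]_d -> 'M[R]_d) (b u : R) :
  random_vector X -> iid_copies P X Xs ->
  @measurable_mx _ _ (bvec R d) _ _ g -> (forall x, (g x)^T = g x) -> 0 <= b ->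
  (forall M : 'M[R]_d, M^T = M ->
     \int[P]_w (\tr (mxexp (M + g (X w))))%:E <= ((1 + b) * \tr (mxexp M))%:E)%E ->
  (P [set w | (expR u <= \tr (mxexp (\sum_i g (Xs i w))))%R]
   <= (d%:R * expR (m%:R * b - u))%:E)%E.
Proof.
move=> mX iX mg sg b0 step.
have sS w : (\sum_i g (Xs i w))^T = \sum_i g (Xs i w).
  by rewrite raddf_sum; apply: eq_bigr => i _; exact: sg.
have [mXs _ _] := iX.
have mgX i : measurable_mx (fun w => g (Xs i w)).
  by move=> k l; exact: (measurableT_comp (mg k l) (mXs i)).
apply: (@le_trans _ _ ((d%:R * expR (m%:R * b)) / expR u)%:E); last first.
  by rewrite lee_fin expRD expRN mulrA.
apply: markov_ge0; rewrite ?expR_gt0 //.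
- by apply: measurable_mxtrace_exp => //; apply: measurable_mx_sum.
- by move=> w; exact: mxtrace_exp_ge0.
have := @potential_random_walk _ _ _ P _ _ _ _ X Xs (fun M : 'M[R]_d => M^T = M)
  (fun M => \tr (mxexp M)) g (1 + b) 0 0 (index_enum 'I_m) mX iX.
move=> /(_ _ mg _ _ _ _ (lexx 0) _ (index_enum_uniq _)) H.
apply: le_trans.
  rewrite le_eqVlt; apply/orP; left; apply/eqP.
  by apply: eq_integral => w _; rewrite -[\sum_i _]add0r.
apply: le_trans (H _ _ _ _ _ _) _ => //.
- by move=> disp' T' M mM sM; exact: measurable_mxtrace_exp.
- by move=> M sM; exact: mxtrace_exp_ge0.
- by rewrite trmx0.
- by move=> M x sM; exact: trmxD_sym.
- by rewrite addr_ge0.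
- by move=> M sM; rewrite addr0; exact: step.
rewrite iter_scale mxtrace_exp0 lee_fin mulrC ler_wpM2l // ?ler0n //.
rewrite -[index_enum _]enumT size_enum_ord expRM_natl.
by apply: lerXn2r; rewrite ?nnegrE ?addr_ge0 ?expR_ge0 //; exact: expR_ge1Dx.
Qed.

(** * Blocks that misbehave *)

Lemma block_setI (R : realType) (disp : measure_display)
    (T : measurableType disp) (d m : nat) (X : 'I_m -> T -> 'cV[R]_d)
    (S : {set 'I_m}) A B :
  <<s block_gen X S >> A -> <<s block_gen X S >> B -> <<s block_gen X S >> (A `&` B).
Proof. by move=> sA sB; exact: (@measurableI _ (blockT X S)). Qed.

(** The first conclusion keeps the induction going: the intersection so far
    depends only on the union of the blocks used, which is disjoint from the
    next block. *)
Lemma independent_blocks_bigcap (R : realType) (disp : measure_display)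
    (T : measurableType disp) (P : probability T R) (d m k : nat)
    (X : 'I_m -> T -> 'cV[R]_d) (G : 'I_k -> {set 'I_m}) (E : 'I_k -> set T)
    (p : R) (s : seq 'I_k) :
  (forall i, random_vector (X i)) -> independent_vectors P X ->
  (forall j l, j != l -> [disjoint G j & G l]%bool) ->
  (forall j, <<s block_gen X (G j) >> (E j)) ->
  0 <= p -> (forall j, (P (E j) <= p%:E)%E) -> uniq s ->
  <<s block_gen X (\bigcup_(j in s) G j)%SET >> (\bigcap_(j in [set` s]) E j) /\
  (P (\bigcap_(j in [set` s]) E j) <= (p ^+ size s)%:E)%E.
Proof.
move=> mX iX disG sE p0 Ep; elim: s => [_|i s IH /= /andP[nis us]].
  rewrite (_ : \bigcap_(j in _) _ = setT); last by apply/seteqP; split => // t _ j.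
  split; last by rewrite expr0 probability_le1.
  exact: (@measurableT _ (blockT X _)).
have [sI pI] := IH us.
have -> : \bigcap_(j in [set` i :: s]) E j = E i `&` \bigcap_(j in [set` s]) E j.
  apply/seteqP; split => t /=.
    move=> h; split; first by apply: h => /=; rewrite mem_head.
    by move=> j js; apply: h => /=; rewrite in_cons [j \in s]js orbT.
  move=> [h h'] j /=; rewrite in_cons => /orP[/eqP ->//|js]; exact: h'.
have sub1 : G i \subset (\bigcup_(j in i :: s) G j)%SET.
  by apply: finset.bigcup_sup; rewrite mem_head.
have sub2 : (\bigcup_(j in s) G j)%SET \subset (\bigcup_(j in i :: s) G j)%SET.
  by apply/finset.bigcupsP => j js; apply: finset.bigcup_sup; rewrite in_cons js orbT.
split.
  apply: block_setI; first exact: block_subset sub1 _ (sE i).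
  exact: block_subset sub2 _ sI.
rewrite (block_independent mX iX _ (sE i) sI); last first.
  apply/finset.bigcup_disjointP => j js; rewrite disG //; first last.
    by apply: contraNneq nis => ->.
by rewrite exprS EFinM lee_pmul.
Qed.

(** If more than [k / q] blocks are bad, then so are all blocks of some [J] with
    [q * #|J| > k], an event of probability at most [(r ^ q) ^ #|J| <= r ^ k]; and
    there are at most [2 ^ k] choices of [J]. *)
Lemma few_bad_blocks (R : realType) (disp : measure_display)
    (T : measurableType disp) (P : probability T R) (d m k : nat)
    (X : 'I_m -> T -> 'cV[R]_d) (G : 'I_k -> {set 'I_m}) (E : 'I_k -> T -> bool)
    (r : R) (q : nat) :
  (forall i, random_vector (X i)) -> independent_vectors P X ->
  (forall j l, j != l -> [disjoint G j & G l]%bool) ->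
  (forall j, <<s block_gen X (G j) >> [set w | E j w]) ->
  0 <= r <= 1 -> (forall j, (P [set w | E j w] <= (r ^+ q)%:E)%E) ->
  exists W : set T, [/\ measurable W, (P W <= ((2 * r) ^+ k)%:E)%E &
    forall w, ~ W w -> (q * #|[pred j | E j w]| <= k)%N].
Proof.
move=> mX iX disG sE /andP[r0 r1] Ep.
pose bad (J : {set 'I_k}) := \bigcap_(j in [set` enum J]) [set w | E j w].
have badP (J : {set 'I_k}) := independent_blocks_bigcap mX iX disG sE (exprn_ge0 q r0) Ep (enum_uniq J).
pose C (J : {set 'I_k}) := if (k < q * #|J|)%N then bad J else set0.
have mC J : measurable (C J).
  by rewrite /C; case: ifP => // _; have [/(block_measurable mX)] := badP J.
have mU : measurable (\bigcup_(J in [set: {set 'I_k}]) C J).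
  apply: fin_bigcup_measurable => //; exact: finite_finset.
exists (\bigcup_(J in [set: {set 'I_k}]) C J); split => //.
  have CE J : (P (C J) <= (r ^+ k)%:E)%E.
    rewrite /C; case: ifPn => [kJ|_]; last by rewrite measure0 lee_fin exprn_ge0.
    have [_ h] := badP J; apply: le_trans h _; rewrite -cardE -exprM lee_fin.
    by rewrite ler_wiXn2l // ltnW.
  have -> : \bigcup_(J in [set: {set 'I_k}]) C J = \big[setU/set0]_(J <- index_enum {set 'I_k}) C J.
    rewrite -bigcup_seq; congr bigcup; apply/seteqP; split => // J _ /=.
    by rewrite mem_index_enum.
  apply: le_trans (_ : (\sum_(J <- index_enum {set 'I_k}) P (C J) <= _)%E).
    elim: (index_enum _) => [|J l IH]; first by rewrite !big_nil measure0.
    rewrite !big_cons; apply: le_trans (leeD2l _ IH).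
    apply: measureU2 => //; apply: bigsetU_measurable => ? _; exact: mC.
  apply: (@le_trans _ _ (\sum_(J : {set 'I_k}) (r ^+ k)%:E)%E).
    by apply: lee_sum => J _; exact: CE.
  rewrite sumEFin sumr_const lee_fin -cardsT -powersetT card_powerset cardsT card_ord.
  by rewrite exprMn -natrX mulr_natl.
move=> w nW; rewrite leqNgt; apply/negP => kJ; apply: nW.
exists [set j | E j w]%SET => //; rewrite /C cardsE kJ /bad => j /=.
by rewrite mem_enum finset.inE.
Qed.

Lemma measurable_ge_cst (R : realType) (disp : measure_display)
    (T : measurableType disp) (f : T -> R) (c : R) :
  measurable_fun [set: T] f -> measurable [set t | c <= f t].
Proof.
move=> mf; rewrite (_ : [set _ | _] = [set: T] `&` f @^-1` `[c, +oo[).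
  exact: mf.
by rewrite setTI; apply/seteqP; split => t /=; rewrite in_itv /= andbT.
Qed.

Lemma measurable_mx_block_sum (R : realType) (disp : measure_display)
    (T : measurableType disp) (d m p q : nat) (Xs : 'I_m -> T -> 'cV[R]_d)
    (h : 'cV[R]_d -> 'M[R]_(p, q)) (S : {set 'I_m}) :
  @measurable_mx _ _ (bvec R d) _ _ h ->
  @measurable_mx _ _ (blockT Xs S) _ _ (fun w => \sum_(i in S) h (Xs i w)).
Proof.
move=> mh; rewrite (_ : (fun t => _) = (fun t => \sum_i if i \in S then h (Xs i t) else 0)).
  apply: measurable_mx_sum => i a e; have [iS|_] := boolP (i \in S).
    exact: (measurableT_comp (mh a e) (block_coordinate (X := Xs) iS)).
  exact: measurable_cst.
by apply/funext => t; rewrite big_mkcond.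
Qed.

(** Chebyshev's inequality in each block, then [few_bad_blocks]: the
    probability of a bad block only has to be a small constant. *)
Lemma few_large_block_sums (R : realType) (disp : measure_display)
    (T : measurableType disp) (P : probability T R) (d m k n0 : nat)
    (X : T -> 'cV[R]_d) (Xs : 'I_m -> T -> 'cV[R]_d) (G : 'I_k -> {set 'I_m})
    (h : 'cV[R]_d -> 'cV[R]_d) (r tau t : R) (q : nat) :
  random_vector X -> iid_copies P X Xs ->
  (forall j l, j != l -> [disjoint G j & G l]%bool) -> (forall j, #|G j| = n0) ->
  @measurable_mx _ _ (bvec R d) _ _ h ->
  (forall v, rint P (fun w => inner v (h (X w)))) ->
  rint P (fun w => inner (h (X w)) (h (X w))) ->
  (forall v, Ex P (fun w => inner v (h (X w))) = 0) ->
  Ex P (fun w => inner (h (X w)) (h (X w))) <= tau ->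
  0 <= tau -> 0 < t -> 0 <= r <= 1 -> n0%:R * tau <= r ^+ q * t ->
  exists W : set T, [/\ measurable W, (P W <= ((2 * r) ^+ k)%:E)%E &
    forall w, ~ W w ->
      (q * #|[pred j | (t <= inner (\sum_(i in G j) h (Xs i w)) (\sum_(i in G j) h (Xs i w)))%R]| <= k)%N].
Proof.
move=> mX iX disG cG mh hi hhi h0 hh tau0 t0 r01 nt.
have [mXs _ indX] := iX.
apply: (few_bad_blocks (G := G) (X := Xs) (E := fun j w => (t <= inner (\sum_(i in G j) h (Xs i w)) (\sum_(i in G j) h (Xs i w)))%R)) => //.
  move=> j; have mS := measurable_mx_block_sum (Xs := Xs) (S := G j) mh.
  exact: (measurable_ge_cst t (measurable_inner mS mS)).
move=> j; apply: (@le_trans _ _ (n0%:R * tau / t)%:E); last first.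
  by rewrite lee_fin ler_pdivrMr.
have mSj : measurable_mx (fun w => \sum_(i in G j) h (Xs i w)).
  move=> a e; have := measurable_mx_block_sum (Xs := Xs) (S := G j) mh a e.
  by move=> mS; exact: (measurableT_comp mS (measurable_to_block (S := G j) mXs)).
apply: markov_ge0 => //; [exact: measurable_inner|by move=> w; exact: inner_ge0|].
have -> : n0%:R * tau = iter (size (enum (G j))) (fun u => 1 * u + tau) (inner (0 : 'cV[R]_d) 0).
  rewrite -cardE cG inner0l; elim: (n0) => [|n IH] /=; first by rewrite mul0r.
  by rewrite -IH -natr1 mulrDl !mul1r.
apply: le_trans (potential_random_walk (D := fun=> True) (Phi := fun M => inner M M)
   mX iX _ mh _ _ _ _ _ _ (enum_uniq _)) => //.
- rewrite le_eqVlt; apply/orP; left; apply/eqP.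
  by apply: eq_integral => w _; rewrite add0r big_enum.
- by move=> disp' T' M mM _; exact: measurable_inner.
- by move=> M _; exact: inner_ge0.
move=> M _; have E w : inner (M + h (X w)) (M + h (X w)) =
    inner M M + (2 * inner M (h (X w)) + inner (h (X w)) (h (X w))).
  by rewrite innerDl !innerDr (innerC (h _) M); ring.
under eq_integral do rewrite E.
have i1 : rint P (fun w => 2 * inner M (h (X w))) by exact: rintZ.
rewrite EFin_Ex; last by apply: rintD; [exact: rint_cst|exact: rintD].
rewrite ExD; [|exact: rint_cst|exact: rintD].
by rewrite ExD // ExZ // h0 mulr0 add0r Ex_cst mul1r lee_fin lerD2l.
Qed.

(** * Moments of the population *)

Section Population.
Context (R : realType) (disp : measure_display) (T : measurableType disp).
Context (P : probability T R) (d : nat) (X : T -> 'cV[R]_d).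
Hypotheses (mX : random_vector X) (fm : (fourth_moment P X < +oo)%E).
Local Notation Z := (centered P X).
Local Notation Sigma := (covariance_mx P X).

Lemma expectation_mxE p q (M : T -> 'M[R]_(p, q)) i j :
  expectation_mx P M i j = Ex P (fun w => M w i j).
Proof. by rewrite mxE unlock. Qed.

Lemma measurable_centered : measurable_mx Z.
Proof.
by apply: measurable_mxB; [exact: random_vector_mx|exact: measurable_mx_cst].
Qed.

Lemma rint_norm4 : rint P (fun w => norm2 (Z w) ^+ 4).
Proof.
have m4 : measurable_fun [set: T] (fun w => norm2 (Z w) ^+ 4).
  by apply: measurable_funX; apply: measurable_norm2; exact: measurable_centered.
apply/integrableP; split; first exact/measurable_EFinP.
move: fm; rewrite /fourth_moment unlock; congr (_ < _)%E.
by apply: eq_integral => w _ /=; rewrite ger0_norm // exprn_ge0 ?norm2_ge0.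
Qed.

(** Every polynomial of degree at most four in the centered vector is
    integrable. *)
Lemma rint_moment (f : T -> R) (c : R) : measurable_fun [set: T] f ->
  (forall w, `|f w| <= c * (1 + norm2 (Z w) ^+ 4)) -> rint P f.
Proof.
move=> mf fc; apply: rint_dominated fc => //; apply: rintZ; apply: rintD.
  exact: rint_cst.
exact: rint_norm4.
Qed.

Lemma measurable_inner_centered v : measurable_fun [set: T] (fun w => inner (Z w) v).
Proof. by apply: measurable_inner; [exact: measurable_centered|exact: measurable_mx_cst]. Qed.

Lemma rint_inner v : rint P (fun w => inner (Z w) v).
Proof.
apply: (@rint_moment _ (norm2 v)); first exact: measurable_inner_centered.
move=> w; apply: le_trans (inner_CS _ _) _; rewrite mulrC ler_wpM2l ?norm2_ge0 //.
have := norm2_ge0 (Z w); move: (norm2 _) => n n0.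
have := sqr_ge0 (n ^+ 2 - 1); have := sqr_ge0 (n - 1); nra.
Qed.

Lemma rint_sqnorm : rint P (fun w => inner (Z w) (Z w)).
Proof.
apply: (@rint_moment _ 1).
  by apply: measurable_inner; exact: measurable_centered.
move=> w; rewrite ger0_norm ?inner_ge0 // -norm2_sqr mul1r.
move: (norm2 _) => n; have := sqr_ge0 (n ^+ 2 - 1); nra.
Qed.

Lemma rint_inner2 u v : rint P (fun w => inner (Z w) u * inner (Z w) v).
Proof.
apply: (@rint_moment _ (norm2 u * norm2 v)).
  by apply: measurable_funM; exact: measurable_inner_centered.
move=> w; rewrite normrM; apply: (@le_trans _ _ ((norm2 (Z w) * norm2 u) * (norm2 (Z w) * norm2 v))).
  by rewrite ler_pM // inner_CS.
rewrite mulrACA mulrC ler_wpM2l ?mulr_ge0 ?norm2_ge0 //.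
move: (norm2 _) => n; have := sqr_ge0 (n ^+ 2 - 1); nra.
Qed.

Lemma rint_weighted u v : rint P (fun w => inner (Z w) (Z w) * (inner (Z w) u * inner (Z w) v)).
Proof.
apply: (@rint_moment _ (norm2 u * norm2 v)).
  apply: measurable_funM; first by apply: measurable_inner; exact: measurable_centered.
  by apply: measurable_funM; exact: measurable_inner_centered.
move=> w; rewrite !normrM ger0_norm ?inner_ge0 // -norm2_sqr.
apply: (@le_trans _ _ (norm2 (Z w) ^+ 2 * ((norm2 (Z w) * norm2 u) * (norm2 (Z w) * norm2 v)))).
  by rewrite ler_wpM2l ?sqr_ge0 // ler_pM // inner_CS.
have h : 0 <= norm2 u * norm2 v by rewrite mulr_ge0 ?norm2_ge0.
by move: (norm2 (Z w)) => n; lra.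
Qed.

Lemma rint_inner4 u v : rint P (fun w => inner (Z w) u ^+ 2 * inner (Z w) v ^+ 2).
Proof.
apply: (@rint_moment _ ((norm2 u * norm2 v) ^+ 2)).
  by apply: measurable_funM; apply: measurable_funX; exact: measurable_inner_centered.
move=> w; rewrite ger0_norm; last by apply: mulr_ge0; exact: sqr_ge0.
apply: (@le_trans _ _ ((norm2 (Z w) * norm2 u) ^+ 2 * (norm2 (Z w) * norm2 v) ^+ 2)).
  have cs x : inner (Z w) x ^+ 2 <= (norm2 (Z w) * norm2 x) ^+ 2.
    rewrite -real_normK ?num_real //.
    by rewrite ler_pXn2r ?nnegrE ?mulr_ge0 ?norm2_ge0 // inner_CS.
  by rewrite ler_pM ?sqr_ge0.
have h : 0 <= (norm2 u * norm2 v) ^+ 2 by rewrite sqr_ge0.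
by move: (norm2 (Z w)) => n; nra.
Qed.

Lemma innerE_delta (x : 'cV[R]_d) i : inner x (delta_mx i 0) = x i 0.
Proof.
rewrite /inner (bigD1 i) //= big1 => [|j ji].
  by rewrite !mxE !eqxx mulr1 addr0.
by rewrite !mxE (negbTE ji) mulr0.
Qed.

Lemma Ex_inner v : Ex P (fun w => inner (Z w) v) = 0.
Proof.
have Zi i : rint P (fun w => Z w i 0).
  by have := rint_inner (delta_mx i 0); under eq_fun do rewrite innerE_delta.
have Xi i : rint P (fun w => X w i 0).
  have := rintD (Zi i) (rint_cst P (mean P X i 0)); congr rint; apply/funext => w.
  by rewrite /centered !mxE subrK.
have E0 i : Ex P (fun w => Z w i 0) = 0.
  have -> : (fun w => Z w i 0) = (fun w => X w i 0 - mean P X i 0).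
    by apply/funext => w; rewrite /centered !mxE.
  by rewrite ExB ?Ex_cst //; [rewrite expectation_mxE subrr|exact: rint_cst].
rewrite /inner Ex_sum => [|i].
  rewrite big1 // => i _; under eq_fun do rewrite mulrC.
  by rewrite ExZ // E0 mulr0.
by under eq_fun do rewrite mulrC; exact: rintZ.
Qed.

Lemma Ex_quadratic (h : T -> R) v :
  (forall u v, rint P (fun w => h w * (inner (Z w) u * inner (Z w) v))) ->
  inner v (expectation_mx P (fun w => h w *: (Z w *m (Z w)^T)) *m v) =
  Ex P (fun w => h w * inner (Z w) v ^+ 2).
Proof.
move=> hi; have hij i j : rint P (fun w => h w * (Z w i 0 * Z w j 0)).
  have := hi (delta_mx i 0) (delta_mx j 0); congr rint.
  by apply/funext => w; rewrite !innerE_delta.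
have -> : (fun w => h w * inner (Z w) v ^+ 2) =
  (fun w => \sum_i \sum_j (v i 0 * v j 0) * (h w * (Z w i 0 * Z w j 0))).
  apply/funext => w; rewrite expr2 /inner mulr_suml mulr_sumr; apply: eq_bigr => i _.
  by rewrite !mulr_sumr; apply: eq_bigr => j _; ring.
rewrite Ex_sum => [|i]; last by apply: rint_sum => j; exact: rintZ.
apply: eq_bigr => i _; rewrite Ex_sum => [|j]; last exact: rintZ.
rewrite mxE mulr_sumr; apply: eq_bigr => j _; rewrite ExZ // expectation_mxE.
rewrite (_ : (fun w => _) = (fun w => h w * (Z w i 0 * Z w j 0))); first by ring.
by apply/funext => w; rewrite !mxE big_ord1 !mxE.
Qed.

Lemma expectation_mx_sym (h : T -> R) :
  (expectation_mx P (fun w => h w *: (Z w *m (Z w)^T)))^T =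
  expectation_mx P (fun w => h w *: (Z w *m (Z w)^T)).
Proof.
apply/matrixP => i j; rewrite mxE !expectation_mxE; congr Ex; apply/funext => w.
by rewrite -{1}(trmx_outer (Z w)) !mxE.
Qed.

Lemma covariance_scaled : Sigma = expectation_mx P (fun w => 1 *: (Z w *m (Z w)^T)).
Proof. by rewrite /covariance_mx; congr expectation_mx; apply/funext => w; rewrite scale1r. Qed.

Lemma covariance_sym : Sigma^T = Sigma.
Proof. by rewrite covariance_scaled expectation_mx_sym. Qed.

Lemma covariance_quad v : inner v (Sigma *m v) = Ex P (fun w => inner (Z w) v ^+ 2).
Proof.
rewrite covariance_scaled Ex_quadratic => [|u u']; first by under eq_fun do rewrite mul1r.
by under eq_fun do rewrite mul1r; exact: rint_inner2.
Qed.

Lemma covariance_trace : \tr Sigma = Ex P (fun w => inner (Z w) (Z w)).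
Proof.
rewrite /inner Ex_sum => [|i].
  apply: eq_bigr => i _; rewrite expectation_mxE; congr Ex; apply/funext => w.
  by rewrite !mxE big_ord1 !mxE.
have := rint_inner2 (delta_mx i 0) (delta_mx i 0); congr rint.
by apply/funext => w; rewrite !innerE_delta.
Qed.

Definition weighted_mx : 'M[R]_d :=
  expectation_mx P (fun w => norm2 (Z w) ^+ 2 *: (Z w *m (Z w)^T)).

Lemma weighted_quad v :
  inner v (weighted_mx *m v) = Ex P (fun w => inner (Z w) (Z w) * inner (Z w) v ^+ 2).
Proof.
rewrite /weighted_mx Ex_quadratic => [|u u']; first by under eq_fun do rewrite norm2_sqr.
by under eq_fun do rewrite norm2_sqr; exact: rint_weighted.
Qed.

Lemma sigma0_ge0 : 0 <= sigma0 P X. Proof. exact: sqrtr_ge0. Qed.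

Lemma sigma0_sqr : sigma0 P X ^+ 2 = opnorm weighted_mx.
Proof. by rewrite /sigma0 sqr_sqrtr // opnorm_ge0 // expectation_mx_sym. Qed.

Lemma Ex_weighted_le v :
  Ex P (fun w => inner (Z w) (Z w) * inner (Z w) v ^+ 2) <= sigma0 P X ^+ 2 * inner v v.
Proof.
rewrite -weighted_quad sigma0_sqr; apply: le_trans (ler_norm _) _.
by apply: quad_le_opnorm; exact: expectation_mx_sym.
Qed.

Lemma Ex_sqr_le v : Ex P (fun w => inner (Z w) v ^+ 2) <= opnorm Sigma * inner v v.
Proof.
rewrite -covariance_quad; apply: le_trans (ler_norm _) _.
by apply: quad_le_opnorm; exact: covariance_sym.
Qed.

End Population.
Section Kurtosis.
Context (R : realType) (disp : measure_display) (T : measurableType disp).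
Context (P : probability T R) (d : nat) (X : T -> 'cV[R]_d).
Hypotheses (mX : random_vector X) (fm : (fourth_moment P X < +oo)%E).
Local Notation Z := (centered P X).
Local Notation Sigma := (covariance_mx P X).
Local Notation K := (fine (kurtosis_sup P X)).

Lemma marginal_momentE v k : marginal_moment P X v k = Ex P (fun w => inner (Z w) v ^+ k).
Proof. by rewrite /marginal_moment unlock. Qed.

Lemma rint_inner_sqr v : rint P (fun w => inner (Z w) v ^+ 2).
Proof.
exact: (rint_inner2 mX fm v v).
Qed.

Lemma rint_inner_fourth v : rint P (fun w => inner (Z w) v ^+ 4).
Proof.
have := rint_inner4 mX fm v v; congr rint.
by apply/funext => w; rewrite -exprD.
Qed.

Lemma sqr_inner_le (z v : 'cV[R]_d) : inner z v ^+ 2 <= inner z z * inner v v.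
Proof.
rewrite -!norm2_sqr -exprMn -real_normK ?num_real //.
by rewrite ler_pXn2r ?nnegrE ?mulr_ge0 ?norm2_ge0 // inner_CS.
Qed.

Lemma rint_weighted_sqr v : rint P (fun w => inner (Z w) (Z w) * inner (Z w) v ^+ 2).
Proof.
exact: (rint_weighted mX fm v v).
Qed.

Lemma opnorm_covariance_le_trace : opnorm Sigma <= \tr Sigma.
Proof.
have t0 : 0 <= \tr Sigma.
  by rewrite covariance_trace //; apply: Ex_ge0 => w; exact: inner_ge0.
apply: opnorm_le => //; first exact: covariance_sym.
move=> u; rewrite covariance_quad // ger0_norm; last by apply: Ex_ge0 => w; exact: sqr_ge0.
rewrite covariance_trace // mulrC -ExZ; last exact: rint_sqnorm.
apply: Ex_le; [exact: rint_inner_sqr|by apply: rintZ; exact: rint_sqnorm|move=> w].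
by rewrite mulrC sqr_inner_le.
Qed.

(** [(E <Z, u>^2)^2 <= E <Z, u>^4 <= |u|^2 E |Z|^2 <Z, u>^2] *)
Lemma opnorm_covariance_le_sigma0 : opnorm Sigma <= sigma0 P X.
Proof.
apply: opnorm_le; [exact: covariance_sym|exact: sigma0_ge0|move=> u].
rewrite covariance_quad // ger0_norm; last by apply: Ex_ge0 => w; exact: sqr_ge0.
rewrite -[X in _ <= X]mulr1; have -> : (fun w => inner (Z w) u ^+ 2) =
  (fun w => inner (Z w) u ^+ 2 * 1) by apply/funext => w; rewrite mulr1.
apply: Ex_mul_le; rewrite ?mulr_ge0 ?sigma0_ge0 ?inner_ge0 ?ler01 //.
- by under eq_fun do rewrite -exprM; exact: rint_inner_fourth.
- exact: rint_cst.
- by under eq_fun do rewrite mulr1; exact: rint_inner_sqr.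
- rewrite exprMn expr2 [X in _ <= _ * X]expr2 mulrA -expr2 mulrC.
  apply: (@le_trans _ _ (inner u u * Ex P (fun w => inner (Z w) (Z w) * inner (Z w) u ^+ 2))).
    rewrite -ExZ; last exact: rint_weighted_sqr.
    apply: Ex_le => [||w]; first by under eq_fun do rewrite -exprM; exact: rint_inner_fourth.
      by apply: rintZ; exact: rint_weighted_sqr.
    by rewrite mulrA [X in _ <= X * _]mulrC {1}expr2 ler_wpM2r ?sqr_ge0 // sqr_inner_le.
  by rewrite ler_wpM2l ?inner_ge0 // Ex_weighted_le.
- by rewrite Ex_cst.
Qed.

Lemma opnorm_eq0 (A : 'M[R]_d) : A^T = A -> opnorm A = 0 -> A = 0.
Proof.
move=> sA A0; apply/matrixP => i j; rewrite mxE.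
have : norm2 (A *m delta_mx j 0) <= 0.
  rewrite -(mul0r (norm2 (delta_mx j 0))) -A0.
  by apply: norm2_spectral_le => //; [exact: opnorm_ge0|move=> u; exact: quad_le_opnorm].
rewrite le_eqVlt ltNge norm2_ge0 orbF norm2_eq0 -colE => /eqP/colP/(_ i).
by rewrite !mxE.
Qed.

Hypotheses (S0 : Sigma != 0) (Kfin : (kurtosis_sup P X < +oo)%E).

Lemma opnorm_covariance_gt0 : 0 < opnorm Sigma.
Proof.
rewrite lt_def opnorm_ge0 ?covariance_sym // andbT.
by apply: contraNneq S0 => /opnorm_eq0 ->; rewrite ?covariance_sym.
Qed.

Lemma kurtosis_ratio_le v : norm2 v <= 1 -> 0 < Ex P (fun w => inner (Z w) v ^+ 2) ->
  Num.sqrt (Ex P (fun w => inner (Z w) v ^+ 4)) <= K * Ex P (fun w => inner (Z w) v ^+ 2).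
Proof.
move=> v1 v0; rewrite -ler_pdivrMr // -lee_fin.
have vE : ((Num.sqrt (Ex P (fun w => inner (Z w) v ^+ 4)) / Ex P (fun w => inner (Z w) v ^+ 2))%:E
     <= kurtosis_sup P X)%E.
  by apply: ereal_sup_ubound; exists v; rewrite /= ?marginal_momentE.
by rewrite fineK // fin_numElt Kfin andbT (lt_le_trans _ vE) // ltNyr.
Qed.

(** Covers the directions that the supremum defining the kurtosis bound leaves
    out: the marginal vanishes almost surely there. *)
Lemma Ex_fourth_eq0 u : Ex P (fun w => inner (Z w) u ^+ 2) = 0 ->
  Ex P (fun w => inner (Z w) u ^+ 4) = 0.
Proof.
move=> u0; have m2 := rint_measurable (rint_inner_sqr u).
have m4 := rint_measurable (rint_inner_fourth u).
have : (\int[P]_w `|(EFin \o (fun w => (inner (Z w) u ^+ 2)%R)) w| = 0)%E.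
  rewrite -[RHS]/(0%R%:E) -u0 -(EFin_Ex (rint_inner_sqr u)).
  by apply: eq_integral => w _ /=; rewrite ger0_norm ?sqr_ge0.
have m2' : measurable_fun [set: T] (EFin \o (fun w => inner (Z w) u ^+ 2)) by exact/measurable_EFinP.
move=> /(ae_eq_integral_abs P measurableT m2') ae2.
suff : (\int[P]_w (inner (Z w) u ^+ 4)%:E = 0)%E.
  by rewrite (EFin_Ex (rint_inner_fourth u)) => -[].
rewrite -[RHS](integral0 P [set: T]); apply: ge0_ae_eq_integral => //.
- exact/measurable_EFinP.
- by move=> w _; rewrite lee_fin exprn_even_ge0.
apply: filterS ae2 => w /= h /h [] /eqP; rewrite sqrf_eq0 => /eqP ->.
by rewrite expr0n.
Qed.

Lemma Ex_inner_scale c u k : rint P (fun w => inner (Z w) u ^+ k) ->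
  Ex P (fun w => inner (Z w) (c *: u) ^+ k) = c ^+ k * Ex P (fun w => inner (Z w) u ^+ k).
Proof.
by move=> i; rewrite -ExZ //; congr Ex; apply/funext => w; rewrite innerZr exprMn.
Qed.

(** The ratio of moments is homogeneous of degree zero, so the bound on the
    unit ball extends to all vectors; the factor [1 / (1 + |u|)] brings [u] into
    the ball. *)
Lemma Ex_fourth_le u :
  Ex P (fun w => inner (Z w) u ^+ 4) <= (K * Ex P (fun w => inner (Z w) u ^+ 2)) ^+ 2.
Proof.
have E2 : 0 <= Ex P (fun w => inner (Z w) u ^+ 2) by apply: Ex_ge0 => w; exact: sqr_ge0.
have [u0|u0] := eqVneq (Ex P (fun w => inner (Z w) u ^+ 2)) 0.
  by rewrite Ex_fourth_eq0 // sqr_ge0.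
have up : 0 < Ex P (fun w => inner (Z w) u ^+ 2) by rewrite lt_def u0.
pose c := (1 + norm2 u)^-1.
have n1 : 0 < 1 + norm2 u by rewrite ltr_wpDr ?norm2_ge0.
have c0 : 0 < c by rewrite invr_gt0.
have := @kurtosis_ratio_le (c *: u).
rewrite (Ex_inner_scale _ (rint_inner_sqr u)) (Ex_inner_scale _ (rint_inner_fourth u)).
rewrite norm2Z ger0_norm ?(ltW c0) // ler_pdivrMl // mulr1 lerDr ler01.
have c2 : 0 < c ^+ 2 * Ex P (fun w => inner (Z w) u ^+ 2) by rewrite mulr_gt0 // exprn_gt0.
move=> /(_ isT c2) h.
have E4 : 0 <= Ex P (fun w => inner (Z w) u ^+ 4).
  by apply: Ex_ge0 => w; rewrite exprn_even_ge0.
have : (Num.sqrt (c ^+ 4 * Ex P (fun w => inner (Z w) u ^+ 4))) ^+ 2 <=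
    (K * (c ^+ 2 * Ex P (fun w => inner (Z w) u ^+ 2))) ^+ 2.
  by rewrite ler_pXn2r ?nnegrE ?sqrtr_ge0 // (le_trans _ h) // sqrtr_ge0.
rewrite sqr_sqrtr; last by rewrite mulr_ge0 // exprn_ge0 // ltW.
rewrite (mulrCA K) [X in _ <= X]exprMn -exprM.
by rewrite ler_pM2l // exprn_gt0.
Qed.

Lemma kurtosis_ge1 : 1 <= K.
Proof.
have [u u0] : exists u, 0 < inner u (Sigma *m u).
  apply: contrapT => /forallNP h.
  have : opnorm Sigma <= 0.
    apply: opnorm_le => //; first exact: covariance_sym.
    move=> u; rewrite mul0r normr_le0; apply/eqP/le_anti.
    have /negP := h u; rewrite -leNgt => ->.
    by rewrite covariance_quad //; apply: Ex_ge0 => w; exact: sqr_ge0.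
  by rewrite leNgt opnorm_covariance_gt0.
rewrite covariance_quad // in u0.
have n1 : 0 < 1 + norm2 u by rewrite ltr_wpDr ?norm2_ge0.
set v := (1 + norm2 u)^-1 *: u.
have v1 : norm2 v <= 1.
  rewrite /v norm2Z ger0_norm ?invr_ge0 ?(ltW n1) // ler_pdivrMl // mulr1.
  by rewrite lerDr.
have v0 : 0 < Ex P (fun w => inner (Z w) v ^+ 2).
  by rewrite (Ex_inner_scale _ (rint_inner_sqr u)) mulr_gt0 // exprn_gt0 // invr_gt0.
rewrite -(ler_pM2r v0) mul1r; apply: le_trans (kurtosis_ratio_le v1 v0).
rewrite -[X in _ <= X]mulr1; have -> : Ex P (fun w => inner (Z w) v ^+ 2) =
  Ex P (fun w => inner (Z w) v ^+ 2 * 1) by congr Ex; apply/funext => w; rewrite mulr1.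
apply: Ex_mul_le; rewrite ?sqrtr_ge0 ?ler01 //.
- by under eq_fun do rewrite -exprM; exact: rint_inner_fourth.
- exact: rint_cst.
- by under eq_fun do rewrite mulr1; exact: rint_inner_sqr.
- rewrite sqr_sqrtr; last by apply: Ex_ge0 => w; rewrite exprn_even_ge0.
  by under eq_fun do rewrite -exprM.
- by rewrite Ex_cst.
Qed.

(** Expand [|Z|^2] over the coordinates and apply the Cauchy-Schwarz inequality
    and the kurtosis bound to each term.  This makes [K sqrt (|Sigma| tr Sigma)]
    a level above [sigma0], to which the selected level is compared. *)
Lemma sigma0_le_kurtosis : sigma0 P X ^+ 2 <= K ^+ 2 * (opnorm Sigma * \tr Sigma).
Proof.
have K0 : 0 <= K := le_trans ler01 kurtosis_ge1.
have o0 := ltW opnorm_covariance_gt0.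
have t0 := le_trans o0 opnorm_covariance_le_trace.
rewrite sigma0_sqr; apply: opnorm_le; first exact: expectation_mx_sym.
  by rewrite mulr_ge0 ?sqr_ge0 // mulr_ge0.
move=> v; rewrite weighted_quad // ger0_norm; last first.
  by apply: Ex_ge0 => w; rewrite mulr_ge0 ?inner_ge0 ?sqr_ge0.
have -> : (fun w => inner (Z w) (Z w) * inner (Z w) v ^+ 2) =
   (fun w => \sum_i (inner (Z w) (delta_mx i 0) ^+ 2 * inner (Z w) v ^+ 2)).
  apply/funext => w; rewrite -mulr_suml; congr (_ * _); apply: eq_bigr => i _.
  by rewrite innerE_delta expr2.
rewrite Ex_sum => [|i]; last exact: rint_inner4.
have trE : \tr Sigma = \sum_i Ex P (fun w => inner (Z w) (delta_mx i 0) ^+ 2).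
  apply: eq_bigr => i _; rewrite -covariance_quad // innerC innerE_delta -colE.
  by rewrite [RHS]mxE.
have -> : K ^+ 2 * (opnorm Sigma * \tr Sigma) * inner v v =
  \sum_i (K * Ex P (fun w => inner (Z w) (delta_mx i 0) ^+ 2)) * (K * (opnorm Sigma * inner v v)).
  by rewrite -mulr_suml -mulr_sumr -trE; ring.
apply: ler_sum => i _; apply: Ex_mul_le.
- by under eq_fun do rewrite -exprM; exact: rint_inner_fourth.
- by under eq_fun do rewrite -exprM; exact: rint_inner_fourth.
- exact: rint_inner4.
- by rewrite mulr_ge0 //; apply: Ex_ge0 => w; exact: sqr_ge0.
- by rewrite mulr_ge0 // mulr_ge0 // inner_ge0.
- by under eq_fun do rewrite -exprM; exact: Ex_fourth_le.
under eq_fun do rewrite -exprM.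
apply: le_trans (Ex_fourth_le v) _.
have e2 : 0 <= Ex P (fun w => inner (Z w) v ^+ 2) by apply: Ex_ge0 => w; exact: sqr_ge0.
rewrite ler_pXn2r ?nnegrE ?mulr_ge0 ?inner_ge0 //.
by rewrite ler_wpM2l // Ex_sqr_le.
Qed.

End Kurtosis.

(** * Perturbation bounds for a fixed sample *)

Lemma norm2_triangle (R : realType) (d : nat) (x y : 'cV[R]_d) :
  norm2 (x + y) <= norm2 x + norm2 y.
Proof.
rewrite -(@ler_pXn2r _ 2) ?nnegrE ?addr_ge0 ?norm2_ge0 //.
rewrite norm2_sqr innerDl !innerDr (innerC y x) sqrrD !norm2_sqr.
by have := le_trans (ler_norm _) (inner_CS x y); lra.
Qed.

Lemma norm2N (R : realType) (d : nat) (x : 'cV[R]_d) : norm2 (- x) = norm2 x.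
Proof. by rewrite -scaleN1r norm2Z normrN1 mul1r. Qed.

(** Moving from [mu] to the median costs almost the full distance on each of the
    three quarters of the points close to [mu], and gains at most that distance
    on each of the others. *)
Lemma geometric_median_robust (R : realType) (d k : nat) (x : 'I_k -> 'cV[R]_d)
    (z mu : 'cV[R]_d) (rho : R) :
  is_geometric_median x z -> (0 < k)%N -> 0 <= rho ->
  (4 * #|[pred j | (rho <= norm2 (x j - mu))%R]| <= k)%N ->
  norm2 (z - mu) <= 4 * rho.
Proof.
move=> med k0 rho0 nb; set D := norm2 (z - mu).
set bad := [pred j | _] in nb.
have D0 : 0 <= D by exact: norm2_ge0.
have term j : (D - 2 * rho) - (if bad j then 2 * D - 2 * rho else 0) <=
    norm2 (z - x j) - norm2 (mu - x j).
  have t1 : D <= norm2 (z - x j) + norm2 (mu - x j).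
    have -> : D = norm2 ((z - x j) + - (mu - x j)).
      by congr norm2; apply/colP => i; rewrite !mxE; ring.
    by apply: le_trans (norm2_triangle _ _) _; rewrite norm2N.
  have t2 : norm2 (mu - x j) <= norm2 (z - x j) + D.
    have -> : norm2 (mu - x j) = norm2 ((z - x j) + - (z - mu)).
      by congr norm2; apply/colP => i; rewrite !mxE; ring.
    by apply: le_trans (norm2_triangle _ _) _; rewrite norm2N.
  have e : norm2 (mu - x j) = norm2 (x j - mu) by rewrite -norm2N opprB.
  case: ifPn; rewrite /bad /= -?ltNge => h; last by rewrite -e in h; lra.
  lra.
have : \sum_j ((D - 2 * rho) - (if bad j then 2 * D - 2 * rho else 0)) <= 0.
  apply: le_trans (ler_sum _ (fun j _ => term j)) _.
  by rewrite sumrB subr_le0; exact: med.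
rewrite sumrB sumr_const card_ord -big_mkcond /= sumr_const -[_ *+ k]mulr_natr -[_ *+ #|_|]mulr_natr.
have nb' : 4 * (#|bad|%:R : R) <= k%:R by rewrite -natrM ler_nat.
have kp : 0 < k%:R :> R by rewrite ltr0n.
have b0 : 0 <= #|bad|%:R :> R by rewrite ler0n.
move: nb' kp b0; set n : R := #|bad|%:R; set kk : R := k%:R => nb' kp b0 h.
rewrite leNgt; apply/negP => Dr.
have h1 : n * (2 * D - 2 * rho) <= kk / 4 * (2 * D - 2 * rho).
  by rewrite ler_wpM2r //; lra.
have : kk * (D - 3 * rho) <= 0 by lra.
by rewrite leNgt mulr_gt0 //; lra.
Qed.

(** Points well inside the ball are shifted by exactly [delta], which leaves a
    cross term with the sum of the clipped vectors.  The others move by at most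
    [|delta|] and are paid for by the gap between the radii [B] and [B / 2]. *)
Lemma clip_shift_quad (R : realType) (d m : nat) (z : 'I_m -> 'cV[R]_d)
    (delta v : 'cV[R]_d) (B D eta : R) :
  0 < B -> norm2 delta <= D -> 10 * D <= B -> inner v v = 1 -> 0 < eta ->
  `|\sum_i (inner (clip B (z i + delta)) v ^+ 2 - inner (clip B (z i)) v ^+ 2)| <=
  2 * D * `|\sum_i inner (clip B (z i)) v| +
  2 * eta * (\sum_i inner (clip B (z i)) v ^+ 2 - \sum_i inner (clip (B / 2) (z i)) v ^+ 2) +
  m%:R * (4 * D ^+ 2 / eta + D ^+ 2).
Proof.
move=> B0 dD DB v1 eta0.
have D0 : 0 <= D := le_trans (norm2_ge0 _) dD.
have unit x : `|inner x v| <= norm2 x.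
  by apply: le_trans (inner_CS _ _) _; rewrite [norm2 v]norm2E v1 sqrtr1 mulr1.
set a := inner delta v.
have aD : `|a| <= D := le_trans (unit _) dD.
have term i : `|inner (clip B (z i + delta)) v ^+ 2 - inner (clip B (z i)) v ^+ 2
     - 2 * a * inner (clip B (z i)) v| <=
   2 * eta * (inner (clip B (z i)) v ^+ 2 - inner (clip (B / 2) (z i)) v ^+ 2) +
   (4 * D ^+ 2 / eta + D ^+ 2).
  set c := inner (clip B (z i)) v; set c2 := inner (clip (B / 2) (z i)) v.
  have gap0 : 0 <= c ^+ 2 - c2 ^+ 2 by rewrite subr_ge0 clip_half_le // ltW.
  pose e := inner (clip B (z i + delta) - clip B (z i)) v.
  have -> : inner (clip B (z i + delta)) v = c + e.
    by rewrite /e innerDl innerNl -/c addrCA subrr addr0.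
  have eD : `|e| <= D.
    apply: le_trans (unit _) _; apply: le_trans (clip_lipschitz _ _ (ltW B0)) _.
    by rewrite addrC addKr.
  (* [D <= B / 10] keeps such a point inside the ball after the shift *)
  have [zB|zB] := ltP (norm2 (z i)) (9 / 10 * B).
    have zB1 : norm2 (z i) <= B by lra.
    have zB2 : norm2 (z i + delta) <= B.
      by apply: le_trans (norm2_triangle _ _) _; lra.
    have ea : e = a by rewrite /e (clip_small zB2) (clip_small zB1) addrAC subrr add0r.
    rewrite ea (_ : (c + a) ^+ 2 - c ^+ 2 - 2 * a * c = a ^+ 2); last by ring.
    rewrite ger0_norm ?sqr_ge0 //.
    have : a ^+ 2 <= D ^+ 2 by rewrite -real_normK ?num_real // ler_pXn2r ?nnegrE.
    have : 0 <= 2 * eta * (c ^+ 2 - c2 ^+ 2) by rewrite mulr_ge0 // mulr_ge0 // ltW.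
    have : 0 <= 4 * D ^+ 2 / eta by rewrite divr_ge0 ?(ltW eta0) // mulr_ge0 ?sqr_ge0.
    lra.
  have gap := clip_half_gap v B0 zB; rewrite -/c -/c2 in gap.
  rewrite (_ : (c + e) ^+ 2 - c ^+ 2 - 2 * a * c = 2 * c * (e - a) + e ^+ 2); last by ring.
  apply: le_trans (ler_normD _ _) _; rewrite addrA; apply: lerD; last first.
    by rewrite ger0_norm ?sqr_ge0 // -real_normK ?num_real // ler_pXn2r ?nnegrE.
  have ea : `|e - a| <= 2 * D.
    by apply: le_trans (ler_normB _ _) _; lra.
  have amgm : 4 * D * `|c| <= eta * c ^+ 2 + 4 * D ^+ 2 / eta.
    rewrite -(@ler_pM2l _ eta) // mulrDr (mulrC eta (_ / eta)) divfK ?gt_eqF //.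
    have -> : c ^+ 2 = `|c| ^+ 2 by rewrite real_normK ?num_real.
    by have := sqr_ge0 (eta * `|c| - 2 * D); lra.
  rewrite !normrM (ger0_norm (ler0n _ _)).
  apply: (@le_trans _ _ (4 * D * `|c|)).
    have -> : 4 * D * `|c| = 2 * `|c| * (2 * D) by ring.
    by rewrite ler_wpM2l // mulr_ge0.
  have := ler_wpM2l (ltW eta0) gap; lra.
have -> : \sum_i (inner (clip B (z i + delta)) v ^+ 2 - inner (clip B (z i)) v ^+ 2) =
   2 * a * \sum_i inner (clip B (z i)) v +
   \sum_i (inner (clip B (z i + delta)) v ^+ 2 - inner (clip B (z i)) v ^+ 2
     - 2 * a * inner (clip B (z i)) v).
  by rewrite mulr_sumr -big_split; apply: eq_bigr => i _ /=; rewrite addrC subrK.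
apply: le_trans (ler_normD _ _) _; rewrite -addrA; apply: lerD.
  by rewrite !normrM ler_wpM2r // (ger0_norm (ler0n _ _)) ler_wpM2l.
apply: le_trans (ler_norm_sum _ _ _) _.
apply: le_trans (ler_sum _ (fun i _ => term i)) _.
rewrite big_split /= -mulr_sumr sumrB sumr_const card_ord.
by rewrite -[_ *+ m]mulr_natl.
Qed.

Lemma sum_sqr_le_card (R : realType) (m : nat) (A : pred 'I_m) (x : 'I_m -> R) :
  (\sum_(i | A i) x i) ^+ 2 <= #|A|%:R * \sum_(i | A i) x i ^+ 2.
Proof.
pose u : 'cV[R]_m := \col_i (A i)%:R; pose v : 'cV[R]_m := \col_i (if A i then x i else 0).
have := sqr_inner_le u v.
have -> : inner u v = \sum_(i | A i) x i.
  rewrite big_mkcond; apply: eq_bigr => i _; rewrite !mxE.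
  by case: (A i); rewrite ?mul1r ?mul0r.
have -> : inner u u = #|A|%:R.
  rewrite -sum1_card natr_sum big_mkcond; apply: eq_bigr => i _; rewrite !mxE.
  by rewrite unfold_in; case: (A i); rewrite ?mul1r ?mul0r.
suff -> : inner v v = \sum_(i | A i) x i ^+ 2 by [].
rewrite [RHS]big_mkcond; apply: eq_bigr => i _; rewrite !mxE.
by case: (A i); rewrite ?expr2 ?mul0r.
Qed.

(** The sums over good blocks are close to [n0 ec]; the points of the bad blocks
    and those outside all blocks are few, and are paid for by the
    Cauchy-Schwarz inequality. *)
Lemma sum_by_blocks_le (R : realType) (d m k n0 q : nat) (c : 'I_m -> 'cV[R]_d)
    (G : 'I_k -> {set 'I_m}) (ec v : 'cV[R]_d) (t : R) :
  (forall j l, j != l -> [disjoint G j & G l]%bool) -> (forall j, #|G j| = n0) ->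
  inner v v = 1 -> 0 <= t -> (0 < q)%N -> (m <= k * n0 + k)%N ->
  (q * #|[pred j | (t <= inner (\sum_(i in G j) (c i - ec)) (\sum_(i in G j) (c i - ec)))%R]| <= k)%N ->
  (\sum_i inner (c i) v) ^+ 2 <=
  3 * (k%:R ^+ 2 * t + (k%:R * n0%:R) ^+ 2 * inner ec v ^+ 2 +
          (k%:R * n0%:R / q%:R + k%:R) * \sum_i inner (c i) v ^+ 2).
Proof.
move=> disG cG v1 t0 q0 mk; set bad := [pred j | _] => nb.
pose G' j := if bad j then finset.set0 else G j.
have disG' j l : j != l -> [disjoint G' j & G' l]%bool.
  move=> jl; rewrite /G'; case: ifP => _; first by rewrite -finset.setI_eq0 finset.set0I.
  by case: ifP => _; [rewrite -finset.setI_eq0 finset.setI0|exact: disG].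
pose U := (\bigcup_j G' j)%SET.
have sumU (x : 'I_m -> R) : \sum_(i in U) x i = \sum_j \sum_(i in G' j) x i.
  by apply: partition_disjoint_bigcup.
have cU : (#|U| = #|[predC bad]| * n0)%N.
  rewrite -sum1_card partition_disjoint_bigcup // -sum_nat_const.
  rewrite [RHS]big_mkcond; apply: eq_bigr => j _; rewrite sum1_card /G'.
  have -> : (j \in [predC bad]) = ~~ bad j by [].
  by case: (bad j); rewrite ?finset.cards0 ?cG.
have cbad : (#|bad| + #|[predC bad]| = k)%N by rewrite cardC card_ord.
have cUC : (#|[predC U]| <= k + #|bad| * n0)%N.
  have := cardC (mem U); rewrite card_ord cU.
  have -> : #|[predC bad]| = (k - #|bad|)%N by move: cbad; lia.
  have : (#|bad| <= k)%N by move: cbad; lia.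
  move: mk cbad; move: #|[predC U]| #|bad| => u' b mk _ bk eq.
  have : ((k - b) * n0 + b * n0 = k * n0)%N by rewrite -mulnDl subnK.
  lia.
pose x i := inner (c i) v.
pose y j := inner (\sum_(i in G j) (c i - ec)) v.
have gsum j : \sum_(i in G' j) x i = if bad j then 0 else y j + n0%:R * inner ec v.
  rewrite /G'; case: ifP => _; first by rewrite big_set0.
  rewrite /y inner_suml /x; under [in RHS]eq_bigr do rewrite innerDl innerNl.
  by rewrite sumrB sumr_const cG -[_ *+ n0]mulr_natl subrK.
pose g := [predC bad].
have split3 : \sum_i x i = \sum_(j | g j) y j + #|g|%:R * (n0%:R * inner ec v) + \sum_(i | [predC U] i) x i.
  rewrite (bigID (mem U)) /=; congr (_ + _).
  rewrite sumU (eq_bigr _ (fun j _ => gsum j)).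
  rewrite (bigID bad) /= big1 ?add0r => [|j bj]; last by move: bj; rewrite -/(bad j) => ->.
  rewrite (eq_bigr (fun j => y j + n0%:R * inner ec v)); last by move=> j; rewrite -/(bad j) => /negbTE ->.
  by rewrite big_split /= sumr_const -[_ *+ _]mulr_natl.
have y2 j : g j -> y j ^+ 2 <= t.
  rewrite /g /= -ltNge => /ltW h; apply: le_trans (sqr_inner_le _ _) _.
  by rewrite v1 mulr1.
have gk : #|g|%:R <= k%:R :> R by rewrite ler_nat; move: cbad; rewrite /g; lia.
have b1 : (\sum_(j | g j) y j) ^+ 2 <= k%:R ^+ 2 * t.
  apply: le_trans (sum_sqr_le_card g y) _; rewrite expr2 -mulrA ler_pM ?ler0n //.
    by rewrite sumr_ge0 // => j _; rewrite sqr_ge0.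
  apply: le_trans (ler_sum _ y2) _; rewrite sumr_const -[_ *+ _]mulr_natl.
  by rewrite ler_wpM2r.
have b2 : (#|g|%:R * (n0%:R * inner ec v)) ^+ 2 <= (k%:R * n0%:R) ^+ 2 * inner ec v ^+ 2.
  rewrite mulrA exprMn ler_wpM2r ?sqr_ge0 // ler_pXn2r ?nnegrE ?mulr_ge0 //.
  by rewrite ler_wpM2r.
have S0 : 0 <= \sum_i x i ^+ 2 by rewrite sumr_ge0 // => i _; rewrite sqr_ge0.
have b3 : (\sum_(i | [predC U] i) x i) ^+ 2 <= (k%:R * n0%:R / q%:R + k%:R) * \sum_i x i ^+ 2.
  apply: le_trans (sum_sqr_le_card [predC U] x) _; apply: ler_pM; rewrite ?ler0n //.
  - by rewrite sumr_ge0 // => i _; rewrite sqr_ge0.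
  - apply: (@le_trans _ _ (k + #|bad| * n0)%N%:R); first by rewrite ler_nat.
    rewrite natrD natrM addrC lerD2r ler_pdivlMr ?ltr0n // -!natrM ler_nat; nia.
  - rewrite [X in _ <= X](bigID [predC U]) /= lerDl sumr_ge0 // => i _.
    by rewrite sqr_ge0.
rewrite split3; move: b1 b2 b3.
set A := \sum_(j | g j) _; set B := #|g|%:R * _; set E := \sum_(i | _) _.
move=> b1 b2 b3; apply: (@le_trans _ _ (3 * (A ^+ 2 + B ^+ 2 + E ^+ 2))).
  have := sqr_ge0 (A - B); have := sqr_ge0 (A - E); have := sqr_ge0 (B - E); lra.
by rewrite ler_wpM2l ?ler0n // !lerD.
Qed.

(** * Concentration of the clipped sample *)

(** The factor of [mxexp_rank1_up], evaluated at clipped vectors, is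
    compensated by the moment that defines [sigma0]: inside the ball the two
    sides agree, outside the clipped norm is constant. *)
Lemma clip_inflation (R : realType) (d : nat) (B : R) (y v : 'cV[R]_d) : 0 < B ->
  (1 + inner (clip B y) (clip B y) / B ^+ 2) * inner (clip B y) v ^+ 2 <=
  inner y v ^+ 2 + inner y y * inner y v ^+ 2 / B ^+ 2.
Proof.
move=> B0; have [yB|yB] := leP (norm2 y) B.
  by rewrite clip_small // mulrDl mul1r mulrAC.
have n0 := lt_trans B0 yB; rewrite -!norm2_sqr inner_clip_sqr /clip norm2Z.
rewrite (clip_large (ltW B0) yB) ger0_norm ?divr_ge0 ?(ltW B0) ?(ltW n0) //.
rewrite divfK ?gt_eqF // divff ?gt_eqF ?exprn_gt0 // expr_div_n.
move: (inner y v ^+ 2) (sqr_ge0 (inner y v)) => t t0.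
move: (norm2 y) n0 => n n0 in yB *.
have -> : (1 + 1) * (B ^+ 2 / n ^+ 2 * t) = (2 * B ^+ 2 / n ^+ 2) * t by ring.
have -> : t + n ^+ 2 * t / B ^+ 2 = (1 + n ^+ 2 / B ^+ 2) * t by ring.
rewrite ler_wpM2r //; apply: (@le_trans _ _ 2).
  by rewrite ler_pdivrMr ?exprn_gt0 // ler_wpM2l ?ler0n // ler_pXn2r ?nnegrE ?(ltW B0) ?(ltW n0) // ltW.
have : 1 <= n ^+ 2 / B ^+ 2.
  by rewrite ler_pdivlMr ?exprn_gt0 // mul1r ler_pXn2r ?nnegrE ?(ltW B0) ?(ltW n0) // ltW.
lra.
Qed.

(** Counterpart of [clip_inflation] for [mxexp_rank1_down].  With
    [x = |y|^2 / B^2 >= 1] the inequality is [(2 x - 1) (x - 1) >= 0]. *)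
Lemma clip_deflation (R : realType) (d : nat) (B : R) (y v : 'cV[R]_d) : 0 < B ->
  inner y v ^+ 2 - 2 / 3 * (inner y y * inner y v ^+ 2 / B ^+ 2) <=
  (1 - 2 / 3 * (inner (clip B y) (clip B y) / B ^+ 2)) * inner (clip B y) v ^+ 2.
Proof.
move=> B0; have [yB|yB] := leP (norm2 y) B.
  by rewrite clip_small // mulrBl mul1r -[X in _ <= _ - X]mulrA [X in _ <= _ - (_ * X)]mulrAC.
have n0 := lt_trans B0 yB; rewrite -!norm2_sqr inner_clip_sqr /clip norm2Z.
rewrite (clip_large (ltW B0) yB) ger0_norm ?divr_ge0 ?(ltW B0) ?(ltW n0) //.
rewrite divfK ?gt_eqF // divff ?gt_eqF ?exprn_gt0 // expr_div_n.
move: (inner y v ^+ 2) (sqr_ge0 (inner y v)) => t t0.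
move: (norm2 y) n0 => n n0 in yB *.
pose x := n ^+ 2 / B ^+ 2.
have x1 : 1 <= x.
  by rewrite /x ler_pdivlMr ?exprn_gt0 // mul1r ler_pXn2r ?nnegrE ?(ltW B0) ?(ltW n0) // ltW.
have xV : B ^+ 2 / n ^+ 2 = x^-1 by rewrite /x invf_div.
rewrite xV mulr1 (_ : n ^+ 2 * t / B ^+ 2 = x * t); last by rewrite /x; ring.
rewrite (_ : t - _ = (1 - 2 / 3 * x) * t); last by ring.
rewrite [X in _ <= X]mulrA ler_wpM2r // ler_pdivlMr; last by lra.
have h1 : 0 <= x - 1 by lra.
have h2 : 0 <= 2 * x - 1 by lra.
by have := mulr_ge0 h1 h2; lra.
Qed.

Section ClippedCovariance.
Context (R : realType) (disp : measure_display) (T : measurableType disp).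
Context (P : probability T R) (d m : nat) (X : T -> 'cV[R]_d).
Context (Xs : 'I_m -> T -> 'cV[R]_d).
Hypotheses (mX : random_vector X) (fm : (fourth_moment P X < +oo)%E).
Hypothesis iid : iid_copies P X Xs.
Local Notation mu := (mean P X).
Local Notation Z := (centered P X).
Local Notation Sigma := (covariance_mx P X).

Lemma measurable_clip_shift (B : R) (c : 'cV[R]_d) :
  @measurable_mx _ _ (bvec R d) _ _ (fun x : 'cV[R]_d => clip B (x - c)).
Proof.
apply: measurable_clip; apply: measurable_mxB; last exact: measurable_mx_cst.
by move=> i j; rewrite (ord1 j); exact: measurable_coord.
Qed.

Lemma measurable_clip_centered (B : R) : measurable_mx (fun w => clip B (Z w)).
Proof. by apply: measurable_clip; exact: measurable_centered mX. Qed.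

Lemma rint_clip_weighted (B : R) (h : 'cV[R]_d -> R) v : 0 < B ->
  measurable_fun [set: T] (fun w => h (Z w)) -> (forall y, 0 <= h y <= 2) ->
  rint P (fun w => h (Z w) * inner (clip B (Z w)) v ^+ 2).
Proof.
move=> B0 mh hB.
apply: (rint_dominated _ (rintZ 2 (rint_inner_sqr mX fm v))) => [|w].
  apply: measurable_funM => //; apply: measurable_funX.
  by apply: measurable_inner; [exact: measurable_clip_centered|exact: measurable_mx_cst].
have /andP[f0 f1] := hB (Z w); rewrite ger0_norm; last by apply: mulr_ge0 => //; exact: sqr_ge0.
by apply: ler_pM => //; [exact: sqr_ge0|apply: inner_clip_le; exact: ltW].
Qed.

Lemma rint_weighted_div (B : R) v :
  rint P (fun w => inner (Z w) (Z w) * inner (Z w) v ^+ 2 / B ^+ 2).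
Proof.
apply: (eq_ind _ (rint P) (rintZ (B ^+ 2)^-1 (rint_weighted_sqr mX fm v))).
by apply/funext => w; rewrite mulrC.
Qed.

Lemma Ex_weighted_div_le (B : R) v : 0 < B -> inner v v = 1 ->
  Ex P (fun w => inner (Z w) (Z w) * inner (Z w) v ^+ 2 / B ^+ 2) <= sigma0 P X ^+ 2 / B ^+ 2.
Proof.
move=> B0 v1; under [fun w => _]eq_fun do rewrite mulrC.
rewrite ExZ; last exact: rint_weighted_sqr.
rewrite mulrC ler_wpM2r ?invr_ge0 ?exprn_ge0 ?(ltW B0) //.
by have := Ex_weighted_le mX fm v; rewrite v1 mulr1.
Qed.

Lemma clip_ratio_itv (B : R) (y : 'cV[R]_d) : 0 < B ->
  0 <= inner (clip B y) (clip B y) / B ^+ 2 <= 1.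
Proof.
move=> B0; rewrite divr_ge0 ?inner_ge0 ?exprn_ge0 ?(ltW B0) //=.
rewrite ler_pdivrMr ?exprn_gt0 // mul1r -norm2_sqr ler_pXn2r ?nnegrE ?norm2_ge0 ?(ltW B0) //.
exact/norm2_clip/ltW.
Qed.

Lemma measurable_clip_ratio (B : R) :
  measurable_fun [set: T] (fun w => inner (clip B (Z w)) (clip B (Z w)) / B ^+ 2).
Proof.
apply: measurable_funM; last exact: measurable_cst.
by apply: measurable_inner; exact: measurable_clip_centered.
Qed.

Lemma Ex_clip_inflation (B : R) v : 0 < B -> inner v v = 1 ->
  Ex P (fun w => (1 + inner (clip B (Z w)) (clip B (Z w)) / B ^+ 2) * inner (clip B (Z w)) v ^+ 2)
  <= inner v (Sigma *m v) + sigma0 P X ^+ 2 / B ^+ 2.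
Proof.
move=> B0 v1.
apply: (@le_trans _ _ (Ex P (fun w => inner (Z w) v ^+ 2 + inner (Z w) (Z w) * inner (Z w) v ^+ 2 / B ^+ 2))).
  apply: Ex_le => [||w]; last exact: clip_inflation.
  - apply: (@rint_clip_weighted B (fun y => 1 + inner (clip B y) (clip B y) / B ^+ 2)) => //.
      by apply: measurable_funD => //; exact: measurable_clip_ratio.
    by move=> y; have := clip_ratio_itv y B0; lra.
  - by apply: rintD; [exact: rint_inner_sqr|exact: rint_weighted_div].
rewrite ExD; [|exact: rint_inner_sqr|exact: rint_weighted_div].
by rewrite (covariance_quad mX fm) lerD2l Ex_weighted_div_le.
Qed.

Lemma Ex_clip_deflation (B : R) v : 0 < B -> inner v v = 1 ->
  inner v (Sigma *m v) - 2 / 3 * (sigma0 P X ^+ 2 / B ^+ 2) <=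
  Ex P (fun w => (1 - 2 / 3 * (inner (clip B (Z w)) (clip B (Z w)) / B ^+ 2)) *
                 inner (clip B (Z w)) v ^+ 2).
Proof.
move=> B0 v1.
apply: (@le_trans _ _ (Ex P (fun w => inner (Z w) v ^+ 2 -
    2 / 3 * (inner (Z w) (Z w) * inner (Z w) v ^+ 2 / B ^+ 2)))); last first.
  apply: Ex_le => [||w]; last exact: clip_deflation.
  - by apply: rintB; [exact: rint_inner_sqr|apply: rintZ; exact: rint_weighted_div].
  - apply: (@rint_clip_weighted B (fun y => 1 - 2 / 3 * (inner (clip B y) (clip B y) / B ^+ 2))) => //.
      apply: measurable_funB => //; apply: measurable_funM => //; exact: measurable_clip_ratio.
    by move=> y; have := clip_ratio_itv y B0; lra.
rewrite ExB; [|exact: rint_inner_sqr|by apply: rintZ; exact: rint_weighted_div].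
rewrite ExZ; last exact: rint_weighted_div.
rewrite (covariance_quad mX fm) lerB // ler_wpM2l ?Ex_weighted_div_le //.
Qed.

Lemma sqrt_two_thirds (B : R) : 0 < B ->
  Num.sqrt (2 / 3 / B ^+ 2) ^+ 2 = 2 / 3 / B ^+ 2.
Proof. by move=> B0; rewrite sqr_sqrtr // divr_ge0 ?divr_ge0 ?ler0n ?exprn_ge0 ?(ltW B0). Qed.

Lemma inner_sum_outer (x : 'I_m -> 'cV[R]_d) v :
  inner v ((\sum_i x i *m (x i)^T) *m v) = \sum_i inner (x i) v ^+ 2.
Proof.
rewrite mulmx_suml inner_sumr; apply: eq_bigr => i _.
by rewrite mulmx_outer innerZr (innerC v) expr2.
Qed.

(** The matrix random walk has increments [a a^T - c^2 Sigma] with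
    [a = c clip B (x - mu)]; the choice [c^2 = 2 / (3 B^2)] is the largest one
    that [mxexp_rank1_up] allows. *)
Lemma clipped_covariance_upper (B t : R) : 0 < B ->
  exists W : set T, [/\ measurable W,
    (P W <= (d%:R * expR (2 / 3 * (m%:R * (sigma0 P X ^+ 2 / B ^+ 4) - t)))%:E)%E &
    forall w, ~ W w -> forall v, inner v v = 1 ->
      \sum_i inner (clip B (Xs i w - mu)) v ^+ 2 <=
      m%:R * inner v (Sigma *m v) + t * B ^+ 2].
Proof.
move=> B0; have B2 : 0 < B ^+ 2 by rewrite exprn_gt0.
pose c := Num.sqrt (2 / 3 / B ^+ 2 : R).
have cE : c ^+ 2 = 2 / 3 / B ^+ 2 by exact: sqrt_two_thirds.
pose a (x : 'cV[R]_d) := c *: clip B (x - mu).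
have aaE x : inner (a x) (a x) =
    2 / 3 * (inner (clip B (x - mu)) (clip B (x - mu)) / B ^+ 2).
  by rewrite /a innerZl innerZr mulrA -expr2 cE; ring.
have avE x v : inner (a x) v ^+ 2 = c ^+ 2 * inner (clip B (x - mu)) v ^+ 2.
  by rewrite /a innerZl exprMn.
pose Bm := c ^+ 2 *: Sigma.
pose g (x : 'cV[R]_d) := a x *m (a x)^T - Bm.
have BmT : Bm^T = Bm by rewrite /Bm linearZ /= covariance_sym.
have gT x : (g x)^T = g x by rewrite /g trmxB_sym ?trmx_outer.
have c20 : 0 <= c ^+ 2 by exact: sqr_ge0.
have mg : @measurable_mx _ _ (bvec R d) _ _ g.
  apply: measurable_mxB; last exact: measurable_mx_cst.
  apply: measurable_mx_outer; apply: measurable_mxZ; first exact: measurable_cst.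
  exact: measurable_clip_shift.
have b0 : 0 <= c ^+ 2 * (sigma0 P X ^+ 2 / B ^+ 2).
  by apply: mulr_ge0 => //; apply: divr_ge0; [exact: sqr_ge0|exact: ltW].
have step (M : 'M[R]_d) : M^T = M ->
   (\int[P]_w (\tr (mxexp (M + g (X w))))%:E <=
    ((1 + c ^+ 2 * (sigma0 P X ^+ 2 / B ^+ 2)) * \tr (mxexp M))%:E)%E.
  move=> MT; apply: (matrix_upper_step (a := fun w => a (X w))) => //.
  - apply: measurable_mxZ; first exact: measurable_cst.
    exact: measurable_clip_centered.
  - by move=> w; rewrite aaE; have := clip_ratio_itv (X w - mu) B0; lra.
  - move=> v; rewrite /Bm -scalemxAl innerZr mulr_ge0 // (covariance_quad mX fm).
    by apply: Ex_ge0 => w; exact: sqr_ge0.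
  - move=> v v1; rewrite /Bm -scalemxAl innerZr -mulrDr.
    apply: le_trans (ler_wpM2l c20 (Ex_clip_inflation B0 v1)).
    rewrite -ExZ; last first.
      apply: (@rint_clip_weighted B (fun y => 1 + inner (clip B y) (clip B y) / B ^+ 2)) => //.
        by apply: measurable_funD => //; exact: measurable_clip_ratio.
      by move=> y; have := clip_ratio_itv y B0; lra.
    rewrite le_eqVlt; apply/orP; left; apply/eqP; congr Ex; apply/funext => w.
    by rewrite aaE avE -/(centered P X w); field; rewrite gt_eqF.
exists [set w | (expR (2 / 3 * t) <= \tr (mxexp (\sum_i g (Xs i w))))%R]; split.
- apply: measurable_ge_cst; apply: measurable_mxtrace_exp; last first.
    by move=> w; rewrite raddf_sum; apply: eq_bigr => i _; exact: gT.
  apply: measurable_mx_sum => i; case: iid => mXs _ _ k l.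
  exact: (measurableT_comp (mg k l) (mXs i)).
- apply: le_trans (matrix_walk_tail _ mX iid mg gT b0 step) _.
  rewrite lee_fin ler_wpM2l ?ler0n // ler_expR cE le_eqVlt; apply/orP; left; apply/eqP.
  by field; rewrite gt_eqF.
move=> w /= /negP; rewrite -ltNge => Ww v v1.
have ST : (\sum_i g (Xs i w))^T = \sum_i g (Xs i w).
  by rewrite raddf_sum; apply: eq_bigr => i _; exact: gT.
have := le_lt_trans (expR_quad_le_trace ST v1) Ww.
rewrite ltr_expR sumrB sumr_const card_ord mulmxBl innerDr innerNr inner_sum_outer.
rewrite (eq_bigr _ (fun i _ => avE (Xs i w) v)) -mulr_sumr -scaler_nat /Bm scalerA -scalemxAl innerZr cE.
move: (\sum_i _) (inner v _) => S q h.
have h2 : 3 / 2 * B ^+ 2 * (2 / 3 / B ^+ 2 * S - m%:R * (2 / 3 / B ^+ 2) * q)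
   < 3 / 2 * B ^+ 2 * (2 / 3 * t).
  by rewrite ltr_pM2l //; lra.
have e1 : 3 / 2 * B ^+ 2 * (2 / 3 / B ^+ 2 * S - m%:R * (2 / 3 / B ^+ 2) * q) = S - m%:R * q.
  by field; rewrite gt_eqF.
by lra.
Qed.

(** Here [2 |Sigma| <= B^2] keeps the compensator below [1 / 3], so that the
    loss [1 / (1 - k0)] of [matrix_lower_step] restores the constant of the
    upper bound. *)
Lemma clipped_covariance_lower (B t : R) : 0 < B -> 2 * opnorm Sigma <= B ^+ 2 ->
  exists W : set T, [/\ measurable W,
    (P W <= (d%:R * expR (2 / 3 * (m%:R * (sigma0 P X ^+ 2 / B ^+ 4) - t)))%:E)%E &
    forall w, ~ W w -> forall v, inner v v = 1 ->
      m%:R * inner v (Sigma *m v) - t * B ^+ 2 <=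
      \sum_i inner (clip B (Xs i w - mu)) v ^+ 2].
Proof.
move=> B0 SB; have B2 : 0 < B ^+ 2 by rewrite exprn_gt0.
pose c := Num.sqrt (2 / 3 / B ^+ 2 : R).
have cE : c ^+ 2 = 2 / 3 / B ^+ 2 by exact: sqrt_two_thirds.
pose a (x : 'cV[R]_d) := c *: clip B (x - mu).
have aaE x : inner (a x) (a x) =
    2 / 3 * (inner (clip B (x - mu)) (clip B (x - mu)) / B ^+ 2).
  by rewrite /a innerZl innerZr mulrA -expr2 cE; ring.
have avE x v : inner (a x) v ^+ 2 = c ^+ 2 * inner (clip B (x - mu)) v ^+ 2.
  by rewrite /a innerZl exprMn.
pose Bm := c ^+ 2 *: Sigma.
pose g (x : 'cV[R]_d) := Bm - a x *m (a x)^T.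
have BmT : Bm^T = Bm by rewrite /Bm linearZ /= covariance_sym.
have gT x : (g x)^T = g x by rewrite /g trmxB_sym ?trmx_outer.
have c20 : 0 <= c ^+ 2 by exact: sqr_ge0.
have mg : @measurable_mx _ _ (bvec R d) _ _ g.
  apply: measurable_mxB; first exact: measurable_mx_cst.
  apply: measurable_mx_outer; apply: measurable_mxZ; first exact: measurable_cst.
  exact: measurable_clip_shift.
pose b := c ^+ 2 * (2 / 3 * (sigma0 P X ^+ 2 / B ^+ 2)).
have b0 : 0 <= b.
  apply: mulr_ge0 => //; apply: mulr_ge0; first by lra.
  by apply: divr_ge0; [exact: sqr_ge0|exact: ltW].
have k01 : 1 / 3 < 1 :> R by lra.
have b0' : 0 <= b / (1 - 1 / 3) by apply: divr_ge0 => //; lra.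
have step (M : 'M[R]_d) : M^T = M ->
   (\int[P]_w (\tr (mxexp (M + g (X w))))%:E <=
    ((1 + b / (1 - 1 / 3)) * \tr (mxexp M))%:E)%E.
  move=> MT; apply: (matrix_lower_step (a := fun w => a (X w))) => //.
  - apply: measurable_mxZ; first exact: measurable_cst.
    exact: measurable_clip_centered.
  - by move=> w; rewrite aaE; have := clip_ratio_itv (X w - mu) B0; lra.
  - move=> v; rewrite /Bm -scalemxAl innerZr.
    have := le_trans (ler_norm _) (quad_le_opnorm v (covariance_sym P X)).
    move=> /(ler_wpM2l c20) h; apply: le_trans h _; rewrite mulrA ler_wpM2r ?inner_ge0 //.
    rewrite cE mulrAC ler_pdivrMr //; lra.
  - move=> v v1; rewrite /Bm -scalemxAl innerZr -mulrBr.
    apply: le_trans (ler_wpM2l c20 (Ex_clip_deflation B0 v1)) _.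
    rewrite -ExZ; last first.
      apply: (@rint_clip_weighted B (fun y => 1 - 2 / 3 * (inner (clip B y) (clip B y) / B ^+ 2))) => //.
        apply: measurable_funB => //; apply: measurable_funM => //; exact: measurable_clip_ratio.
      by move=> y; have := clip_ratio_itv y B0; lra.
    rewrite le_eqVlt; apply/orP; left; apply/eqP; congr Ex; apply/funext => w.
    by rewrite aaE avE -/(centered P X w); field; rewrite gt_eqF.
exists [set w | (expR (2 / 3 * t) <= \tr (mxexp (\sum_i g (Xs i w))))%R]; split.
- apply: measurable_ge_cst; apply: measurable_mxtrace_exp; last first.
    by move=> w; rewrite raddf_sum; apply: eq_bigr => i _; exact: gT.
  apply: measurable_mx_sum => i; case: iid => mXs _ _ k l.
  exact: (measurableT_comp (mg k l) (mXs i)).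
- apply: le_trans (matrix_walk_tail _ mX iid mg gT b0' step) _.
  rewrite lee_fin ler_wpM2l ?ler0n // ler_expR /b cE le_eqVlt; apply/orP; left; apply/eqP.
  by field; rewrite gt_eqF.
move=> w /= /negP; rewrite -ltNge => Ww v v1.
have ST : (\sum_i g (Xs i w))^T = \sum_i g (Xs i w).
  by rewrite raddf_sum; apply: eq_bigr => i _; exact: gT.
have := le_lt_trans (expR_quad_le_trace ST v1) Ww.
rewrite ltr_expR sumrB sumr_const card_ord mulmxBl innerDr innerNr inner_sum_outer.
rewrite (eq_bigr _ (fun i _ => avE (Xs i w) v)) -mulr_sumr -scaler_nat /Bm scalerA -scalemxAl innerZr cE.
move: (\sum_i _) (inner v _) => S q h.
have h2 : 3 / 2 * B ^+ 2 * (m%:R * (2 / 3 / B ^+ 2) * q - 2 / 3 / B ^+ 2 * S)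
   < 3 / 2 * B ^+ 2 * (2 / 3 * t).
  by rewrite ltr_pM2l //; lra.
have e1 : 3 / 2 * B ^+ 2 * (m%:R * (2 / 3 / B ^+ 2) * q - 2 / 3 / B ^+ 2 * S) = m%:R * q - S.
  by field; rewrite gt_eqF.
by lra.
Qed.

Lemma sqr_Ex_le (f : T -> R) : rint P f -> rint P (fun w => f w ^+ 2) ->
  Ex P f ^+ 2 <= Ex P (fun w => f w ^+ 2).
Proof.
move=> rf rf2; rewrite -subr_ge0; set c := Ex P f.
have : 0 <= Ex P (fun w => (f w - c) ^+ 2) by apply: Ex_ge0 => w; exact: sqr_ge0.
have -> : (fun w => (f w - c) ^+ 2) = (fun w => f w ^+ 2 - 2 * c * f w + c ^+ 2).
  by apply/funext => w; ring.
have r2 := rintZ (2 * c) rf.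
rewrite ExD; [|exact: rintB|exact: rint_cst].
by rewrite ExB // ExZ // Ex_cst -/c; lra.
Qed.

Definition clip_mean (B : R) : 'cV[R]_d := expectation_mx P (fun w => clip B (Z w)).

Lemma measurable_inner_clip B v : measurable_fun [set: T] (fun w => inner (clip B (Z w)) v).
Proof. by apply: measurable_inner; [exact: measurable_clip_centered|exact: measurable_mx_cst]. Qed.

Lemma rint_inner_clip B v : 0 < B -> rint P (fun w => inner (clip B (Z w)) v).
Proof.
move=> B0; apply: (@measurable_rint_bounded _ _ _ _ _ (B * norm2 v)).
  exact: measurable_inner_clip.
move=> w; apply: le_trans (inner_CS _ _) _; rewrite ler_wpM2r ?norm2_ge0 //.
exact/norm2_clip/ltW.
Qed.

Lemma rint_sqnorm_clip B : 0 < B -> rint P (fun w => inner (clip B (Z w)) (clip B (Z w))).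
Proof.
move=> B0; apply: (@measurable_rint_bounded _ _ _ _ _ (B ^+ 2)).
  by apply: measurable_inner; exact: measurable_clip_centered.
move=> w; rewrite ger0_norm ?inner_ge0 // -norm2_sqr.
by rewrite ler_pXn2r ?nnegrE ?norm2_ge0 ?(ltW B0) //; exact/norm2_clip/ltW.
Qed.

Lemma inner_clip_mean B v : 0 < B ->
  inner (clip_mean B) v = Ex P (fun w => inner (clip B (Z w)) v).
Proof.
move=> B0; rewrite /inner Ex_sum => [|i]; last first.
  have := rintZ (v i 0) (rint_inner_clip (delta_mx i 0) B0).
  by under [X in rint _ X]eq_fun do rewrite innerE_delta mulrC.
apply: eq_bigr => i _; rewrite /clip_mean expectation_mxE mulrC -ExZ.
  by congr Ex; apply/funext => w; rewrite mulrC.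
have := rint_inner_clip (delta_mx i 0) B0.
by under [X in rint _ X]eq_fun do rewrite innerE_delta.
Qed.

(** The centered vector has mean zero, so the clipped mean is the mean of what
    clipping removes. *)
Lemma clip_mean_bias B v : 0 < B -> inner v v = 1 ->
  inner (clip_mean B) v ^+ 2 <= sigma0 P X ^+ 2 / B ^+ 2.
Proof.
move=> B0 v1; pose f w := inner (Z w) v - inner (clip B (Z w)) v.
have rf : rint P f by apply: rintB; [exact: rint_inner|exact: rint_inner_clip].
have f2 w : f w ^+ 2 <= inner (Z w) (Z w) * inner (Z w) v ^+ 2 / B ^+ 2 by exact: clip_bias.
have rf2 : rint P (fun w => f w ^+ 2).
  apply: (rint_dominated _ (rint_weighted_div B v)) => [|w].
    by apply: measurable_funX; exact: rint_measurable rf.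
  by rewrite ger0_norm ?sqr_ge0.
have -> : inner (clip_mean B) v ^+ 2 = Ex P f ^+ 2.
  rewrite /f ExB ?(Ex_inner mX fm) ?inner_clip_mean ?sub0r ?sqrrN //.
    exact: rint_inner.
  exact: rint_inner_clip.
apply: le_trans (sqr_Ex_le rf rf2) _; apply: le_trans (Ex_weighted_div_le B0 v1).
by apply: Ex_le => //; exact: rint_weighted_div.
Qed.

(** Clipping decreases second moments, so [tr Sigma] bounds the variance at
    every radius. *)
Lemma few_large_clipped_blocks (k n0 q : nat) (G : 'I_k -> {set 'I_m}) (B r : R) :
  0 < B -> 0 < r <= 1 -> 0 < \tr Sigma -> (0 < n0)%N ->
  (forall j l, j != l -> [disjoint G j & G l]%bool) -> (forall j, #|G j| = n0) ->
  exists W : set T, [/\ measurable W, (P W <= ((2 * r) ^+ k)%:E)%E &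
    forall w, ~ W w ->
     (q * #|[pred j | (n0%:R * \tr Sigma / r ^+ q <=
        inner (\sum_(i in G j) (clip B (Xs i w - mu) - clip_mean B))
              (\sum_(i in G j) (clip B (Xs i w - mu) - clip_mean B)))%R]| <= k)%N].
Proof.
move=> B0 /andP[r0 r1] tr0 n00 disG cG.
pose h (x : 'cV[R]_d) := clip B (x - mu) - clip_mean B.
have hE v : (fun w => inner v (h (X w))) =
    (fun w => inner (clip B (Z w)) v - inner (clip_mean B) v).
  by apply/funext => w; rewrite /h innerDr innerNr !(innerC v).
have hh : (fun w => inner (h (X w)) (h (X w))) =
    (fun w => inner (clip B (Z w)) (clip B (Z w))
      - 2 * inner (clip B (Z w)) (clip_mean B) + inner (clip_mean B) (clip_mean B)).
  apply/funext => w; rewrite /h -/(centered P X w) innerDl innerNl !innerDr !innerNr.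
  by rewrite (innerC (clip_mean B) (clip B _)); ring.
have rc := rint_inner_clip (clip_mean B) B0.
have rhh : rint P (fun w => inner (h (X w)) (h (X w))).
  rewrite hh.
  by apply: rintD; [apply: rintB; [exact: rint_sqnorm_clip|exact: rintZ]|exact: rint_cst].
apply: (few_large_block_sums (h := h) (tau := \tr Sigma) mX iid disG cG).
- apply: measurable_mxB; first exact: measurable_clip_shift.
  exact: measurable_mx_cst.
- move=> v; rewrite hE.
  by apply: rintB; [exact: rint_inner_clip|exact: rint_cst].
- exact: rhh.
- move=> v; rewrite hE.
  rewrite ExB ?Ex_cst; [|exact: rint_inner_clip|exact: rint_cst].
  by rewrite inner_clip_mean // subrr.
- rewrite hh.
  have r1' := rint_sqnorm_clip B0; have r2' := rintZ 2 rc.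
  rewrite ExD; [|exact: rintB|exact: rint_cst].
  rewrite ExB // ExZ // Ex_cst -inner_clip_mean //.
  apply: (@le_trans _ _ (Ex P (fun w => inner (clip B (Z w)) (clip B (Z w))))).
    by have := inner_ge0 (clip_mean B); lra.
  rewrite (covariance_trace mX fm); apply: Ex_le => [//||w].
    exact: rint_sqnorm.
  rewrite -!norm2_sqr ler_pXn2r ?nnegrE ?norm2_ge0 // /clip norm2Z.
  have /andP[c0 c1] := clip_factor_itv (Z w) (ltW B0).
  by rewrite ger0_norm // ler_piMl ?norm2_ge0.
- exact: ltW.
- by rewrite divr_gt0 ?exprn_gt0 // mulr_gt0 // ltr0n.
- by rewrite (ltW r0).
- by rewrite mulrCA divff ?gt_eqF ?exprn_gt0 // mulr1.
Qed.

Lemma few_far_block_means (k n0 q : nat) (G : 'I_k -> {set 'I_m}) (r : R) :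
  0 < r <= 1 -> 0 < \tr Sigma -> (0 < n0)%N ->
  (forall j l, j != l -> [disjoint G j & G l]%bool) -> (forall j, #|G j| = n0) ->
  exists W : set T, [/\ measurable W, (P W <= ((2 * r) ^+ k)%:E)%E &
    forall w, ~ W w ->
     (q * #|[pred j | (Num.sqrt (\tr Sigma / (n0%:R * r ^+ q)) <=
        norm2 (group_mean (fun i => Xs i w) (G j) - mu))%R]| <= k)%N].
Proof.
move=> /andP[r0 r1] tr0 n00 disG cG.
have n0p : 0 < n0%:R :> R by rewrite ltr0n.
pose h (x : 'cV[R]_d) := x - mu.
have [|||||||||W [mW PW HW]] := few_large_block_sums (h := h) (r := r) (tau := \tr Sigma)
   (t := n0%:R * \tr Sigma / r ^+ q) (q := q) mX iid disG cG.
- apply: measurable_mxB; last exact: measurable_mx_cst.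
  by move=> i j; rewrite (ord1 j); exact: measurable_coord.
- move=> v; rewrite (_ : (fun w => _) = (fun w => inner (Z w) v)); first exact: rint_inner.
  by apply/funext => w; rewrite innerC.
- exact: rint_sqnorm.
- move=> v; rewrite (_ : (fun w => _) = (fun w => inner (Z w) v)); first exact: Ex_inner.
  by apply/funext => w; rewrite innerC.
- by rewrite (covariance_trace mX fm).
- exact: ltW.
- by rewrite divr_gt0 ?exprn_gt0 // mulr_gt0.
- by rewrite (ltW r0).
- by rewrite mulrCA divff ?gt_eqF ?exprn_gt0 // mulr1.
exists W; split => // w Ww; apply: leq_trans (HW w Ww); rewrite leq_mul2l; apply/orP; right.
apply/subset_leq_card/fintype.subsetP => j; rewrite !finset.inE.
have -> : group_mean (fun i => Xs i w) (G j) - mu = n0%:R^-1 *: \sum_(i in G j) h (Xs i w).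
  rewrite /group_mean cG /h sumrB sumr_const cG scalerBr -[mu *+ n0]scaler_nat scalerA mulVf ?scale1r //.
  by rewrite gt_eqF.
set Y := \sum_(i in G j) _ => H.
have : Num.sqrt (\tr Sigma / (n0%:R * r ^+ q)) ^+ 2 <= norm2 (n0%:R^-1 *: Y) ^+ 2.
  by rewrite ler_pXn2r ?nnegrE ?norm2_ge0 ?sqrtr_ge0.
have rq : 0 < r ^+ q by rewrite exprn_gt0.
rewrite sqr_sqrtr; last by rewrite divr_ge0 ?(ltW tr0) // mulr_ge0 // ltW.
rewrite norm2_sqr innerZl innerZr => /(ler_wpM2l (ltW (mulr_gt0 n0p n0p))) h1.
have e1 : n0%:R * n0%:R * (\tr Sigma / (n0%:R * r ^+ q)) = n0%:R * \tr Sigma / r ^+ q.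
  by field; rewrite !gt_eqF.
have e2 : n0%:R * n0%:R * (n0%:R^-1 * (n0%:R^-1 * inner Y Y)) = inner Y Y.
  by field; rewrite !gt_eqF.
by rewrite -e1 -[X in _ <= X]e2.
Qed.

End ClippedCovariance.

(** * Error at one level *)

(** Adds up the errors: [5 / 2 s] from concentration, [2 / 100 * 8 s] from the
    gap between the radii (weight [eta = 1 / 100] in [clip_shift_quad]), and the
    cross term, split by [2 D l <= D^2 / (10 K0 e) + 10 K0 e l^2]. *)
Lemma shifted_clip_error (R : realType) (d m : nat) (z : 'I_m -> 'cV[R]_d)
    (delta v : 'cV[R]_d) (B D s nS Sv e K0 q : R) :
  (0 < m)%N -> 0 < B -> norm2 delta <= D -> 10 * D <= B -> inner v v = 1 ->
  0 <= s -> 0 <= nS -> 0 < e -> 1 <= K0 -> 700%:R * K0 <= q -> 2500%:R * K0 * e <= 1 / 4 ->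
  D ^+ 2 <= K0 * e ^+ 2 * nS ->
  \sum_i inner (clip B (z i)) v ^+ 2 <= m%:R * (Sv + 5 / 2 * s) ->
  m%:R * (Sv - 5 / 2 * s) <= \sum_i inner (clip B (z i)) v ^+ 2 ->
  m%:R * (Sv - 11 / 2 * s) <= \sum_i inner (clip (B / 2) (z i)) v ^+ 2 ->
  (\sum_i inner (clip B (z i)) v) ^+ 2 <= m%:R ^+ 2 * (7 / q * nS + 18 * s) ->
  `|m%:R^-1 * \sum_i inner (clip B (z i + delta)) v ^+ 2 - Sv| <=
  276 / 100 * s + 1 / 4 * (e * nS).
Proof.
move=> m0 B0 dD DB v1 s0 nS0 e0 K1 qK Ke D2 H1 H2 H3 HL.
have D0 : 0 <= D := le_trans (norm2_ge0 _) dD.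
have mp : 0 < m%:R :> R by rewrite ltr0n.
have eta0 : 0 < 1 / 100 :> R by lra.
have := clip_shift_quad z B0 dD DB v1 eta0.
rewrite sumrB.
move: (\sum_i inner (clip B (z i + delta)) v ^+ 2) H1 H2 H3 HL => A.
move: (\sum_i inner (clip B (z i)) v ^+ 2) => S2.
move: (\sum_i inner (clip (B / 2) (z i)) v ^+ 2) => S2h.
move: (\sum_i inner (clip B (z i)) v) => L H1 H2 H3 HL H.
pose l := `|L| / m%:R.
have l0 : 0 <= l by rewrite divr_ge0.
have lE : `|L| = m%:R * l by rewrite /l mulrC divfK // gt_eqF.
have l2 : l ^+ 2 <= 7 / q * nS + 18 * s.
  rewrite -(@ler_pM2l _ (m%:R ^+ 2)) ?exprn_gt0 // -exprMn -lE real_normK ?num_real //.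
have qp : 0 < q by lra.
have eK : 0 < 10 * K0 * e by rewrite mulr_gt0 //; lra.
have amgm : 2 * D * l <= D ^+ 2 / (10 * K0 * e) + 10 * K0 * e * l ^+ 2.
  move: (10 * K0 * e) eK => c c0; rewrite -(@ler_pM2l _ c) //.
  have -> : c * (D ^+ 2 / c + c * l ^+ 2) = D ^+ 2 + (c * l) ^+ 2 by field; rewrite gt_eqF.
  by have := sqr_ge0 (D - c * l); lra.
have en : 0 <= e * nS by rewrite mulr_ge0 // ltW.
have t1 : D ^+ 2 / (10 * K0 * e) <= 1 / 10 * (e * nS).
  by rewrite ler_pdivrMr //; apply: le_trans D2 _; lra.
have t2 : 10 * K0 * e * l ^+ 2 <= 1 / 10 * (e * nS) + 18 / 1000%:R * s.
  apply: le_trans (ler_wpM2l (ltW eK) l2) _; rewrite mulrDr; apply: lerD.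
    have -> : 10 * K0 * e * (7 / q * nS) = 70 * K0 / q * (e * nS) by ring.
    by rewrite ler_wpM2r // ler_pdivrMr //; lra.
  by have := ler_wpM2r s0 Ke; lra.
have t3 : 401%:R * D ^+ 2 <= 401%:R / 2500%:R / 4 * (e * nS).
  have := ler_wpM2r en Ke; lra.
have h4 : `|A - S2| <= m%:R * (2 * D * l + 16 / 100 * s + 401%:R * D ^+ 2).
  apply: le_trans H _; rewrite lE.
  have -> : 4 * D ^+ 2 / (1 / 100) + D ^+ 2 = 401%:R * D ^+ 2 by field.
  lra.
have h5 : `|A - m%:R * Sv| <= m%:R * (276 / 100 * s + 1 / 4 * (e * nS)).
  have -> : A - m%:R * Sv = (A - S2) + (S2 - m%:R * Sv) by ring.
  apply: le_trans (ler_normD _ _) _.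
  have h6 : `|S2 - m%:R * Sv| <= m%:R * (5 / 2 * s) by rewrite ler_norml; lra.
  apply: le_trans (lerD h4 h6) _; rewrite -mulrDr ler_wpM2l ?(ltW mp) //.
  lra.
have -> : m%:R^-1 * A - Sv = m%:R^-1 * (A - m%:R * Sv).
  by rewrite mulrBr mulKf // gt_eqF.
rewrite normrM ger0_norm ?invr_ge0 ?(ltW mp) //.
by rewrite [X in X <= _]mulrC ler_pdivrMr // [X in _ <= X]mulrC.
Qed.

(** The clipped sample mean is small compared with the square root of the
    accuracy: [sum_by_blocks_le], with each of its three terms bounded by the
    corresponding share of [nS / q] and [s]. *)
Lemma clipped_mean_le (R : realType) (d m k n0 q : nat) (c : 'I_m -> 'cV[R]_d)
    (G : 'I_k -> {set 'I_m}) (ec v : 'cV[R]_d) (t s nS : R) :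
  (forall j l, j != l -> [disjoint G j & G l]%bool) -> (forall j, #|G j| = n0) ->
  inner v v = 1 -> 0 <= t -> (5 <= q)%N -> (m <= k * n0 + k)%N -> (k * n0 <= m)%N ->
  0 <= s -> 0 <= nS -> (q * k <= m)%N -> inner ec v ^+ 2 <= s ->
  3 * q%:R * k%:R ^+ 2 * t <= m%:R ^+ 2 * nS ->
  \sum_i inner (c i) v ^+ 2 <= m%:R * (nS + 5 / 2 * s) ->
  (q * #|[pred j | (t <= inner (\sum_(i in G j) (c i - ec)) (\sum_(i in G j) (c i - ec)))%R]| <= k)%N ->
  (\sum_i inner (c i) v) ^+ 2 <= m%:R ^+ 2 * (7 / q%:R * nS + 18 * s).
Proof.
move=> disG cG v1 t0 q5 mk km s0 nS0 qk ecs tS S2 nb.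
have q0 : (0 < q)%N by lia.
apply: le_trans (sum_by_blocks_le disG cG v1 t0 q0 mk nb) _.
have qp : 0 < q%:R :> R by rewrite ltr0n.
have q5' : 5 <= q%:R :> R by rewrite ler_nat.
have kn : k%:R * n0%:R <= m%:R :> R by rewrite -natrM ler_nat.
have qk' : k%:R <= m%:R / q%:R :> R by rewrite ler_pdivlMr // -natrM ler_nat mulnC.
have S20 : 0 <= \sum_i inner (c i) v ^+ 2 by rewrite sumr_ge0 // => i _; rewrite sqr_ge0.
move: (\sum_i _) S2 S20 => S2 S2m S20.
have m0 : 0 <= m%:R :> R by [].
have t1 : 3 * (k%:R ^+ 2 * t) <= m%:R ^+ 2 * (nS / q%:R).
  by rewrite [X in _ <= X]mulrA ler_pdivlMr //; lra.
have t2 : (k%:R * n0%:R) ^+ 2 * inner ec v ^+ 2 <= m%:R ^+ 2 * s.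
  apply: ler_pM; [exact: sqr_ge0|exact: sqr_ge0| |exact: ecs].
  by rewrite ler_pXn2r ?nnegrE // -natrM.
have t3 : (k%:R * n0%:R / q%:R + k%:R) * S2 <= m%:R ^+ 2 * (2 / q%:R * (nS + 5 / 2 * s)).
  have -> : m%:R ^+ 2 * (2 / q%:R * (nS + 5 / 2 * s)) =
    (m%:R / q%:R + m%:R / q%:R) * (m%:R * (nS + 5 / 2 * s)) by ring.
  apply: ler_pM; [|exact: S20| |exact: S2m].
    by rewrite addr_ge0 // divr_ge0 // -natrM.
  by apply: lerD; [rewrite ler_wpM2r // invr_ge0|exact: qk'].
have qi : q%:R^-1 <= 1 / 5 :> R by rewrite -div1r ler_pdivrMr //; lra.
have t4 : q%:R^-1 * s <= 1 / 5 * s by rewrite ler_wpM2r.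
have mm := sqr_ge0 (m%:R : R); have ms := mulr_ge0 mm s0.
have : m%:R ^+ 2 * (q%:R^-1 * s) <= m%:R ^+ 2 * (1 / 5 * s) by rewrite ler_wpM2l.
lra.
Qed.

(** [1 / 16 <= e^(-2)], because [e^(- 1 / 2) >= 1 / 2] *)
Lemma expR_block_le (R : realType) (beta : R) (k : nat) : 7 / 2 * beta <= k%:R -> 0 <= beta ->
  (2 * (1 / 32)) ^+ k <= expR (- (4 * beta)).
Proof.
move=> kb b0; have h : 1 / 2 <= expR (- (1 / 2)) :> R.
  by apply: le_trans (expR_ge1Dx _); lra.
have h4 : 2 * (1 / 32) <= expR (- 2) :> R.
  have -> : - 2 = 4 * (- (1 / 2)) :> R by lra.
  rewrite expRM_natl; apply: (@le_trans _ _ ((1 / 2) ^+ 4)); first by rewrite !exprS expr0; lra.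
  by rewrite ler_pXn2r ?nnegrE ?expR_ge0 //; lra.
apply: (@le_trans _ _ (expR (- 2) ^+ k)).
  by apply: lerXn2r; rewrite ?nnegrE ?expR_ge0 //; lra.
by rewrite -expRM_natl ler_expR; lra.
Qed.

(** At radius [B] one has [m sigma0^2 / B^4 <= beta], so the deviation
    [5 / 2 beta] leaves the exponent [- beta].  At radius [B / 2] this quantity
    is [16] times larger, and the deviation [22 beta] leaves [- 4 beta]. *)
Lemma level_deviation (R : realType) (disp : measure_display) (T : measurableType disp)
    (P : probability T R) (d m k n0 q : nat) (X : T -> 'cV[R]_d)
    (Xs : 'I_m -> T -> 'cV[R]_d) (G : 'I_k -> {set 'I_m}) (beta e K0 sigma B eps : R) :
  random_vector X -> (fourth_moment P X < +oo)%E -> iid_copies P X Xs ->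
  (forall j l, j != l -> [disjoint G j & G l]%bool) -> (forall j, #|G j| = n0) ->
  (0 < n0)%N -> (m <= k * n0 + k)%N -> (k * n0 <= m)%N ->
  0 < beta -> 7 / 2 * beta <= k%:R -> k%:R <= 9 / 2 * beta ->
  0 < opnorm (covariance_mx P X) -> 0 < e -> e ^+ 2 * (m%:R * opnorm (covariance_mx P X)) = beta * \tr (covariance_mx P X) ->
  1 <= K0 -> 700%:R * K0 <= q%:R -> 2500%:R * K0 * e <= 1 / 4 ->
  27 / 2 * q%:R * e ^+ 2 <= (1 / 32) ^+ q ->
  9 / 2 * q%:R * e ^+ 2 <= 1 ->
  eps = Num.sqrt (beta / m%:R) -> 0 < B -> B ^+ 2 * eps = sigma -> sigma0 P X <= sigma ->
  exists W : set T, [/\ measurable W,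
    (P W <= (2 * d%:R * expR (- beta) + (d%:R + 1) * expR (- (4 * beta)))%:E)%E &
    forall w, ~ W w -> forall mh, norm2 (mean P X - mh) ^+ 2 <= K0 * e ^+ 2 * opnorm (covariance_mx P X) ->
      opnorm (m%:R^-1 *: (\sum_i clip B (Xs i w - mh) *m (clip B (Xs i w - mh))^T) - (covariance_mx P X))
      <= 276 / 100 * (sigma * eps) + 1 / 4 * (e * opnorm (covariance_mx P X))].
Proof.
move=> mX fm iid disG cG n00 mk km beta0 kb1 kb2 nS0 e0 eE K1 qK Ke qe1 qe2 epsE B0 BE s0s.
have m0 : (0 < m)%N.
  have k0 : (0 < k)%N by rewrite -(ltr0n R); apply: lt_le_trans kb1; rewrite mulr_gt0 //; lra.
  by apply: leq_trans km; rewrite muln_gt0 k0.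
have mp : 0 < m%:R :> R by rewrite ltr0n.
have eps2 : m%:R * eps ^+ 2 = beta.
  by rewrite epsE sqr_sqrtr ?divr_ge0 ?(ltW beta0) // mulrC divfK // gt_eqF.
have eps0 : 0 < eps by rewrite epsE sqrtr_gt0 divr_gt0.
have beta_le : beta <= m%:R * e ^+ 2.
  rewrite -(@ler_pM2r _ (opnorm (covariance_mx P X))) //.
  have := ler_wpM2l (ltW beta0) (opnorm_covariance_le_trace mX fm); rewrite -eE; lra.
have eps_le : eps <= e.
  rewrite -(@ler_pXn2r _ 2) ?nnegrE ?(ltW eps0) ?(ltW e0) // -(@ler_pM2l _ m%:R) //.
  by rewrite eps2.
have e_small : e <= 1 / 1000%:R by have := ler_wpM2r (ltW e0) K1; lra.
have tr0 : 0 < \tr (covariance_mx P X) by exact: lt_le_trans nS0 (opnorm_covariance_le_trace mX fm).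
clear epsE.
have B2 : 0 < B ^+ 2 by rewrite exprn_gt0.
have sg0 : 0 < sigma by rewrite -BE mulr_gt0.
have s00 : 0 <= sigma0 P X by exact: sigma0_ge0.
have nSs : opnorm (covariance_mx P X) <= sigma := le_trans (opnorm_covariance_le_sigma0 mX fm) s0s.
have tB : beta * B ^+ 2 = m%:R * (sigma * eps) by rewrite -{1}eps2 -BE; ring.
(* the growth rate of the potential over the whole sample, at radius [B] *)
have kap : m%:R * (sigma0 P X ^+ 2 / B ^+ 4) <= beta.
  rewrite mulrA ler_pdivrMr ?exprn_gt0 //.
  have -> : beta * B ^+ 4 = m%:R * sigma ^+ 2 by rewrite -{1}eps2 -BE; ring.
  by rewrite ler_pM2l // ler_pXn2r ?nnegrE // ltW.
have SB : 8 * opnorm (covariance_mx P X) <= B ^+ 2.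
  rewrite -(@ler_pM2r _ eps) // BE; apply: le_trans nSs.
  have h : eps <= 1 / 8 by clear -eps_le e_small; lra.
  by have := ler_wpM2l (ltW nS0) h; clear; lra.
have [W1 [mW1 PW1 HW1]] := clipped_covariance_upper mX fm iid (5 / 2 * beta) B0.
have [|W2 [mW2 PW2 HW2]] := clipped_covariance_lower mX fm iid (5 / 2 * beta) B0; first by clear -SB nS0; lra.
have Bh0 : 0 < B / 2 by clear -B0; lra.
have [|W3 [mW3 PW3 HW3]] := clipped_covariance_lower mX fm iid (22 * beta) Bh0.
  by rewrite expr_div_n; clear -SB; lra.
have r01 : 0 < (1 / 32 : R) <= 1 by clear; lra.
have [W4 [mW4 PW4 HW4]] := few_large_clipped_blocks mX fm iid q B0 r01 tr0 n00 disG cG.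
exists (W1 `|` W2 `|` (W3 `|` W4)); split.
- by apply: measurableU; apply: measurableU.
- have U (A C : set T) (a c : R) : measurable A -> measurable C ->
      (P A <= a%:E)%E -> (P C <= c%:E)%E -> (P (A `|` C) <= (a + c)%:E)%E.
    move=> mA mC PA PC; apply: le_trans (measureU2 _ _ _) _ => //.
    by rewrite EFinD; apply: leeD.
  have d0 : 0 <= d%:R :> R by [].
  have b1 : (P W1 <= (d%:R * expR (- beta))%:E)%E.
    by apply: le_trans PW1 _; rewrite lee_fin ler_wpM2l // ler_expR; clear -kap; lra.
  have b2 : (P W2 <= (d%:R * expR (- beta))%:E)%E.
    by apply: le_trans PW2 _; rewrite lee_fin ler_wpM2l // ler_expR; clear -kap; lra.
  have b3 : (P W3 <= (d%:R * expR (- (4 * beta)))%:E)%E.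
    apply: le_trans PW3 _; rewrite lee_fin ler_wpM2l // ler_expR.
    have -> : m%:R * (sigma0 P X ^+ 2 / (B / 2) ^+ 4) = 16 * (m%:R * (sigma0 P X ^+ 2 / B ^+ 4)).
      by field; rewrite gt_eqF.
    by clear -kap beta0; lra.
  have b4 : (P W4 <= (expR (- (4 * beta)))%:E)%E.
    by apply: le_trans PW4 _; rewrite lee_fin expR_block_le // ltW.
  apply: le_trans (U _ _ _ _ _ _ (U _ _ _ _ mW1 mW2 b1 b2) (U _ _ _ _ mW3 mW4 b3 b4)) _.
  + exact: measurableU.
  + exact: measurableU.
  + by rewrite lee_fin; clear; lra.
move=> w nW mh mhK.
have n1 : ~ W1 w by move=> h; apply: nW; left; left.
have n2 : ~ W2 w by move=> h; apply: nW; left; right.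
have n3 : ~ W3 w by move=> h; apply: nW; right; left.
have n4 : ~ W4 w by move=> h; apply: nW; right; right.
have sT : (m%:R^-1 *: (\sum_i clip B (Xs i w - mh) *m (clip B (Xs i w - mh))^T) - (covariance_mx P X))^T =
   m%:R^-1 *: (\sum_i clip B (Xs i w - mh) *m (clip B (Xs i w - mh))^T) - (covariance_mx P X).
  rewrite trmxB_sym ?covariance_sym // linearZ /= raddf_sum; congr (_ *: _).
  by apply: eq_bigr => i _; exact: trmx_outer.
have sge : 0 <= sigma * eps by rewrite mulr_ge0 // ltW.
have ens : 0 <= e * opnorm (covariance_mx P X) by rewrite mulr_ge0 // ltW.
apply: opnorm_le; [exact: sT|by clear -sge ens; lra|].
suff unit v : inner v v = 1 -> `|inner v ((m%:R^-1 *: (\sum_i clip B (Xs i w - mh) *m (clip B (Xs i w - mh))^T) - (covariance_mx P X)) *m v)| <=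
    276 / 100 * (sigma * eps) + 1 / 4 * (e * opnorm (covariance_mx P X)).
  move=> u; have [->|u0] := eqVneq u 0; first by rewrite mulmx0 !inner0l normr0 mulr0.
  have nu : 0 < norm2 u by rewrite lt_def norm2_eq0 u0 norm2_ge0.
  have := unit ((norm2 u)^-1 *: u).
  rewrite -scalemxAr !innerZl !innerZr -norm2_sqr => h.
  have := h _; rewrite {h}; have -> : (norm2 u)^-1 * ((norm2 u)^-1 * norm2 u ^+ 2) = 1.
    by field; rewrite gt_eqF.
  move=> /(_ erefl); rewrite mulrA normrM -expr2 ger0_norm ?sqr_ge0 // exprVn.
  by rewrite mulrC ler_pdivrMr // exprn_gt0.
move=> v1.
have -> : inner v ((m%:R^-1 *: (\sum_i clip B (Xs i w - mh) *m (clip B (Xs i w - mh))^T) - (covariance_mx P X)) *m v) =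
  m%:R^-1 * \sum_i inner (clip B ((Xs i w - mean P X) + (mean P X - mh))) v ^+ 2 - inner v ((covariance_mx P X) *m v).
  rewrite mulmxBl innerDr innerNr -scalemxAl innerZr inner_sum_outer.
  congr (_ * _ - _); apply: eq_bigr => i _; congr (inner (clip B _) v ^+ 2).
  by rewrite addrA subrK.
have Q : 0 <= K0 * e ^+ 2 * opnorm (covariance_mx P X).
  by rewrite mulr_ge0 ?(ltW nS0) // mulr_ge0 ?sqr_ge0 //; clear -K1; lra.
have Svn : inner v ((covariance_mx P X) *m v) <= opnorm (covariance_mx P X).
  have := le_trans (ler_norm _) (quad_le_opnorm v (covariance_sym P X)).
  by rewrite v1 mulr1.
have up : \sum_i inner (clip B (Xs i w - mean P X)) v ^+ 2 <=
    m%:R * (inner v ((covariance_mx P X) *m v) + 5 / 2 * (sigma * eps)).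
  by apply: le_trans (HW1 w n1 v v1) _; clear -tB; lra.
apply: (@shifted_clip_error _ _ _ (fun i => Xs i w - mean P X) (mean P X - mh) v B (Num.sqrt (K0 * e ^+ 2 * opnorm (covariance_mx P X)))
   (sigma * eps) (opnorm (covariance_mx P X)) (inner v ((covariance_mx P X) *m v)) e K0 q%:R) => //.
- by rewrite -(@ler_pXn2r _ 2) ?nnegrE ?norm2_ge0 ?sqrtr_ge0 // [X in _ <= X]sqr_sqrtr.
- rewrite -(@ler_pXn2r _ 2) ?nnegrE ?(ltW B0) //.
  rewrite exprMn sqr_sqrtr // -(@ler_pM2r _ eps) // BE; apply: le_trans nSs.
  have h1 : e ^+ 2 * eps <= 1 / 1000%:R * e.
    have -> : e ^+ 2 * eps = e * eps * e by ring.
    rewrite ler_wpM2r ?(ltW e0) //; apply: le_trans (ler_pM _ _ e_small (_ : eps <= 1)) _; clear -eps_le e_small eps0 e0; lra.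
  have K00 : 0 <= K0 by clear -K1; lra.
  have h2 : 100 * (K0 * (e ^+ 2 * eps)) <= 1.
    by have := ler_wpM2l K00 h1; clear -Ke; lra.
  by have := ler_wpM2l (ltW nS0) h2; clear; lra.
- exact: ltW.
- by rewrite sqr_sqrtr.
- by have := HW2 w n2 v v1; clear -tB; lra.
- have := HW3 w n3 v v1; rewrite expr_div_n; clear -tB; lra.
apply: (clipped_mean_le (ec := clip_mean P X B) (t := n0%:R * \tr (covariance_mx P X) / (1 / 32) ^+ q) disG cG v1 _ _ mk km sge (ltW nS0) _ _ _ _ (HW4 w n4)).
- by rewrite divr_ge0 ?exprn_ge0 // ?mulr_ge0 ?(ltW tr0) //; clear; lra.
- by rewrite -(ler_nat R); clear -qK K1; lra.
- rewrite -(ler_nat R) natrM.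
  have := ler_wpM2l (ler0n R q) kb2; have := ler_wpM2l (ler0n R q) beta_le.
  have := ler_wpM2r (ltW mp) qe2; clear; lra.
- apply: le_trans (clip_mean_bias mX fm B0 v1) _.
  rewrite ler_pdivrMr //; apply: (@le_trans _ _ (sigma ^+ 2)).
    by rewrite ler_pXn2r ?nnegrE // ltW.
  by rewrite expr2 -{2}BE; clear; lra.
- have rq : 0 < (1 / 32) ^+ q :> R by rewrite exprn_gt0 //; clear; lra.
  rewrite mulrA ler_pdivrMr //.
  have kn : k%:R * n0%:R <= m%:R :> R by rewrite -natrM ler_nat.
  have h1 : k%:R ^+ 2 * n0%:R <= 9 / 2 * beta * m%:R.
    by rewrite expr2 -mulrA ler_pM // mulr_ge0.
  have h2 : 3 * q%:R * \tr (covariance_mx P X) * (k%:R ^+ 2 * n0%:R) <= 3 * q%:R * \tr (covariance_mx P X) * (9 / 2 * beta * m%:R).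
    by rewrite ler_wpM2l // mulr_ge0 ?(ltW tr0).
  have h3 := ler_wpM2r (mulr_ge0 (sqr_ge0 (m%:R : R)) (ltW nS0)) qe1.
  have h4 : 27 / 2 * q%:R * e ^+ 2 * (m%:R ^+ 2 * opnorm (covariance_mx P X)) = 27 / 2 * q%:R * m%:R * (beta * \tr (covariance_mx P X)).
    by rewrite -eE; ring.
  by move: h2 h3 h4; clear; lra.
- by apply: le_trans up _; rewrite ler_wpM2l // lerD2r.
Qed.

(** * Selection of the level *)

Lemma cov_estE (R : realType) (d m : nat) (beta smin B : R) (x : 'I_m -> 'cV[R]_d)
    (mu : 'cV[R]_d) (j : int) :
  0 < B -> 0 < sigma_grid smin j ->
  B ^+ 2 * Num.sqrt (beta / m%:R) = sigma_grid smin j ->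
  cov_est beta smin x mu j =
  m%:R^-1 *: \sum_i clip B (x i - mu) *m (clip B (x i - mu))^T.
Proof.
move=> B0 s0 BE; have B2 : 0 < B ^+ 2 by rewrite exprn_gt0.
have e0 : 0 < Num.sqrt (beta / m%:R) by rewrite -(pmulr_rgt0 _ B2) BE.
have tE : theta m beta smin j = (B ^+ 2)^-1.
  by rewrite /theta -BE; field; rewrite !gt_eqF.
rewrite /cov_est tE; under eq_bigr do rewrite mxfun_psi_outer //.
by rewrite -scaler_sumr scalerA invfM invrK -mulrA mulfV ?mulr1 // gt_eqF.
Qed.

(** The grid consists of the first [N] doublings of [smin].  Since the ratio
    [2 smax / smin] is at least [2], rounding its logarithm up at most doubles
    it. *)
Lemma grid_level (R : realType) (smin smax : R) : 0 < smin -> smin <= smax ->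
  exists N : nat, [/\ (0 < N)%N,
    forall j, grid smin smax j <-> exists2 i : nat, (i < N)%N & j = Posz i,
    smax <= sigma_grid smin (Posz N.-1) &
    N%:R <= 2 * (ln (2 * smax / smin) / ln 2)].
Proof.
move=> s0 sM; pose r := 2 * smax / smin.
have r2 : 2 <= r by rewrite /r ler_pdivlMr // ler_wpM2l.
have ex : exists n, r <= 2 ^+ n.
  exists (Num.truncn r).+1; apply: (@le_trans _ _ (Num.truncn r).+1%:R).
    by rewrite ltW // truncnS_gt.
  by rewrite -natrX ler_nat ltnW // ltn_expl.
pose N := ex_minn ex; have : r <= 2 ^+ N /\ forall n, r <= 2 ^+ n -> (N <= n)%N.
  by rewrite /N; case: ex_minnP.
move: N => N [rN Nmin].
have N0 : (0 < N)%N by rewrite lt0n; apply/eqP => N0; move: rN; rewrite N0 expr0; lra.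
have gE i : (sigma_grid smin (Posz i) < 2 * smax) = (i < N)%N.
  have -> : sigma_grid smin (Posz i) = smin * 2 ^+ i by [].
  rewrite [smin * _]mulrC -ltr_pdivlMr // -/r ltnNge.
  case: (ltP (2 ^+ i) r) => h; symmetry; apply/negbTE || idtac.
    by apply/negP => Ni; have := le_trans rN (ler_weXn2l (ler1n _ 2) Ni); rewrite leNgt h.
  by rewrite (Nmin _ h).
have gle i : smin <= sigma_grid smin (Posz i).
  by rewrite -{1}(mulr1 smin) ler_wpM2l ?(ltW s0) // exprn_ege1 // ler1n.
exists N; split => //.
- move=> j; split => [|[i iN ->]]; last by rewrite /grid /= gle gE.
  rewrite /grid /=; case: j => [i /andP[_]|n /andP[h _]]; first by rewrite gE; exists i.
  exfalso; move: h; apply/negP; rewrite -ltNge.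
  have -> : sigma_grid smin (Negz n) = smin * (2 ^+ n.+1)^-1 by [].
  by rewrite -{2}(mulr1 smin) ltr_pM2l // invf_lt1 ?exprn_gt0 // exprn_egt1 // ltr1n.
- have := gE N; rewrite ltnn => /negbT; rewrite -leNgt.
  have -> : sigma_grid smin (Posz N) = 2 * sigma_grid smin (Posz N.-1).
    have -> : sigma_grid smin (Posz N) = smin * 2 ^+ N by [].
    have -> : sigma_grid smin (Posz N.-1) = smin * 2 ^+ N.-1 by [].
    by rewrite -{1}(prednK N0) exprS; ring.
  by rewrite ler_pM2l.
have l2 : 0 < ln 2 :> R by rewrite ln_gt0 // ltr1n.
have h1 : N.-1%:R * ln 2 <= ln r.
  rewrite mulr_natl -lnXn // ler_ln ?posrE ?exprn_gt0 //; last by lra.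
  have := gE N.-1; rewrite prednK // leqnn => h.
  rewrite ltW // /r ltr_pdivlMr // mulrC.
  exact: h.
have h2 : ln 2 <= ln r by rewrite ler_ln ?posrE //; lra.
rewrite -/r mulrA ler_pdivlMr //.
have -> : N%:R = N.-1%:R + 1 :> R by rewrite natr1 prednK.
lra.
Qed.

Lemma jstarP (R : realType) (d m N : nat) (beta smin smax : R)
    (x : 'I_m -> 'cV[R]_d) (mu : 'cV[R]_d) : (0 < N)%N ->
  (forall j, grid smin smax j <-> exists2 i : nat, (i < N)%N & j = Posz i) ->
  admissible beta smin smax x mu (jstar beta smin smax x mu) /\
  forall k, admissible beta smin smax x mu k -> jstar beta smin smax x mu <= k.
Proof.
move=> N0 gP; rewrite /jstar; set A := [set j | _].
have ex : exists n, `[< admissible beta smin smax x mu (Posz n) >].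
  exists N.-1; apply/asboolP; split; first by apply/gP; exists N.-1 => //; rewrite prednK.
  move=> k /gP[i iN ->]; rewrite ltz_nat => h; exfalso.
  by move: iN; rewrite -(prednK N0) ltnS leqNgt h.
case: (ex_minnP ex) => n /asboolP an nmin.
have An : A (Posz n).
  split => // k ak; have [/gP[i iN ki] _] := ak.
  by rewrite ki lez_nat nmin //; apply/asboolP; rewrite -ki.
exact: (@xgetPex _ 0 A (ex_intro _ _ An)).
Qed.

(** Lepski's argument.  The selected level is not above any admissible level
    [i0], hence differs from it by at most the tolerance at [i0].  The bound is
    [6 * 2 st + 276 / 100 * 2 st + 1 / 4 st <= 18 st]. *)
Lemma lepski_error (R : realType) (d m N : nat) (beta smin smax st : R)
    (x : 'I_m -> 'cV[R]_d) (mu : 'cV[R]_d) (Sigma : 'M[R]_d) (s0 : R) :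
  let eps := Num.sqrt (beta / m%:R) in
  let err i := opnorm (cov_est beta smin x mu (Posz i) - Sigma) in
  0 < smin -> (0 < N)%N ->
  (forall j, grid smin smax j <-> exists2 i : nat, (i < N)%N & j = Posz i) ->
  (forall j, (cov_est beta smin x mu j)^T = cov_est beta smin x mu j) ->
  Sigma^T = Sigma ->
  smin <= s0 -> s0 <= sigma_grid smin (Posz N.-1) -> s0 * eps <= st ->
  (forall i : nat, (i < N)%N -> s0 <= sigma_grid smin (Posz i) ->
     err i <= 276 / 100 * (sigma_grid smin (Posz i) * eps) + 1 / 4 * st) ->
  opnorm (cov_adaptive beta smin smax x mu - Sigma) <= 18 * st.
Proof.
move=> eps err smin0 N0 gP cT ST s0min s0N s0st H.
have e0 : 0 <= eps by exact: sqrtr_ge0.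
have sg i : sigma_grid smin (Posz i) = smin * 2 ^+ i by [].
have sgS i : sigma_grid smin (Posz i.+1) = 2 * sigma_grid smin (Posz i).
  by rewrite !sg exprS; ring.
have sg_ge0 i : 0 <= sigma_grid smin (Posz i) by rewrite sg mulr_ge0 ?(ltW smin0) ?exprn_ge0.
have sg_mono i j : (i <= j)%N -> sigma_grid smin (Posz i) <= sigma_grid smin (Posz j).
  by move=> ij; rewrite !sg ler_wpM2l ?(ltW smin0) // ler_weXn2l // ler1n.
have st0 : 0 <= st by apply: le_trans s0st; rewrite mulr_ge0 //; lra.
have [i0 [i0N s0i0 i0st adm]] : exists i0 : nat, [/\ (i0 < N)%N, s0 <= sigma_grid smin (Posz i0),
    sigma_grid smin (Posz i0) * eps <= 2 * st &
    admissible beta smin smax x mu (Posz i0)].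
  have [/existsP [k0 hk0]|/existsPn none] := boolP [exists k : 'I_N,
     (s0 <= sigma_grid smin (Posz k)) && (st <= sigma_grid smin (Posz k) * eps)].
    have ex : exists n, (n < N)%N && ((s0 <= sigma_grid smin (Posz n)) && (st <= sigma_grid smin (Posz n) * eps)).
      by exists k0; rewrite ltn_ord.
    (* the first level above [s0] whose noise reaches [st]: the previous one
       fails one of the two conditions, and either way its noise is below [st] *)
    case: (ex_minnP ex) => n /and3P[nN n1 n2] nmin; exists n.
    have n3 : sigma_grid smin (Posz n) * eps <= 2 * st.
      case: n nmin nN n1 n2 => [|n] nmin nN n1 n2.
        have : sigma_grid smin (Posz 0) * eps <= s0 * eps by rewrite ler_wpM2r // sg expr0 mulr1.
        lra.
      rewrite sgS -mulrA ler_pM2l //.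
      have := contra (nmin n); rewrite ltnn (ltn_trans (ltnSn n) nN) /= => /(_ isT).
      rewrite negb_and -!ltNge => /orP[] h; last exact: ltW.
      by apply: le_trans s0st; rewrite ler_wpM2r // ltW.
    split => //; split; first by apply/gP; exists n.
    move=> k /gP[i iN ->]; rewrite ltz_nat => ni.
    have hi := H i iN (le_trans n1 (sg_mono _ _ (ltnW ni))); have hn := H n nN n1.
    have -> : cov_est beta smin x mu (Posz i) - cov_est beta smin x mu (Posz n) =
       (cov_est beta smin x mu (Posz i) - Sigma) + - (cov_est beta smin x mu (Posz n) - Sigma).
      by rewrite opprB addrA subrK.
    apply: le_trans (opnormD _ _) _; rewrite ?linearN /= ?trmxB_sym // opnormN.
    have ns : 2 * (sigma_grid smin (Posz n) * eps) <= sigma_grid smin (Posz i) * eps.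
      by rewrite mulrA -sgS ler_wpM2r // sg_mono.
    rewrite -/eps -mulrA; move: hi hn ns n2; rewrite /err.
    move: (_ * eps) (_ * eps) (opnorm _) (opnorm _) => a b c c'; lra.
    (* no level is that noisy: the last one will do, being trivially admissible *)
  exists N.-1; have NN : (N.-1 < N)%N by rewrite prednK.
  split => //.
    by have := none (Ordinal NN); rewrite /= s0N /= -ltNge; lra.
  split; first by apply/gP; exists N.-1.
  move=> k /gP[i iN ->]; rewrite ltz_nat => h; exfalso.
  by move: iN; rewrite -(prednK N0) ltnS leqNgt h.
have [[/gP[j jN jE] jadm] jmin] := jstarP beta x mu N0 gP.
have := jmin _ adm; rewrite /cov_adaptive; move: jadm; rewrite jE => jadm.
rewrite lez_nat leq_eqVlt => /orP[/eqP ji|ji].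
  by have := H i0 i0N s0i0; rewrite ji /err; lra.
have := jadm (Posz i0); rewrite ltz_nat => /(_ _ ji) h.
have {}h := h (proj2 (gP _) (ex_intro2 _ _ i0 i0N erefl)).
have hi := H i0 i0N s0i0.
have -> : cov_est beta smin x mu (Posz j) - Sigma =
   - (cov_est beta smin x mu (Posz i0) - cov_est beta smin x mu (Posz j)) +
   (cov_est beta smin x mu (Posz i0) - Sigma).
  by rewrite opprB addrA subrK.
apply: le_trans (opnormD _ _) _; rewrite ?linearN /= ?trmxB_sym // opnormN.
move: h hi; rewrite -/eps -mulrA /err; move: i0st.
move: (_ * eps) (opnorm _) (opnorm _) => a b c; lra.
Qed.

(** * Measurability of the event *)

Section Event.
Context (R : realType) (disp : measure_display) (T : measurableType disp).
Context (d m N : nat) (Xs : 'I_m -> T -> 'cV[R]_d) (muhat : T -> 'cV[R]_d).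
Context (beta smin smax : R).
Hypotheses (mXs : forall i, random_vector (Xs i)) (mmu : random_vector muhat).
Hypotheses (smin0 : 0 < smin) (eps0 : 0 < Num.sqrt (beta / m%:R)).
Hypotheses (N0 : (0 < N)%N)
  (gP : forall j, grid smin smax j <-> exists2 i : nat, (i < N)%N & j = Posz i).
Local Notation est j := (fun w => cov_est beta smin (fun i => Xs i w) (muhat w) j).

Lemma clip_level (j : int) : exists2 B : R, 0 < B &
  B ^+ 2 * Num.sqrt (beta / m%:R) = sigma_grid smin j.
Proof.
have s0 : 0 < sigma_grid smin j by rewrite mulr_gt0 // exprz_gt0.
have q0 : 0 < sigma_grid smin j / Num.sqrt (beta / m%:R) by rewrite divr_gt0.
exists (Num.sqrt (sigma_grid smin j / Num.sqrt (beta / m%:R))); first by rewrite sqrtr_gt0.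
by rewrite sqr_sqrtr ?(ltW q0) // divfK // gt_eqF.
Qed.

Lemma cov_est_sym (x : 'I_m -> 'cV[R]_d) mu j :
  (cov_est beta smin x mu j)^T = cov_est beta smin x mu j.
Proof.
have [B B0 BE] := clip_level j.
rewrite (cov_estE _ _ B0 _ BE); last by rewrite mulr_gt0 // exprz_gt0.
by rewrite linearZ /= raddf_sum; congr (_ *: _); apply: eq_bigr => i _; exact: trmx_outer.
Qed.

Lemma measurable_cov_est j : measurable_mx (est j).
Proof.
have [B B0 BE] := clip_level j.
rewrite (_ : est j = fun w => m%:R^-1 *: \sum_i clip B (Xs i w - muhat w) *m (clip B (Xs i w - muhat w))^T); last first.
  by apply/funext => w; rewrite (cov_estE _ _ B0 _ BE) // mulr_gt0 // exprz_gt0.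
apply: measurable_mxZ; first exact: measurable_cst.
apply: measurable_mx_sum => i; apply: measurable_mx_outer; apply: measurable_clip.
by apply: measurable_mxB; exact: random_vector_mx.
Qed.

Let adm (i : nat) := [set w | admissible beta smin smax (fun i => Xs i w) (muhat w) (Posz i)].

Lemma measurable_admissible (i : nat) : (i < N)%N -> measurable (adm i).
Proof.
move=> iN.
rewrite (_ : adm i = \bigcap_(k in [set` [pred k : 'I_N | (i < k)%N]])
  [set w | opnorm (est (Posz k) w - est (Posz i) w) <= 6 * sigma_grid smin (Posz k) * Num.sqrt (beta / m%:R)]).
  apply: fin_bigcap_measurable; first exact: finite_finset.
  move=> k _; apply: measurable_opnorm_le.
    by apply: measurable_mxB; exact: measurable_cov_est.
  by move=> w; rewrite trmxB_sym // cov_est_sym.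
apply/seteqP; split => w /=.
  move=> [_ H] k /= ik; apply: H; last by rewrite ltz_nat.
  by apply/gP; exists (k : nat).
move=> H; split; first by apply/gP; exists i.
move=> k /gP[l lN ->]; rewrite ltz_nat => il.
exact: (H (Ordinal lN)).
Qed.

(** The selected level takes finitely many values; it is the level [i] exactly
    when [i] is admissible and no smaller level is. *)
Lemma measurable_adaptive_le (Sigma : 'M[R]_d) (c : R) : Sigma^T = Sigma ->
  measurable [set w | opnorm (cov_adaptive beta smin smax (fun i => Xs i w) (muhat w) - Sigma) <= c].
Proof.
move=> ST.
pose first (i : 'I_N) := adm i `&` \bigcap_(k in [set` [pred k : 'I_N | (k < i)%N]]) ~` adm k.
rewrite (_ : [set w | _] = \bigcup_(i in [set: 'I_N])
   (first i `&` [set w | opnorm (est (Posz i) w - Sigma) <= c])).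
  apply: fin_bigcup_measurable; first exact: finite_finset.
  move=> i _; apply: measurableI; first apply: measurableI.
  - exact: measurable_admissible.
  - apply: fin_bigcap_measurable; first exact: finite_finset.
    by move=> k _; apply: measurableC; exact: measurable_admissible.
  - apply: measurable_opnorm_le.
      by apply: measurable_mxB; [exact: measurable_cov_est|exact: measurable_mx_cst].
    by move=> w; rewrite trmxB_sym // cov_est_sym.
apply/seteqP; split => w /=.
  have [[/gP[j jN jE] jadm] jmin] := jstarP beta (fun i => Xs i w) (muhat w) N0 gP.
  rewrite /cov_adaptive jE => H; exists (Ordinal jN) => //; split => //.
  split; first by rewrite /adm /= -jE; split=> //; apply/gP; exists j.
  move=> k /= kj ak; have := jmin _ ak; rewrite jE lez_nat.
  by apply/negP; rewrite -ltnNge.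
move=> [i _ [[ai ni] H]].
have [[/gP[j jN jE] jadm] jmin] := jstarP beta (fun i => Xs i w) (muhat w) N0 gP.
have := jmin _ ai; rewrite /cov_adaptive jE lez_nat leq_eqVlt => /orP[/eqP ->//|ji].
exfalso; apply: (ni (Ordinal jN) ji); rewrite /adm /= -jE; split => //.
by apply/gP; exists j.
Qed.

End Event.

(** * Failure probability and constants *)

Lemma probability_bigsetU_le (R : realType) (disp : measure_display) (T : measurableType disp)
    (P : probability T R) (W : nat -> set T) (p : R) (n : nat) :
  (forall i, measurable (W i)) -> (forall i, (P (W i) <= p%:E)%E) ->
  measurable (\big[setU/set0]_(i < n) W i) /\
  (P (\big[setU/set0]_(i < n) W i) <= (n%:R * p)%:E)%E.
Proof.
move=> mW PW; elim: n => [|n [mU PU]]; first by rewrite big_ord0 measure0 mul0r.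
rewrite big_ord_recr /=; split; first exact: measurableU.
apply: le_trans (measureU2 P mU (mW n)) _.
by rewrite -natr1 mulrDl mul1r EFinD; apply: leeD; [exact: PU|exact: PW].
Qed.

(** [e^(- 3 beta) <= 1 / 8], since [e^(- beta) <= 1 / 2]; this pays for all terms
    in [e^(- 4 beta)] with one [d L e^(- beta)]. *)
Lemma failure_budget (R : realType) (d N : nat) (beta L : R) : (0 < d)%N -> 1 < beta -> 1 <= L ->
  N%:R <= 2 * L ->
  expR (- (4 * beta)) +
  N%:R * (2 * d%:R * expR (- beta) + (d%:R + 1) * expR (- (4 * beta))) <=
  5 * d%:R * L * expR (- beta).
Proof.
move=> d0 b1 L1 NL; have d1 : 1 <= d%:R :> R by rewrite ler1n.
have h : expR (- beta) <= 1 / 2.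
  rewrite expRN -div1r ler_pdivrMr ?expR_gt0 //.
  have := expR_ge1Dx beta; lra.
have -> : expR (- (4 * beta)) = expR (- beta) ^+ 4.
  by rewrite -mulrN expRM_natl.
have x0 := expR_ge0 (- beta); move: (expR (- beta)) h x0 => x h x0.
have x4 : x ^+ 4 <= 1 / 8 * x.
  have x2 : x ^+ 3 <= (1 / 2) ^+ 3 by rewrite ler_pXn2r ?nnegrE //; lra.
  by rewrite exprSr ler_wpM2r //; apply: le_trans x2 _; lra.
have dL : 1 <= d%:R * L.
  by apply: le_trans d1 _; rewrite ler_peMr //; lra.
have c0 : 0 <= 2 * d%:R * x + (d%:R + 1) * x ^+ 4.
  by rewrite addr_ge0 ?mulr_ge0 ?exprn_ge0 //; lra.
apply: le_trans (lerD x4 (ler_wpM2r c0 NL)) _.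
have h1 : (d%:R + 1) * x ^+ 4 <= (2 * d%:R) * (1 / 8 * x).
  by apply: ler_pM => //; rewrite ?exprn_ge0 //; lra.
have L0 : 0 <= 2 * L by lra.
have h2 := ler_wpM2l L0 h1.
have h3 := ler_wpM2r x0 dL.
lra.
Qed.

Lemma nb_groups_itv (R : realType) (beta : R) : 1 < beta ->
  7 / 2 * beta <= (nb_groups beta)%:R <= 9 / 2 * beta.
Proof.
move=> b1; rewrite /nb_groups; set x := 7 / 2 * beta.
have x0 : 0 <= x by rewrite /x; lra.
rewrite (ltW (truncnS_gt x)) /= -natr1.
by have := truncn_le x; rewrite x0 /x; lra.
Qed.

(** Combines [few_far_block_means] with [geometric_median_robust].  The constant
    [144] is [4 ^ 2] from the latter times [9], because a block has at least
    [m / (2 k)] points and [k <= 9 / 2 beta]. *)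
Lemma geometric_median_deviation (R : realType) (disp : measure_display)
    (T : measurableType disp) (P : probability T R) (d m k n0 : nat) (X : T -> 'cV[R]_d)
    (Xs : 'I_m -> T -> 'cV[R]_d) (G : 'I_k -> {set 'I_m}) (muhat : T -> 'cV[R]_d) (beta r : R) :
  random_vector X -> (fourth_moment P X < +oo)%E -> iid_copies P X Xs ->
  (forall j l, j != l -> [disjoint G j & G l]%bool) -> (forall j, #|G j| = n0) ->
  (0 < n0)%N -> (0 < k)%N -> (m <= 2 * (k * n0))%N -> 0 < r <= 1 ->
  k%:R <= 9 / 2 * beta -> 0 < \tr (covariance_mx P X) ->
  (forall w, is_geometric_median (fun j => group_mean (fun i => Xs i w) (G j)) (muhat w)) ->
  exists W : set T, [/\ measurable W, (P W <= ((2 * r) ^+ k)%:E)%E &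
    forall w, ~ W w ->
      m%:R * norm2 (mean P X - muhat w) ^+ 2 <=
      144 / r ^+ 4 * (beta * \tr (covariance_mx P X))].
Proof.
move=> mX fm iid disG cG n00 k0 mk r01 kb tr0 med.
have [W [mW PW HW]] := few_far_block_means mX fm iid 4 r01 tr0 n00 disG cG.
have /andP[r0 _] := r01; have rq : 0 < r ^+ 4 by rewrite exprn_gt0.
exists W; split => // w Ww.
have := geometric_median_robust (med w) k0 (sqrtr_ge0 _) (HW w Ww).
have np : 0 < n0%:R :> R by rewrite ltr0n.
have q0 : 0 <= \tr (covariance_mx P X) / (n0%:R * r ^+ 4).
  by rewrite divr_ge0 ?(ltW tr0) // mulr_ge0 // ltW.
move=> h; have {h} := ler_pM (norm2_ge0 _) (norm2_ge0 _) h h; rewrite -!expr2.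
rewrite exprMn (sqr_sqrtr q0) -norm2N opprB => h.
have m0 : 0 <= m%:R :> R by [].
apply: le_trans (ler_wpM2l m0 h) _.
have mkR : m%:R <= 2 * (k%:R * n0%:R) :> R by rewrite -!natrM ler_nat.
have -> : m%:R * (4 ^+ 2 * (\tr (covariance_mx P X) / (n0%:R * r ^+ 4))) =
   m%:R / n0%:R * (16 * (\tr (covariance_mx P X) / r ^+ 4)).
  by field; rewrite !gt_eqF.
have -> : 144 / r ^+ 4 * (beta * \tr (covariance_mx P X)) =
   (9 * beta) * (16 * (\tr (covariance_mx P X) / r ^+ 4)).
  by field; rewrite gt_eqF.
rewrite ler_wpM2r //; first by rewrite mulr_ge0 // divr_ge0 ?(ltW tr0) ?(ltW rq).
rewrite ler_pdivrMr //; apply: le_trans mkR _.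
by rewrite mulrA ler_wpM2r //; lra.
Qed.

(** The proportion [1 / q] of bad blocks is fixed first; the accuracy [e] must
    then beat the probability [(1 / 32) ^ q] that a block is allowed to be bad
    with, hence depends on [q]. *)
Lemma accuracy_constant (R : realType) (K0 : R) : 1 <= K0 ->
  exists (q : nat) (c0 : R), [/\ 0 < c0, 700%:R * K0 <= q%:R &
    forall e, 0 < e -> e ^+ 2 <= c0 ->
     [/\ 2500%:R * K0 * e <= 1 / 4,
         27 / 2 * q%:R * e ^+ 2 <= (1 / 32) ^+ q &
         9 / 2 * q%:R * e ^+ 2 <= 1]].
Proof.
move=> K1; have [q qK] : exists q : nat, 700%:R * K0 <= q%:R.
  by exists (Num.truncn (700%:R * K0)).+1; rewrite ltW // truncnS_gt.
have q1 : 1 <= q%:R :> R by lra.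
(* [a ^ 2] meets the first condition on [e ^ 2], and [f] the other two *)
pose a : R := (100 * 100 * K0)^-1.
have D0 : 0 < 100 * 100 * K0 by lra.
have a0 : 0 < a by rewrite invr_gt0.
have aE : 100 * 100 * K0 * a = 1 by rewrite mulfV // gt_eqF.
have a1 : a <= 1 by rewrite invf_le1 //; lra.
pose r : R := (1 / 32) ^+ q.
have r0 : 0 < r by rewrite exprn_gt0 //; lra.
have r1 : r <= 1 by rewrite exprn_ile1 //; lra.
pose f : R := 2 / 27 * r / q%:R.
have f0 : 0 < f by rewrite divr_gt0 ?mulr_gt0 ?divr_gt0 //; lra.
have fE : 27 / 2 * q%:R * f = r by rewrite /f; field; rewrite gt_eqF //; lra.
have f1 : f <= 1.
  have : 1 * f <= q%:R * f by rewrite ler_wpM2r // ltW.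
  lra.
exists q, (a ^+ 2 * f); split => //; first by rewrite mulr_gt0 ?exprn_gt0.
move=> e e0 ec.
have ea : e <= a.
  rewrite -(@ler_pXn2r _ 2) ?nnegrE ?(ltW e0) ?(ltW a0) //; apply: le_trans ec _.
  by rewrite ler_piMr ?sqr_ge0.
have ef : e ^+ 2 <= f.
  by apply: le_trans ec _; rewrite ler_piMl ?(ltW f0) // exprn_ile1 // ltW.
have qe : 27 / 2 * q%:R * e ^+ 2 <= r.
  rewrite -fE ler_wpM2l //; lra.
split; [|exact: qe|lra].
have := ler_wpM2l (ltW D0) ea; rewrite aE; lra.
Qed.

(** * The adaptive estimator *)

Theorem corollary2p2 (R : realType) :
  exists C : R, 0 < C /\
  forall (disp : measure_display) (T : measurableType disp)
    (P : probability T R) (d m : nat)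
    (X : T -> 'cV[R]_d) (Xs : 'I_m -> T -> 'cV[R]_d)
    (beta smin smax : R)
    (G : 'I_(nb_groups beta) -> {set 'I_m}) (muhat : T -> 'cV[R]_d),
  random_vector X ->
  (fourth_moment P X < +oo)%E ->
  covariance_mx P X != 0 ->
  iid_copies P X Xs ->
  1 < beta ->
  (nb_groups beta)%:R <= m%:R / 2%:R :> R ->
  is_grouping G ->
  random_vector muhat ->
  (forall w, is_geometric_median
     (fun j => group_mean (fun i => Xs i w) (G j)) (muhat w)) ->
  0 < smin -> smin <= sigma0 P X -> sigma0 P X <= smax ->
  C * beta * effective_rank (covariance_mx P X) <= m%:R ->
  (kurtosis_sup P X < +oo)%E ->
  ((1 - 5%:R * d%:R * (ln (2%:R * smax / smin) / ln 2%:R) * expR (- beta))%:E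
   <= P [set w | (opnorm (cov_adaptive beta smin smax (fun i => Xs i w) (muhat w)
                         - covariance_mx P X)
            <= 18%:R * fine (kurtosis_sup P X) * opnorm (covariance_mx P X)
               * Num.sqrt (effective_rank (covariance_mx P X) * beta / m%:R))%R])%E.
Proof.
pose K0 : R := 144 / (1 / 32) ^+ 4.
have r4 : 0 < (1 / 32 : R) ^+ 4 <= 1.
  by rewrite exprn_gt0 ?exprn_ile1 //; lra.
have K1 : 1 <= K0.
  have /andP[h1 h2] := r4; rewrite /K0 ler_pdivlMr //; lra.
have [q [c0 [c00 qK tune]]] := accuracy_constant K1.
exists c0^-1; split; first by rewrite invr_gt0.
move=> disp T P d m X Xs beta smin smax G muhat mX fm S0 iid b1 km isG mmu med smin0 sm0 s0M Cm Kfin.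
have [cG disG] := isG; set k := nb_groups beta in G km isG med cG disG *.
have /andP[kb1 kb2] := nb_groups_itv b1; rewrite -/k in kb1 kb2.
have b0 : 0 < beta by lra.
have k0 : (0 < k)%N by [].
have km' : (k * 2 <= m)%N by rewrite -(ler_nat R) natrM; move: km; clear; lra.
pose n0 := (m %/ k)%N.
have n00 : (0 < n0)%N by rewrite divn_gt0 //; move: km' k0; clear; lia.
have mdiv : (n0 * k <= m)%N := leq_divM m k.
have mdiv2 : (m < n0 * k + k)%N.
  by rewrite {1}(divn_eq m k) ltn_add2l ltn_mod.
have m0 : (0 < m)%N by move: km' k0; clear; lia.
have mp : 0 < m%:R :> R by rewrite ltr0n.
have nS0 := opnorm_covariance_gt0 S0.
have ST := covariance_sym P X.
have trS := opnorm_covariance_le_trace mX fm.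
have tr0 : 0 < \tr (covariance_mx P X) := lt_le_trans nS0 trS.
(* [e] is the relative accuracy; [e^2 m |Sigma| = beta tr Sigma] is the form in
   which the effective rank is used *)
pose rho := effective_rank (covariance_mx P X) * beta / m%:R.
pose e := Num.sqrt rho; pose eps := Num.sqrt (beta / m%:R).
have rho0 : 0 < rho.
  by apply: divr_gt0 => //; apply: mulr_gt0 => //; exact: divr_gt0.
have e0 : 0 < e by rewrite sqrtr_gt0.
have e2 : e ^+ 2 = rho by rewrite sqr_sqrtr // ltW.
have eE : e ^+ 2 * (m%:R * opnorm (covariance_mx P X)) = beta * \tr (covariance_mx P X).
  by rewrite e2 /rho /effective_rank; field; rewrite !gt_eqF.
have [|Ke qe1 qe2] := tune e e0.
  rewrite e2 /rho ler_pdivrMr // -ler_pdivrMl //.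
  by move: Cm; rewrite -mulrA (mulrC beta).
have eps0 : 0 < eps by rewrite sqrtr_gt0 divr_gt0.
have eps2 : eps ^+ 2 * m%:R = beta by rewrite sqr_sqrtr ?divfK ?gt_eqF // ltW // divr_gt0.
have Kk := kurtosis_ge1 mX fm S0 Kfin.
have sK := sigma0_le_kurtosis mX fm S0 Kfin.
set Kr := fine (kurtosis_sup P X) in Kk sK *.
set nS := opnorm (covariance_mx P X) in nS0 trS eE sK *.
(* the error bound is [18 st]; [st] dominates the noise at [sigma0] *)
pose st := Kr * nS * e.
have st_s0 : sigma0 P X * eps <= st.
  have s00 : 0 <= sigma0 P X := sigma0_ge0 P X.
  have st0 : 0 <= st by rewrite /st; apply: mulr_ge0; [apply: mulr_ge0|]; clear -Kk nS0 e0; lra.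
  rewrite -(@ler_pXn2r _ 2) ?nnegrE //; last by apply: mulr_ge0 => //; exact: ltW.
  rewrite -(@ler_pM2r _ m%:R) // exprMn -mulrA eps2 /st !exprMn.
  have -> : Kr ^+ 2 * nS ^+ 2 * e ^+ 2 * m%:R = Kr ^+ 2 * nS * (e ^+ 2 * (m%:R * nS)) by ring.
  by rewrite eE; have := ler_wpM2r (ltW b0) sK; clear; lra.
have ste : e * nS <= st.
  by rewrite /st -mulrA (mulrC nS) ler_peMl // mulr_ge0 // ltW.
have [N [N0 gP Nmax NL]] := grid_level smin0 (le_trans sm0 s0M).
set L := ln (2 * smax / smin) / ln 2 in NL *.
have mXs : forall i, random_vector (Xs i) by case: iid.
have [W0 [mW0 PW0 HW0]] : exists W : set T, [/\ measurable W,
    (P W <= (expR (- (4 * beta)))%:E)%E &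
    forall w, ~ W w -> norm2 (mean P X - muhat w) ^+ 2 <= K0 * e ^+ 2 * nS].
  have mkn : (m <= 2 * (k * n0))%N by move: mdiv2 n00; clear; nia.
  have r1 : 0 < (1 / 32 : R) <= 1 by clear; lra.
  have [W [mW PW HW]] := geometric_median_deviation mX fm iid disG cG n00 k0 mkn r1 kb2 tr0 med.
  exists W; split => //.
    by apply: le_trans PW _; rewrite lee_fin expR_block_le // ltW.
  move=> w Ww; rewrite -(@ler_pM2l _ m%:R) //; apply: le_trans (HW w Ww) _.
  by rewrite -/K0 -eE; clear; lra.
pose p := 2 * d%:R * expR (- beta) + (d%:R + 1) * expR (- (4 * beta)).
have p0 : 0 <= p by rewrite addr_ge0 ?mulr_ge0 ?expR_ge0 // addr_ge0.
have lev (i : nat) : exists W : set T, [/\ measurable W, (P W <= p%:E)%E &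
    sigma0 P X <= sigma_grid smin (Posz i) -> forall w, ~ W w -> forall mh,
     norm2 (mean P X - mh) ^+ 2 <= K0 * e ^+ 2 * nS ->
     opnorm (cov_est beta smin (fun i => Xs i w) mh (Posz i) - covariance_mx P X)
     <= 276 / 100 * (sigma_grid smin (Posz i) * eps) + 1 / 4 * (e * nS)].
  (* nothing is claimed below [sigma0] *)
  have [s0s|s0s] := leP (sigma0 P X) (sigma_grid smin (Posz i)); last first.
    by exists set0; split => //; rewrite measure0 lee_fin.
  have [B B0 BE] := clip_level smin0 eps0 (Posz i).
  have km2 : (k * n0 <= m)%N by rewrite mulnC.
  have mk2 : (m <= k * n0 + k)%N by rewrite mulnC ltnW.
  have [W [mW PW HW]] := level_deviation mX fm iid disG cG n00 mk2 km2 b0 kb1 kb2 nS0 e0 eE K1 qK Ke qe1 qe2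
     (erefl eps) B0 BE s0s.
  exists W; split => // _ w Ww mh hmh; rewrite (cov_estE _ _ B0 _ BE); first exact: HW.
  by rewrite mulr_gt0 // exprn_gt0.
have [W HW] := choice lev.
have [mU PU] := @probability_bigsetU_le _ _ _ P W p N (fun i => let: And3 a _ _ := HW i in a)
  (fun i => let: And3 _ a _ := HW i in a).
set U := \big[setU/set0]_(i < N) W i in mU PU.
set E := [set w | _].
have mE : measurable E.
  exact: (measurable_adaptive_le mXs mmu smin0 eps0 N0 gP).
(* outside the bad events the selection argument applies pointwise *)
have badE : ~` (W0 `|` U) `<=` E.
  move=> w nW; rewrite /E /= -/rho -/e -!mulrA (mulrA Kr) -/st.
  apply: (lepski_error (s0 := sigma0 P X) (N := N) smin0 N0 gP _ ST sm0 _ st_s0).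
  - by move=> j; exact: (cov_est_sym smin0 eps0).
  - exact: le_trans s0M Nmax.
  move=> i iN s0i; have [_ _ H] := HW i.
  apply: le_trans (H s0i w _ (muhat w) _) _.
  - by move=> Wi; apply: nW; right; rewrite /U -bigcup_mkord; exists i.
  - by apply: HW0 => W0w; apply: nW; left.
  - by rewrite lerD2l; move: ste; clear; lra.
have d0 : (0 < d)%N.
  rewrite lt0n; apply/eqP => d0; move: S0 => /eqP; apply; apply/matrixP => i.
  by exfalso; move: (ltn_ord i); rewrite {2}d0.
have l2 : 0 < ln 2 :> R by rewrite ln_gt0 // ltr1n.
have L1 : 1 <= L.
  rewrite /L ler_pdivlMr // mul1r ler_ln ?posrE //.
    by rewrite ler_pdivlMr // ler_wpM2l //; clear -sm0 s0M; lra.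
  by rewrite divr_gt0 // mulr_gt0 //; clear -smin0 sm0 s0M; lra.
have budget := failure_budget d0 b1 L1 NL.
have PB : (P (W0 `|` U) <= (5 * d%:R * L * expR (- beta))%:E)%E.
  apply: le_trans (measureU2 P mW0 mU) _.
  apply: (@le_trans _ _ (expR (- (4 * beta)) + N%:R * p)%:E); last by rewrite lee_fin.
  by rewrite EFinD; apply: leeD.
have mB : measurable (W0 `|` U) by exact: measurableU.
apply: (@le_trans _ _ (P (~` (W0 `|` U)))).
  rewrite probability_setC // EFinB; apply: leeB => //.
by apply: le_measure; rewrite ?inE //; exact: measurableC.
Qed.
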